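(* For every graph $H$ and every $\gamma > 0$, there exists $C > 0$ such that if $p = p(n) \geq C n^{-1/m_2(H)}$, then asymptotically almost surely every $H$-free subgraph $G' \subseteq G_{n,p}$ with minimum degree $\delta(G') \geq \left(1 - \frac{3}{3\chi(H) - 4} + \gamma\right) p n$ may be made $(\chi(H)-1)$-partite by removing from it at most $\gamma p n^2$ edges.
   Context: $G_{n,p}$ is the binomial random graph on $n$ vertices with edge probability $p$; ''asymptotically almost surely'' means with probability tending to $1$ as $n\to\infty$. $\chi(H)$ is the chromatic number of $H$. The $2$-density is $m_2(H) = \max\{ (e(H')-1)/(v(H')-2) : H' \subseteq H,\ v(H') \geq 3\}$, with $m_2(K_2) = 1/2$. *)

(* Defs.v *)
From HB Require Import structures.
From mathcomp Require Import all_boot all_order all_algebra.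
From mathcomp Require Import all_classical all_reals all_analysis.

Set Implicit Arguments.
Unset Strict Implicit.
Unset Printing Implicit Defensive.

Import Order.TTheory GRing.Theory Num.Theory.
Import numFieldNormedType.Exports.

Local Open Scope ring_scope.

(* Finite simple graphs whose vertices lie in an ambient finite type T: a pair
   (vertex set, edge set), every edge being a 2-element set of vertices.  The
   vertex set need not be all of T, so that subgraphs of a graph over T are
   again graphs over T. *)
Definition is_graph (T : finType) (g : {set T} * {set {set T}}) : bool :=
  [forall e in g.2, (e \subset g.1) && (#|e| == 2)%N].

Record graph (T : finType) := Graph {
  graph_val : {set T} * {set {set T}};
  _ : is_graph graph_val }.

HB.instance Definition _ (T : finType) := [isSub for @graph_val T].
HB.instance Definition _ (T : finType) := [Finite of graph T by <:].

Definition vset (T : finType) (G : graph T) : {set T} := (graph_val G).1.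
Definition eset (T : finType) (G : graph T) : {set {set T}} := (graph_val G).2.

Definition subgraph (T : finType) (F G : graph T) : bool :=
  (vset F \subset vset G) && (eset F \subset eset G).

Definition deg (T : finType) (G : graph T) (v : T) : nat :=
  #|[set e in eset G | v \in e]|.

(* The default value #|T| exceeds every degree; it is only attained when G has
   no vertex. *)
Definition min_deg (T : finType) (G : graph T) : nat :=
  \big[minn/#|T|]_(v in vset G) deg G v.

(* G contains a (not necessarily induced) copy of H. *)
Definition contains_copy (U T : finType) (H : graph U) (G : graph T) : bool :=
  [exists f : {ffun U -> T},
    [&& [forall x in vset H, forall y in vset H, (f x == f y) ==> (x == y)],
        [forall x in vset H, f x \in vset G]
      & [forall e in eset H, (f @: e) \in eset G]]].

Definition free_of (U T : finType) (H : graph U) (G : graph T) : bool :=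
  ~~ contains_copy H G.

(* The vertex set splits into k (possibly empty) independent classes. *)
Definition partite (T : finType) (k : nat) (G : graph T) : bool :=
  [exists P : {ffun 'I_k -> {set T}},
    [&& \bigcup_i P i == vset G,
        [forall i, forall j, (i != j) ==> [disjoint P i & P j]]
      & [forall i, forall e in eset G, ~~ (e \subset P i)]]].

Lemma partite_exists (T : finType) (G : graph T) : exists k, partite k G.
Proof.
exists #|T|; apply/existsP.
exists [ffun i => vset G :&: [set enum_val i]]; apply/and3P; split.
- apply/eqP/setP => x; apply/bigcupP/idP => [[i _]|xG].
    by rewrite ffunE inE => /andP[].
  by exists (enum_rank x) => //; rewrite ffunE !inE xG enum_rankK eqxx.
- apply/forallP => i; apply/forallP => j; apply/implyP => ij.
  rewrite !ffunE; apply/pred0P => x /=; rewrite !inE.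
  apply/negP => /andP[/andP[_ /eqP xi] /andP[_ /eqP xj]].
  by move: ij; rewrite -(inj_eq enum_val_inj) -xi -xj eqxx.
- apply/forallP => i; apply/forall_inP => e eG; rewrite ffunE.
  have /forall_inP/(_ e eG)/andP[_ /eqP e2] : is_graph (graph_val G) := valP G.
  apply/negP => /subset_leq_card; rewrite e2 leqNgt ltnS.
  by rewrite (leq_trans (subset_leq_card (subsetIr _ _))) ?cards1.
Qed.

Definition chromatic_number (T : finType) (G : graph T) : nat :=
  ex_minn (partite_exists G).

(* The 2-density.  The max runs over a finite set, nonempty when H has at least
   3 vertices, so that sup is a maximum.  The value 1/2 at K_2 is also used in
   the cases in which 1 / m_2(H) would otherwise be meaningless: no subgraph on
   3 vertices (the maximum is over the empty set), or K_2 plus isolated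
   vertices (the maximum is 0). *)
Definition m2 (R : realType) (T : finType) (H : graph T) : R :=
  if (#|vset H| <= 2)%N || (#|eset H| == 1)%N then 2^-1
  else sup [set (#|eset F|%:R - 1) / (#|vset F|%:R - 2)
           | F in [set F : graph T | subgraph F H && (3 <= #|vset F|)%N]]%classic.

(* The probability that the binomial random graph G_{n,p}, with vertex set
   'I_n, has the property A. *)
Definition gnp_prob (R : realType) (n : nat) (p : R) (A : pred (graph 'I_n)) : R :=
  \sum_(G : graph 'I_n | (vset G == [set: 'I_n]) && A G)
     p ^+ #|eset G| * (1 - p) ^+ ('C(n, 2) - #|eset G|).

(* G becomes k-partite after the removal of at most x edges. *)
Definition close_to_partite (R : realType) (T : finType) (k : nat) (x : R)
    (G : graph T) : bool :=
  [exists F : graph T,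
    [&& vset F == vset G, eset F \subset eset G,
        #|eset G :\: eset F|%:R <= x & partite k F]].

(* Main.v *)
Require Import Defs.
From HB Require Import structures.
From mathcomp Require Import all_boot all_order all_algebra.
From mathcomp Require Import all_classical all_reals all_analysis.
From mathcomp Require Import ring lra zify.

Set Implicit Arguments.
Unset Strict Implicit.
Unset Printing Implicit Defensive.

Import mathcomp.boot.fintype mathcomp.boot.finset.
Import Order.TTheory GRing.Theory Num.Theory.
Import numFieldNormedType.Exports.

Local Open Scope ring_scope.


(** Write r for the chromatic number of H. The main case, [aes_dense_case], assumes that H has an
    edge and that [m2 R H] is at least 1. An H-free G' on enough vertices is an independent set in
    the hypergraph whose vertices are the pairs of 'I_n and whose edges are the copies of H. At the
    scale tau = n^(-1/m2) the copies are spread evenly enough for the container method ([container],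
    [copy_containers]): G' lies in a graph W with few copies of H, and W is determined by boundedly
    many fingerprints, which are subsets of G' with O(tau n^2) edges each.

    In G_{n,p} it is unlikely that, for some fingerprint present in the graph, one of exponentially
    many test sets of edges of W receives many more edges than p times its size
    ([gnp_container_bound]). The number of fingerprints is paid for by the probability that they are
    present in the graph. Outside this event the minimum degree of G' forces almost all vertices of
    G' to have degree above (1 - 3/(3r-4)) n in W, with some slack, while a partition of W with few
    edges inside its classes is also good for G' ([close_of_container]).

    What remains is a statement on dense graphs, [dense_hom]: a graph with few copies of H in which
    few vertices violate the degree condition is nearly (r-1)-partite. Few copies of H imply few
    cliques of size r ([supersaturation], by repeated use of convexity), and [dense_aes] is a robust
    form of the Andrasfai-Erdos-Sos theorem. It follows from the exact theorem [andrasfai_erdos_sos]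
    by sampling: a graph far from (r-1)-colourable has many bounded samples that are not
    (r-1)-colourable ([far_samples]), whereas a typical large sample contains no r-clique and
    inherits the degree condition at most of its vertices.

    If [m2 R H] is below 1, then H has no two intersecting edges. For a nonempty matching p n^2 may
    stay bounded, and a direct argument on maximum degrees replaces containers ([aes_matching]). An
    edgeless H is degenerate ([aes_edgeless]). *)

(** * The Andrasfai-Erdos-Sos theorem *)

Definition clique (T : finType) (w : rel T) (Q : {set T}) : bool :=
  [forall x in Q, forall y in Q, (x != y) ==> w x y].

Lemma cliqueP (T : finType) (w : rel T) (Q : {set T}) :
  reflect {in Q &, forall x y, x != y -> w x y} (clique w Q).
Proof.
apply: (iffP forall_inP) => [H x y xQ yQ xy|H x xQ].
  by have /forall_inP/(_ y yQ)/implyP/(_ xy) := H x xQ.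
by apply/forall_inP => y yQ; apply/implyP; apply: H.
Qed.

Lemma cliqueS (T : finType) (w : rel T) (P Q : {set T}) :
  P \subset Q -> clique w Q -> clique w P.
Proof.
move=> /subsetP sPQ /cliqueP cQ; apply/cliqueP => x y xP yP.
by apply: cQ; apply: sPQ.
Qed.

Lemma clique_setU1 (T : finType) (w : rel T) (v : T) (Q : {set T}) :
  symmetric w -> clique w Q -> {in Q, forall u, w v u} -> clique w (v |: Q).
Proof.
move=> ws /cliqueP cQ vQ; apply/cliqueP => x y.
rewrite !in_setU1 => /orP[/eqP->|xQ] /orP[/eqP->|yQ] xy.
- by rewrite eqxx in xy.
- exact: vQ.
- by rewrite ws vQ.
- exact: cQ.
Qed.

Lemma subset_card_exists (T : finType) (A : {set T}) (k : nat) :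
  (k <= #|A|)%N -> exists2 B : {set T}, B \subset A & #|B| = k.
Proof.
move=> kA; exists [set x in take k (enum A)].
  by apply/subsetP => x; rewrite inE => /mem_take; rewrite mem_enum.
rewrite cardsE (card_uniqP _) ?take_uniq ?enum_uniq // size_takel //.
by rewrite -cardE.
Qed.

Section AndrasfaiErdosSos.
Variables (T : finType) (r : nat).
Hypothesis r2 : (2 <= r)%N.

(** For irreflexive [w] the vertex [v] itself is included, so the size is the number of vertices
    minus the degree of [v]. *)
Definition nonadj (w : rel T) (v : T) : {set T} := [set u | ~~ w v u].

Definition add_edge (w : rel T) (x y : T) : rel T :=
  fun a b => [|| w a b, (a == x) && (b == y) | (a == y) && (b == x)].

(* When no edge can be added without creating a clique of size r, either
   non-adjacency is transitive or there are x, y, z as below. *)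
Let wheel (w : rel T) (c : T * T * T * {set T} * {set T}) : bool :=
  let: (x, y, z, P, Q) := c in
  [&& w x y, clique w P, clique w Q, #|P| == r - 2, #|Q| == r - 2,
      [forall u in P, w x u && w z u] & [forall u in Q, w y u && w z u]]%N.

Let hub (c : T * T * T * {set T} * {set T}) : nat := #|c.1.2 :&: c.2|.

Lemma clique_nonadj (w : rel T) (v : T) (Q : {set T}) :
  symmetric w -> irreflexive w ->
  (forall Q, clique w Q -> (#|Q| < r)%N) -> clique w Q -> (r.-1 <= #|Q|)%N ->
  (0 < #|Q :&: nonadj w v|)%N.
Proof.
move=> ws wi free cQ Qr; rewrite card_gt0; apply/set0Pn.
case: (pickP (fun u => (u \in Q) && ~~ w v u)) => [u /andP[uQ vu]|H].
  by exists u; rewrite !inE uQ.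
have vQ : {in Q, forall u, w v u}.
  by move=> u uQ; have := H u; rewrite uQ /= => /negbFE.
have := free _ (clique_setU1 ws cQ vQ).
rewrite cardsU1; have -> : v \notin Q by apply/negP => /vQ; rewrite wi.
by lia.
Qed.

(** A full hub would give [P = Q], and then [x], [y] and [P] would form a clique of size [r]. *)
Lemma wheel_hub_lt (w : rel T) c : symmetric w -> irreflexive w ->
  (forall Q, clique w Q -> (#|Q| < r)%N) -> wheel w c -> (hub c < r - 2)%N.
Proof.
case: c => [[[[x y] z] P] Q] ws wi free.
move=> /and5P[wxy cP cQ /eqP sP /and3P[/eqP sQ /forall_inP xP /forall_inP yQ]].
rewrite ltnNge; apply/negP => /= hPQ.
have PQ : P = Q.
  apply/eqP; rewrite eqEcard sP sQ leqnn andbT; apply/setIidPl/eqP.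
  by rewrite eqEcard subsetIl sP.
have cyQ : clique w (y |: Q) by apply: clique_setU1 => // u /yQ/andP[].
have cxyQ : clique w (x |: (y |: Q)).
  apply: clique_setU1 => // u; rewrite in_setU1 => /orP[/eqP->//|].
  by rewrite -PQ => /xP/andP[].
have := free _ cxyQ.
have yQ' : y \notin Q by apply/negP => /yQ/andP[]; rewrite wi.
have xQ' : x \notin y |: Q.
  rewrite in_setU1 negb_or; apply/andP; split.
    by apply/eqP => xy; rewrite xy wi in wxy.
  by rewrite -PQ; apply/negP => /xP/andP[]; rewrite wi.
by rewrite !cardsU1 xQ' yQ' sQ; lia.
Qed.

(* If v is adjacent to x, y, z and to all of P and Q except for one
   vertex of each, then exchanging these two for v enlarges the hub. *)
Lemma wheel_exchange (w : rel T) x y z P Q v : symmetric w -> irreflexive w ->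
  wheel w (x, y, z, P, Q) -> P :&: Q :&: nonadj w v = set0 ->
  w v x -> w v y -> w v z ->
  #|P :&: nonadj w v| = 1%N -> #|Q :&: nonadj w v| = 1%N ->
  exists2 c, wheel w c & (#|P :&: Q| < hub c)%N.
Proof.
move=> ws wi /and5P[wxy cP cQ /eqP sP].
move=> /and3P[/eqP sQ /forall_inP xP /forall_inP yQ] hPQ vx vy vz.
move=> /eqP/cards1P[a Pa] /eqP/cards1P[b Qb].
have swap (c : T) (S : {set T}) : clique w S -> S :&: nonadj w v = [set c]%SET ->
    [/\ clique w (v |: S :\ c), #|v |: S :\ c| = #|S|
      & {in S :\ c, forall u, w v u}].
  move=> cS Sc.
  have vS : {in S :\ c, forall u, w v u}.
    move=> u; rewrite !inE => /andP[uc uS]; apply: contraNT uc => nvu.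
    by have := in_set1 u c; rewrite -Sc !inE uS nvu => <-.
  split=> //.
    by apply: (clique_setU1 ws _ vS); apply: (cliqueS _ cS); exact: subD1set.
  have cinS : c \in S.
    have : c \in S :&: nonadj w v by rewrite Sc set11.
    by move=> /setIP[].
  rewrite cardsU1 (cardsD1 c S) cinS; congr (_ + _)%N.
  by apply/eqP; rewrite eqb1; apply/negP => /vS; rewrite wi.
have [cP' sP' vP] := swap _ _ cP Pa.
have [cQ' sQ' vQ] := swap _ _ cQ Qb.
exists (x, y, z, v |: P :\ a, v |: Q :\ b).
  rewrite /wheel wxy cP' cQ' sP' sQ' sP sQ eqxx /=; apply/andP; split.
    apply/forall_inP => u; rewrite in_setU1 => /orP[/eqP->|].
      by rewrite ![w _ v]ws vx vz.
    by rewrite in_setD1 => /andP[_ /xP].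
  apply/forall_inP => u; rewrite in_setU1 => /orP[/eqP->|].
    by rewrite ![w _ v]ws vy vz.
  by rewrite in_setD1 => /andP[_ /yQ].
rewrite /hub /=.
have sub : v |: (P :&: Q) \subset (v |: P :\ a) :&: (v |: Q :\ b).
  apply/subsetP => u; rewrite !in_setU1 !inE.
  case: eqP => //= _ /andP[uP uQ]; rewrite uP uQ !andbT.
  have vu : w v u.
    apply: contraT => nvu; have : u \in P :&: Q :&: nonadj w v.
      by rewrite !inE uP uQ.
    by rewrite hPQ inE.
  apply/andP; split; apply/eqP => ue.
    have : a \in P :&: nonadj w v by rewrite Pa set11.
    by rewrite !inE -ue vu andbF.
  have : b \in Q :&: nonadj w v by rewrite Qb set11.
  by rewrite !inE -ue vu andbF.
apply: leq_trans (subset_leq_card sub).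
rewrite cardsU1; have -> : v \notin P :&: Q; last by lia.
apply/negP => vPQ; have : v \in P :&: Q :&: nonadj w v.
  by rewrite inE vPQ inE wi.
by rewrite hPQ inE.
Qed.

(** Double counting of non-adjacencies to a wheel with maximal hub, where the hub vertices get
    weight 3, the rest of [P] and [Q] and the vertices [x], [y], [z] weight 1. Every vertex misses
    weight at least 3, while the total weight is at most [3 * r - 4], so some vertex has many
    non-neighbours. *)
Lemma wheel_nonadj (w : rel T) c : symmetric w -> irreflexive w ->
  (forall Q, clique w Q -> (#|Q| < r)%N) ->
  wheel w c -> (forall c', wheel w c' -> (hub c' <= hub c)%N) ->
  exists2 v, true & (3 * #|T| <= (3 * r - 4) * #|nonadj w v|)%N.
Proof.
case: c => [[[[x y] z] P] Q] ws wi free wh hmax.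
have hlt := wheel_hub_lt ws wi free wh.
have wh' := wh.
case/and5P: wh => wxy cP cQ /eqP sP.
move=> /and3P[/eqP sQ /forall_inP xP /forall_inP yQ].
pose m v := (#|P :&: nonadj w v| + #|Q :&: nonadj w v|
  + #|P :&: Q :&: nonadj w v| + ~~ w v x + ~~ w v y + ~~ w v z)%N.
(* A missed hub vertex already counts three times. Otherwise, a neighbour of [x] or [z] must miss a
   vertex of [P], and a neighbour of [y] or [z] a vertex of [Q]. Only a neighbour of all three that
   misses exactly one vertex on each side would have weight 2, and the exchange would then enlarge
   the hub. *)
have m3 v : (3 <= m v)%N.
  rewrite /m; have [hPQ|] := eqVneq (P :&: Q :&: nonadj w v) set0; last first.
    rewrite -card_gt0 => h.
    have := subset_leq_card (setSI (nonadj w v) (subsetIl P Q)).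
    by have := subset_leq_card (setSI (nonadj w v) (subsetIr P Q)); lia.
  have ext (u : T) (S : {set T}) : clique w S -> #|S| = (r - 2)%N ->
      {in S, forall t, w u t} -> w v u -> (0 < #|S :&: nonadj w v|)%N.
    move=> cS sS uS vu.
    have cuS : clique w (u |: S) by apply: clique_setU1.
    have := clique_nonadj v ws wi free cuS; rewrite cardsU1 sS.
    have -> : u \notin S by apply/negP => /uS; rewrite wi.
    move=> /(_ ltac:(lia)) h; apply: leq_trans h _; apply: subset_leq_card.
    apply/subsetP => t; rewrite !inE => /andP[/orP[/eqP->|->//]].
    by rewrite vu.
  have hx := ext x P cP sP (fun t tP => proj1 (andP (xP t tP))).
  have hzP := ext z P cP sP (fun t tP => proj2 (andP (xP t tP))).
  have hy := ext y Q cQ sQ (fun t tQ => proj1 (andP (yQ t tQ))).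
  have hzQ := ext z Q cQ sQ (fun t tQ => proj2 (andP (yQ t tQ))).
  have nob : w v x -> w v y -> w v z ->
      ~ (#|P :&: nonadj w v| = 1%N /\ #|Q :&: nonadj w v| = 1%N).
    move=> vx vy vz [P1 Q1].
    have [c' whc' lt] := wheel_exchange ws wi wh' hPQ vx vy vz P1 Q1.
    by have := hmax _ whc'; rewrite leqNgt lt.
  move: hx hzP hy hzQ nob; rewrite hPQ cards0.
  by case: (w v x) (w v y) (w v z) => [] [] [] /=; lia.
have swp (S : {set T}) :
    (\sum_v #|S :&: nonadj w v| = \sum_(u in S) #|nonadj w u|)%N.
  under eq_bigr do rewrite -sum1_card big_mkcond /=.
  under [RHS]eq_bigr do rewrite -sum1_card big_mkcond /=.
  rewrite exchange_big /= [RHS]big_mkcond /=; apply: eq_bigr => u _.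
  case uS: (u \in S); last by rewrite big1 // => v _; rewrite inE uS.
  by apply: eq_bigr => v _; rewrite !inE uS ws.
have swp1 u : (\sum_v (~~ w v u : nat) = #|nonadj w u|)%N.
  rewrite -sum1_card [RHS]big_mkcond /=; apply: eq_bigr => v _.
  by rewrite inE ws; case: (w u v).
pose N := (\max_v #|nonadj w v|)%N.
have le1 u : (#|nonadj w u| <= N)%N by exact: leq_bigmax.
have leN (S : {set T}) : (\sum_(u in S) #|nonadj w u| <= #|S| * N)%N.
  by rewrite -sum_nat_const; apply: leq_sum => u _.
have tot : (3 * #|T| <= (3 * r - 4) * N)%N.
  have h1 : (#|T| * 3 <= \sum_v m v)%N.
    by rewrite -sum_nat_const; apply: leq_sum => v _; apply: m3.
  have h2 : (\sum_v m v <= (#|P| + #|Q| + #|P :&: Q| + 3) * N)%N.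
    rewrite /m !big_split /= !swp !swp1.
    have := leN P; have := leN Q; have := leN (P :&: Q).
    by have := le1 x; have := le1 y; have := le1 z; nia.
  move: hlt; rewrite /hub /= => hlt.
  (* The hub has at most [r - 3] vertices, so the weight is at most 2(r-2) + (r-3) + 3. *)
  have h3 : (#|P| + #|Q| + #|P :&: Q| + 3 <= 3 * r - 4)%N by rewrite sP sQ; lia.
  by rewrite mulnC; apply: leq_trans h1 (leq_trans h2 _); rewrite leq_mul2r h3 orbT.
have [v vN] : {v | N = #|nonadj w v|}.
  by apply: bigop.eq_bigmax; apply/card_gt0P; exists x.
by exists v; rewrite // -vN.
Qed.

(** A large clique created by the new edge must contain both of its ends; the other members are
    common neighbours of these ends. *)
Lemma add_edge_clique (w : rel T) x z Q : symmetric w -> irreflexive w ->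
  (forall Q, clique w Q -> (#|Q| < r)%N) -> ~~ w x z ->
  clique (add_edge w x z) Q -> (r <= #|Q|)%N ->
  exists P : {set T}, [/\ clique w P, #|P| = (r - 2)%N
    & {in P, forall u, w x u /\ w z u}].
Proof.
move=> ws wi free nxz /cliqueP cQ rQ.
have inQ (u v : T) : ((u == x) && (v == z)) || ((u == z) && (v == x)) ->
    u \in Q /\ v \in Q.
  have key t : t \notin Q -> (t == x) || (t == z) -> False.
    move=> tQ tt; have : clique w Q.
      apply/cliqueP => a b aQ bQ ab; have := cQ a b aQ bQ ab.
      case/or3P => // /andP[/eqP ea /eqP eb]; move: tt tQ;
        by rewrite -?ea -?eb => /orP[]/eqP->; rewrite ?aQ ?bQ.
    by move/free; rewrite ltnNge rQ.
  have xQ : x \in Q by apply: contraT => /key; rewrite eqxx => /(_ isT).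
  have zQ : z \in Q by apply: contraT => /key; rewrite eqxx orbT => /(_ isT).
  by case/orP => /andP[/eqP-> /eqP->].
have [xQ zQ] := inQ x z ltac:(by rewrite !eqxx).
have [P sP cP] : exists2 P : {set T}, P \subset Q :\ x :\ z & #|P| = (r - 2)%N.
  apply: subset_card_exists.
  have := cardsD1 x Q; have := cardsD1 z (Q :\ x).
  by rewrite xQ; case: (z \in _); lia.
have PQ u : u \in P -> [/\ u != x, u != z & u \in Q].
  by move=> /(subsetP sP); rewrite !inE => /and3P[-> ->].
exists P; split=> //.
  apply/cliqueP => a b /PQ[/negPf ax /negPf az aQ] /PQ[_ _ bQ] ab.
  by have := cQ a b aQ bQ ab; rewrite /add_edge ax az !orbF.
move=> u /PQ[ux uz uQ]; split.
  have := cQ x u xQ uQ; rewrite eq_sym => /(_ ux).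
  by rewrite /add_edge (negPf ux) (negPf uz) !andbF !orbF.
have := cQ z u zQ uQ; rewrite eq_sym => /(_ uz).
by rewrite /add_edge (negPf ux) (negPf uz) !andbF !orbF.
Qed.

(** The graph is complete multipartite. A maximum clique has fewer than [r] members and represents
    every class, so each vertex is coloured by a member that it is not adjacent to. *)
Lemma nonadj_trans_colourable (w : rel T) : irreflexive w ->
  (forall Q, clique w Q -> (#|Q| < r)%N) ->
  (forall x y z, ~~ w x z -> ~~ w y z -> ~~ w x y) ->
  symmetric w ->
  exists f : T -> 'I_r.-1, forall x y, w x y -> f x != f y.
Proof.
move=> wi free tr ws.
have c0 : clique w set0 by apply/cliqueP => x y; rewrite inE.
have [Q cQ Qmax] := arg_maxnP (fun Q : {set T} => #|Q|) c0.
have hQ v : exists2 u, u \in Q & ~~ w v u.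
  case: (pickP (fun u => (u \in Q) && ~~ w v u)) => [u /andP[]|H]; first by exists u.
  have vQ : {in Q, forall u, w v u}.
    by move=> u uQ; have := H u; rewrite uQ /= => /negbFE.
  have := Qmax _ (clique_setU1 ws cQ vQ).
  rewrite cardsU1; have -> : v \notin Q by apply/negP => /vQ; rewrite wi.
  by rewrite /=; lia.
have lt v : (index (s2val (sig2W (hQ v))) (enum Q) < r.-1)%N.
  apply: (@leq_trans #|Q|); last by have := free _ cQ; lia.
  by rewrite cardE index_mem mem_enum; case: (sig2W (hQ v)).
exists (fun v => Ordinal (lt v)) => x y; apply: contraTneq => /(congr1 val) /=.
case: (sig2W (hQ x)) (sig2W (hQ y)) => [u uQ xu] [v vQ yv] /= uv.
have {uv} e : u = v.
  by have := congr1 (nth u (enum Q)) uv; rewrite !nth_index ?mem_enum.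
by subst v; apply: tr xu yv.
Qed.

(** Induction on the number of non-adjacent pairs: while an edge can be added without creating an
    [r]-clique, add it, which preserves the degree condition. In a saturated graph a failure of
    transitivity of non-adjacency yields a wheel, which [wheel_nonadj] excludes. *)
Theorem andrasfai_erdos_sos (w : rel T) : symmetric w -> irreflexive w ->
  (forall Q, clique w Q -> (#|Q| < r)%N) ->
  (forall v, (3 * r - 4) * #|nonadj w v| < 3 * #|T|)%N ->
  exists f : T -> 'I_r.-1, forall x y, w x y -> f x != f y.
Proof.
have [m] := ubnP (\sum_v #|nonadj w v|)%N; elim: m w => // m IH w lem ws wi free miss.
have [/existsP[c whc]|nowheel] := boolP [exists c, wheel w c].
  have [c' whc' cmax] := arg_maxnP hub whc.
  have [v _] := wheel_nonadj ws wi free whc' cmax.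
  by rewrite leqNgt miss.
pose ext x z := ~~ w x z && (x != z) &&
  [forall Q : {set T}, clique (add_edge w x z) Q ==> (#|Q| < r)%N].
have [/existsP[x /existsP[z /andP[/andP[nxz xz] /forallP ok]]]|noext] :=
  boolP [exists x, exists z, ext x z].
  have sub u v : w u v -> add_edge w x z u v by rewrite /add_edge => ->.
  have mono v : nonadj (add_edge w x z) v \subset nonadj w v.
    by apply/subsetP => u; rewrite !inE; apply: contra; apply: sub.
  have [|||||f fP] := IH (add_edge w x z).
  - rewrite -ltnS; apply: leq_trans lem; rewrite ltnS.
    rewrite (bigD1 x) //= [leqRHS](bigD1 x) //= -addSn leq_add //.
      apply: proper_card; rewrite properE mono /=; apply/subsetPn.
      by exists z; rewrite !inE ?nxz // /add_edge !eqxx orbT.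
    by apply: leq_sum => v _; apply: subset_leq_card.
  - move=> u v; rewrite /add_edge ws; congr (_ || _).
    by rewrite orbC ![(v == _) && _]andbC.
  - move=> u; rewrite /add_edge wi /=; apply/norP; split.
      by apply: contra xz => /andP[/eqP<- /eqP<-].
    by apply: contra xz => /andP[/eqP<- /eqP<-].
  - by move=> Q cQ; have /implyP := ok Q; apply.
  - move=> v; apply: leq_ltn_trans (miss v).
    by rewrite leq_mul2l subset_leq_card ?orbT.
  by exists f => u v uv; apply: fP; apply: sub.
have nbr x z : ~~ w x z -> x != z -> exists P : {set T},
    [/\ clique w P, #|P| = (r - 2)%N & {in P, forall u, w x u /\ w z u}].
  move=> nxz xz; have : ~~ ext x z.
    by apply: contra noext => h; apply/existsP; exists x; apply/existsP; exists z.
  rewrite /ext nxz xz /= negb_forall => /existsP[Q].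
  rewrite negb_imply -leqNgt => /andP[cQ rQ].
  exact: add_edge_clique ws wi free nxz cQ rQ.
apply: nonadj_trans_colourable => // x y z nxz nyz.
apply: contra nowheel => wxy.
have xz : x != z by apply: contraNneq nyz => <-; rewrite ws.
have yz : y != z by apply: contraNneq nxz => <-.
have [P [cP sP xP]] := nbr _ _ nxz xz.
have [Q [cQ sQ yQ]] := nbr _ _ nyz yz.
apply/existsP; exists (x, y, z, P, Q).
rewrite /wheel wxy cP cQ sP sQ !eqxx /=; apply/andP; split; apply/forall_inP => u.
  by move=> /xP[-> ->].
by move=> /yQ[-> ->].
Qed.

End AndrasfaiErdosSos.


(** * Averages over finite sample spaces *)

Lemma leq_bool (a b : bool) : (a -> b) -> (a <= b)%N.
Proof. by case: a => // ->. Qed.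

Section Mean.
Variable R : realType.

Definition mean (X : finType) (F : X -> R) : R := (\sum_x F x) / #|X|%:R.

Lemma ler_mean (X : finType) (F G : X -> R) :
  (forall x, F x <= G x) -> mean F <= mean G.
Proof. by move=> FG; rewrite ler_wpM2r // ler_sum. Qed.

Lemma eq_mean (X : finType) (F G : X -> R) : F =1 G -> mean F = mean G.
Proof. by move=> FG; congr (_ / _); apply: eq_bigr => x _. Qed.

Lemma mean_ge0 (X : finType) (F : X -> R) : (forall x, 0 <= F x) -> 0 <= mean F.
Proof. by move=> F0; rewrite divr_ge0 // sumr_ge0. Qed.

Lemma meanD (X : finType) (F G : X -> R) :
  mean (fun x => F x + G x) = mean F + mean G.
Proof. by rewrite /mean big_split mulrDl. Qed.

Lemma meanZ (X : finType) c (F : X -> R) : mean (fun x => c * F x) = c * mean F.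
Proof. by rewrite /mean -mulr_sumr mulrA. Qed.

Lemma mean_sum (X I : finType) (P : pred I) (F : I -> X -> R) :
  mean (fun x => \sum_(i | P i) F i x) = \sum_(i | P i) mean (F i).
Proof. by rewrite /mean exchange_big mulr_suml. Qed.

Lemma mean_cst (X : finType) c : (0 < #|X|)%N -> mean (fun _ : X => c) = c.
Proof.
move=> X0; rewrite /mean sumr_const -[c *+ _]mulr_natr mulfK // pnatr_eq0.
by rewrite -lt0n.
Qed.

Lemma mean_bij (X Y : finType) (h : Y -> X) (F : X -> R) :
  bijective h -> mean (fun y => F (h y)) = mean F.
Proof.
by move=> bh; rewrite /mean (bij_eq_card bh) [in RHS](reindex h) //; apply: onW_bij.
Qed.

Lemma mean_pair (X Y : finType) (F : X -> Y -> R) :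
  mean (fun z : X * Y => F z.1 z.2) = mean (fun x => mean (F x)).
Proof.
rewrite /mean card_prod -mulr_suml natrM invfM mulrA mulrAC.
by rewrite (pair_bigA _ F).
Qed.

Lemma mean_prod (I X : finType) (F : I -> X -> R) :
  mean (fun x : {ffun I -> X} => \prod_i F i (x i)) = \prod_i mean (F i).
Proof.
rewrite /mean -bigA_distr_bigA /= big_split /= prodr_const.
by rewrite card_ffun natrX exprVn.
Qed.

Definition upd (I T : finType) (x : {ffun I -> T}) (a : I) (t : T) : {ffun I -> T} :=
  [ffun b => if b == a then t else x b].

(** Resampling one coordinate preserves the uniform distribution; this is how independence of
    coordinates gets used below. *)
Lemma mean_upd (I T : finType) (a : I) (F : {ffun I -> T} -> R) :
  (0 < #|T|)%N -> mean (fun x => mean (fun t => F (upd x a t))) = mean F.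
Proof.
move=> T0; rewrite -(mean_pair (fun x t => F (upd x a t))).
(* Exchanging the old value of coordinate [a] with the fresh one is an involution. *)
pose h (z : {ffun I -> T} * T) := (upd z.1 a z.2, z.1 a).
have hK : involutive h.
  move=> [x t]; rewrite /h /= ffunE eqxx; congr (_, _).
  by apply/ffunP => b; rewrite !ffunE; case: eqP => [->|].
rewrite (mean_bij (fun z => F z.1) (inv_bij hK)).
rewrite (mean_pair (fun x _ => F x)).
by apply: eq_mean => x; rewrite mean_cst.
Qed.

Lemma mean_coord (I T : finType) (a : I) (F : T -> R) :
  (0 < #|T|)%N -> mean (fun x : {ffun I -> T} => F (x a)) = mean F.
Proof.
move=> T0; rewrite -(mean_upd a) //.
under eq_mean do under eq_mean do rewrite ffunE eqxx.
by rewrite mean_cst // card_ffun expn_gt0 T0.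
Qed.

Definition pullback (I J T : finType) (h : J -> I) (x : {ffun I -> T}) : {ffun J -> T} :=
  [ffun j => x (h j)].

(** All fibres of the restriction along an injection have the same size, so a uniform point
    restricts to a uniform point. *)
Lemma mean_pullback (I J T : finType) (h : J -> I) (F : {ffun J -> T} -> R) :
  injective h -> (0 < #|T|)%N ->
  mean (fun x : {ffun I -> T} => F (pullback h x)) = mean F.
Proof.
move=> inj_h T0.
pose fib (y : {ffun J -> T}) := [set x : {ffun I -> T} | pullback h x == y].
have fib_le y y' : (#|fib y| <= #|fib y'|)%N.
  pose s (x : {ffun I -> T}) : {ffun I -> T} :=
    [ffun i => if [pick j | h j == i] is Some j then y' j else x i].
  have injs : {in fib y &, injective s}.
    move=> x1 x2; rewrite !inE => /eqP e1 /eqP e2 e; apply/ffunP => i.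
    have := congr1 (fun f : {ffun I -> T} => f i) e; rewrite !ffunE.
    case: pickP => // j /eqP <- _.
    have := congr1 (fun f : {ffun J -> T} => f j) (etrans e1 (esym e2)).
    by rewrite !ffunE.
  rewrite -(card_in_imset injs); apply: subset_leq_card.
  apply/subsetP => _ /imsetP[x _ ->]; rewrite inE; apply/eqP/ffunP => j.
  rewrite !ffunE; case: pickP => [j' /eqP/inj_h -> //|/(_ j)].
  by rewrite eqxx.
have sumF (G : {ffun J -> T} -> R) y0 :
    \sum_(x : {ffun I -> T}) G (pullback h x) = #|fib y0|%:R * \sum_y G y.
  rewrite (partition_big (pullback h) predT) //= mulr_sumr; apply: eq_bigr => y _.
  rewrite (_ : #|fib y0| = #|fib y|); last by apply/eqP; rewrite eqn_leq !fib_le.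
  rewrite -sum1_card natr_sum mulr_suml; apply: eq_big => [x|x /eqP ->].
    by rewrite inE.
  by rewrite mul1r.
have [y0 _] : exists y : {ffun J -> T}, true.
  by have /card_gt0P[t _] := T0; exists [ffun=> t].
have cF := sumF (fun=> 1) y0.
rewrite /mean (sumF _ y0); move: cF; rewrite !sumr_const => ->.
have k0 : #|fib y0|%:R != 0 :> R.
  apply/negP => /eqP k0; have := sumF (fun=> 1) y0; rewrite k0 mul0r sumr_const.
  by apply/eqP; rewrite pnatr_eq0 -lt0n card_ffun expn_gt0 T0.
by rewrite invfM mulrACA divff // mul1r.
Qed.

Lemma mean_le1 (X : finType) (P : pred X) : mean (fun x => (P x)%:R) <= 1.
Proof.
rewrite /mean -natr_sum; have [->|X0] := posnP #|X|; first by rewrite invr0 mulr0.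
rewrite ler_pdivrMr ?ltr0n // mul1r ler_nat -sum1_card; apply: leq_sum => x _.
by case: (P x).
Qed.

Lemma mean_card (X : finType) (P : pred X) :
  mean (fun x => (P x)%:R) = #|[set x | P x]|%:R / #|X|%:R.
Proof.
rewrite /mean -natr_sum -sum1_card; congr (_%:R / _); rewrite [RHS]big_mkcond /=.
by apply: eq_bigr => x _; rewrite inE; case: (P x).
Qed.

(** A convex power lies above its tangent at [s]. In the induction the gap is a nonnegative multiple
    of [(t - s) ^+ 2]. *)
Lemma tangent_pow (s t : R) b : 0 <= s -> 0 <= t ->
  s ^+ b + b%:R * s ^+ b.-1 * (t - s) <= t ^+ b.
Proof.
move=> s0 t0; elim: b => [|b IH]; first by rewrite !expr0 !mul0r addr0.
rewrite [leRHS]exprS; apply: le_trans (ler_wpM2l t0 IH).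
case: b IH => [|b] IH; first by rewrite !expr0 !expr1; lra.
rewrite /= -subr_ge0.
rewrite [X in 0 <= X](_ : _ = b.+1%:R * s ^+ b * (t - s) ^+ 2); last first.
  by rewrite !exprS -[in b.+2%:R]natr1; ring.
by rewrite mulr_ge0 ?sqr_ge0 // mulr_ge0 // exprn_ge0.
Qed.

(** Jensen's inequality: in the tangent at the mean the linear term averages to zero. *)
Lemma mean_pow (X : finType) (F : X -> R) b : (0 < #|X|)%N -> (forall x, 0 <= F x) ->
  mean F ^+ b <= mean (fun x => F x ^+ b).
Proof.
move=> X0 F0; set s := mean F.
have s0 : 0 <= s by apply: mean_ge0.
rewrite [leLHS](_ : _ = mean (fun x => s ^+ b + b%:R * s ^+ b.-1 * (F x - s))).
  by apply: ler_mean => x; apply: tangent_pow.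
rewrite meanD mean_cst // meanZ meanD mean_cst // -/s.
by rewrite subrr mulr0 addr0.
Qed.

End Mean.

(** * Bounded samples detect graphs far from [k]-colourable *)

Section ListColouring.
Variables (T : finType) (w : rel T) (k : nat).

Definition list_colourable (J : finType) (L : T -> {set 'I_k}) (x : {ffun J -> T}) :=
  [exists g : {ffun J -> 'I_k}, [forall a, g a \in L (x a)] &&
     [forall a, forall b, w (x a) (x b) ==> (g a != g b)]].

(* Counts ordered pairs. *)
Definition mono_edges (f : T -> 'I_k) : nat :=
  \sum_u #|[set v | w u v && (f v == f u)]|.

Definition violations (L : T -> {set 'I_k}) (f : T -> 'I_k) : {set T} :=
  [set u | f u \notin L u].

End ListColouring.

(* Colouring a vertex u with i removes i from the lists of its neighbours.  If
   for many u this shortens the lists substantially whatever colour of its list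
   u receives, then one u followed by one sample for each of its colours is bad
   by induction; if not, then almost every vertex has a colour with few
   conflicts, and using these colours gives few monochromatic edges. *)
Lemma far_samples_list (R : realType) (k : nat) (e : R) (j : nat) :
  (0 < k)%N -> 0 < e ->
  exists (J : finType) (c : R), [/\ 0 < c, (0 < #|J|)%N &
  forall (T : finType) (w : rel T) (L : T -> {set 'I_k}), (0 < #|T|)%N ->
    (\sum_u #|L u|)%:R < j%:R * (e * #|T|%:R) ->
    (forall f : T -> 'I_k, 4 * e * #|T|%:R ^+ 2 <=
       (mono_edges w f)%:R + #|T|%:R * #|violations L f|%:R) ->
    c <= mean (fun x : {ffun J -> T} => (~~ list_colourable w L x)%:R)].
Proof.
move=> k0 e0; elim: j => [|j [J [c0 [c00 J0 IH]]]].
  exists unit, 1; split=> //; first by rewrite card_unit.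
  by move=> T w L T0; rewrite mul0r ltNge ler0n.
(* Colours outside the list of [u] will contribute a factor 1, so the bound for one colour is capped
   at 1. *)
pose c := Num.min c0 1.
have c_gt0 : 0 < c by rewrite lt_min c00 ltr01.
(* [None] is the vertex [u], and [Some (i, _)] is the sample that rules out colour [i] for it. The
   factor [e] is the chance that [u] falls in [G]. *)
exists (option ('I_k * J)), (e * c ^+ k); split.
- by rewrite mulr_gt0 // exprn_gt0.
- by rewrite card_option.
move=> T w L T0 total far.
have n0 : 0 < #|T|%:R :> R by rewrite ltr0n.
set n := #|T|%:R in n0 total far *.
pose D u i := #|[set v | w u v && (i \in L v)]|.
pose G := [set u | [forall i in L u, e * n <= (D u i)%:R]].
(* Otherwise give each vertex outside [G] a colour of its list with few conflicts. The monochromatic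
   edges number at most 2 n #|G| + e n^2 and the violations at most #|G|, for a total below 4 e n^2,
   against [far]. *)
have Gbig : e * n <= #|G|%:R.
  rewrite leNgt; apply/negP => Gs.
  pose i0 : 'I_k := Ordinal k0.
  pose f u := if [pick i | (i \in L u) && ((D u i)%:R < e * n)] is Some i then i else i0.
  have fP u : u \notin G -> f u \in L u /\ (D u (f u))%:R < e * n.
    rewrite inE negb_forall => /existsP[i]; rewrite negb_imply -ltNge => hi.
    by rewrite /f; case: pickP => [i' /andP[]//|/(_ i)]; rewrite hi.
  have viol : (#|violations L f| <= #|G|)%N.
    apply: subset_leq_card; apply/subsetP => u; rewrite inE; apply: contraR.
    by move=> /fP[].
  have monoU u : u \notin G ->
      #|[set v | w u v && (f v == f u)]|%:R <= e * n + #|G|%:R.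
    move=> /fP[_ Du]; have : (#|[set v | w u v && (f v == f u)]| <=
        D u (f u) + #|violations L f|)%N.
      apply: leq_trans (leq_card_setU _ _).
      apply: subset_leq_card; apply/subsetP => v; rewrite !inE => /andP[-> /eqP ev] /=.
      by rewrite -ev orbN.
    rewrite -(ler_nat R) natrD => /le_trans; apply; apply: lerD; first exact: ltW.
    by rewrite ler_nat.
  have : (mono_edges w f)%:R <= #|G|%:R * n + n * (e * n + #|G|%:R).
    rewrite /mono_edges natr_sum (bigID (mem G)) /=; apply: lerD.
      rewrite mulr_natl -sumr_const; apply: ler_sum => u _.
      by rewrite ler_nat max_card.
    rewrite [X in _ <= X]mulr_natl -sumr_const big_mkcond /=.
    apply: ler_sum => u _; case: ifP => [/monoU//|_].
    by rewrite addr_ge0 // mulr_ge0 // ltW.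
  move: (far f) viol Gs; rewrite -(ler_nat R).
  set y := #|violations L f|%:R; set g := #|G|%:R; set z := (mono_edges w f)%:R.
  move=> h1 h2 h3 h4.
  have h5 : n * g < n * (e * n) by rewrite ltr_pM2l.
  have h6 : n * y <= n * g by rewrite ler_pM2l.
  by move: h1; rewrite expr2; lra.
pose Lu u i v := if w u v then L v :\ i else L v.
have LuL u i v : Lu u i v \subset L v.
  by rewrite /Lu; case: ifP => // _; apply: subD1set.
have LuB u i : i \in L u -> u \in G ->
    c <= mean (fun y : {ffun J -> T} => (~~ list_colourable w (Lu u i) y)%:R).
  move=> iL uG; apply: le_trans (IH T w (Lu u i) T0 _ _); first by rewrite ge_min lexx.
    have sumE : (\sum_v #|L v| = \sum_v #|Lu u i v| + D u i)%N.
      rewrite /D -sum1_card [X in (_ + X)%N]big_mkcond -big_split /=; apply: eq_bigr => v _.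
      rewrite /Lu inE; case: (w u v) => /=; last by rewrite addn0.
      by rewrite (cardsD1 i (L v)) addnC; case: (i \in L v).
    move: total; rewrite sumE natrD -natr1.
    by move: uG; rewrite inE => /forall_inP/(_ i iL); lra.
  (* Shorter lists can only add violations, so the graph stays far. *)
  move=> f; apply: le_trans (far f) _; rewrite lerD2l ler_pM2l // ler_nat.
  apply: subset_leq_card; apply/subsetP => v; rewrite !inE.
  by apply: contra; apply: subsetP.
pose h (z : T * {ffun 'I_k -> {ffun J -> T}}) : {ffun option ('I_k * J) -> T} :=
  [ffun o => if o is Some ia then z.2 ia.1 ia.2 else z.1].
pose h' (x : {ffun option ('I_k * J) -> T}) : T * {ffun 'I_k -> {ffun J -> T}} :=
  (x None, [ffun i => [ffun a => x (Some (i, a))]]).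
have bh : bijective h.
  exists h'.
    move=> [u y]; rewrite /h' /h ffunE; congr (_, _).
    by apply/ffunP => i; apply/ffunP => a; rewrite !ffunE.
  by move=> x; apply/ffunP => -[[i a]|]; rewrite !ffunE.
rewrite -(mean_bij _ bh).
rewrite (mean_pair (fun u y => (~~ list_colourable w L (h (u, y)))%:R)).
apply: (@le_trans _ _ (mean (fun u => (u \in G)%:R * c ^+ k))).
  under eq_mean do rewrite mulrC.
  rewrite meanZ mulrC ler_wpM2l ?exprn_ge0 ?(ltW c_gt0) // mean_card -/n.
  by rewrite ler_pdivlMr // (_ : [set x in G] = G) //; apply/setP => u; rewrite inE.
apply: ler_mean => u; have [uG|_] := boolP (u \in G); last by rewrite mul0r mean_ge0.
rewrite mul1r.
pose B (i : 'I_k) (y : {ffun J -> T}) : R :=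
  ((i \in L u) ==> ~~ list_colourable w (Lu u i) y)%:R.
apply: (@le_trans _ _ (mean (fun y : {ffun 'I_k -> {ffun J -> T}} => \prod_i B i (y i)))).
  rewrite mean_prod -[X in c ^+ X](card_ord k) -prodr_const; apply: ler_prod => i _.
  rewrite (ltW c_gt0) /=; have [iL|iL] := boolP (i \in L u).
    by apply: le_trans (LuB u i iL uG) _; apply: ler_mean => y; rewrite /B iL.
  rewrite (eq_mean (G := fun=> 1)); last by move=> y; rewrite /B (negPf iL).
  by rewrite mean_cst ?ge_min ?lexx ?orbT // card_ffun expn_gt0 T0.
apply: ler_mean => y.
have [/existsP[i ni]|/existsPn all1] := boolP [exists i, B i (y i) == 0].
  by rewrite (bigD1 i) //= (eqP ni) mul0r.
rewrite [leLHS](_ : _ = 1); last first.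
  apply: big1 => i _; move: (all1 i); rewrite /B.
  by case: (_ ==> _); rewrite ?eqxx.
(* A list colouring of the whole sample would give [u] some colour [i] and then colour the block of
   [i] from the shortened lists. *)
rewrite (_ : ~~ _) //; apply/negP => /existsP[g /andP[/forallP gL /forallP gw]].
pose i := g None.
have iL : i \in L u by have := gL None; rewrite ffunE.
move: (all1 i); rewrite /B iL /= pnatr_eq0 eqb0 negbK => /negP; apply.
apply/existsP; exists [ffun a => g (Some (i, a))]; apply/andP; split.
  apply/forallP => a; rewrite ffunE /Lu.
  have := gL (Some (i, a)); rewrite ffunE /= => ga.
  case: ifP => // uv; rewrite !inE ga andbT.
  have /forallP/(_ (Some (i, a))) := gw None; rewrite !ffunE /= uv /=.
  by rewrite eq_sym.
apply/forallP => a; apply/forallP => b; rewrite !ffunE.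
by have /forallP/(_ (Some (i, b))) := gw (Some (i, a)); rewrite !ffunE.
Qed.

Definition colourable (T J : finType) (w : rel T) (k : nat) (x : {ffun J -> T}) : bool :=
  [exists g : {ffun J -> 'I_k}, [forall a, forall b, w (x a) (x b) ==> (g a != g b)]].

(** With full lists the total list size is k times the number of vertices, which fixes [j];
    replacing [e] by [e / 4] absorbs the factor 4. *)
Lemma far_samples (R : realType) (k : nat) (e : R) : (0 < k)%N -> 0 < e ->
  exists (J : finType) (c : R), [/\ 0 < c, (0 < #|J|)%N &
  forall (T : finType) (w : rel T), (0 < #|T|)%N ->
    (forall f : T -> 'I_k, e * #|T|%:R ^+ 2 <= (mono_edges w f)%:R) ->
    c <= mean (fun x : {ffun J -> T} => (~~ colourable w k x)%:R)].
Proof.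
move=> k0 e0; pose j := Num.bound (k%:R / (e / 4)).
have e40 : 0 < e / 4 by rewrite divr_gt0.
have [J [c [c0 J0 H]]] := far_samples_list j k0 e40.
exists J, c; split=> // T w T0 far.
apply: le_trans (H T w (fun=> setT) T0 _ _) _.
- under eq_bigr do rewrite cardsT card_ord.
  rewrite sum_nat_const natrM mulrC mulrA ltr_pM2r ?ltr0n //.
  by rewrite -ltr_pdivrMr //; apply: archi_boundP; rewrite divr_ge0 // ltW.
- move=> f; rewrite [4 * _](_ : _ = e); last by field.
  by apply: le_trans (far f) _; rewrite lerDl mulr_ge0.
- apply: ler_mean => x; rewrite ler_nat; apply: leq_bool; apply: contra.
  move=> /existsP[g gP]; apply/existsP; exists g; rewrite gP andbT.
  by apply/forallP => a; rewrite inE.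
Qed.

(** * Degrees in a random sample *)

Section Sampling.
Variables (R : realType) (T I : finType) (w : rel T).
Hypothesis T0 : (0 < #|T|)%N.

Let mu (v : T) : R := #|nonadj w v|%:R / #|T|%:R.

Let g (v u : T) : R := (~~ w v u)%:R - mu v.

Let dev (a : I) (x : {ffun I -> T}) : R := \sum_(b | b != a) g (x a) (x b).

Let mean_g v : mean (g v) = 0.
Proof. by rewrite meanD mean_card mean_cst // subrr. Qed.

Let g_sqr v u : g v u ^+ 2 <= 1.
Proof.
have m0 : 0 <= mu v by rewrite divr_ge0.
have m1 : mu v <= 1 by rewrite ler_pdivrMr ?ltr0n // mul1r ler_nat max_card.
rewrite /g; case: (w v u) => /=.
  by rewrite sub0r sqrrN exprn_ile1.
by rewrite exprn_ile1 ?subr_ge0 // gerBl.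
Qed.

(** In the expanded square the cross terms vanish: averaging over the coordinate [b] alone
    annihilates [g]. Each diagonal term is at most 1. *)
Lemma mean_dev_sqr a : mean (fun x => dev a x ^+ 2) <= #|I|%:R.
Proof.
under eq_mean do rewrite expr2 mulr_suml.
rewrite mean_sum; under eq_bigr do (under eq_mean do rewrite mulr_sumr; rewrite mean_sum).
have XI : (0 < #|{ffun I -> T}|)%N by rewrite card_ffun expn_gt0 T0.
have offdiag b b' : b != a -> b' != a -> b' != b ->
    mean (fun x : {ffun I -> T} => g (x a) (x b) * g (x a) (x b')) = 0.
  move=> ba b'a bb'; rewrite -(mean_upd b) //.
  rewrite (eq_mean (G := fun=> 0)) ?mean_cst // => x.
  under eq_mean do rewrite !ffunE eqxx eq_sym (negPf ba) (negPf bb') mulrC.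
  by rewrite meanZ mean_g mulr0.
rewrite -sum1_card natr_sum big_mkcond; apply: ler_sum => b _.
case: ifP => // ba; rewrite (bigD1 b) //= big1 => [|b' /andP[b'a bb']]; last first.
  exact: offdiag.
rewrite addr0 -(mean_cst 1 XI); apply: ler_mean => x.
by rewrite -expr2.
Qed.

(* Chebyshev's inequality. *)
Lemma mean_bad_degree (beta gamma eta : R) a : irreflexive w -> 0 < gamma ->
  4 / gamma <= #|I|%:R ->
  #|[set v | (beta - gamma) * #|T|%:R < #|nonadj w v|%:R]|%:R <= eta * #|T|%:R ->
  mean (fun x : {ffun I -> T} =>
    ((beta - gamma / 2) * #|I|%:R < #|[set b | ~~ w (x a) (x b)]|%:R)%R%:R)
    <= eta + 16 / (gamma ^+ 2 * #|I|%:R).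
Proof.
move=> wi g0 qbig few.
have q0 : 0 < #|I|%:R :> R by apply: lt_le_trans qbig; rewrite divr_gt0.
have n0 : 0 < #|T|%:R :> R by rewrite ltr0n.
pose low v := (beta - gamma) * #|T|%:R < #|nonadj w v|%:R.
apply: (@le_trans _ _ (mean (fun x : {ffun I -> T} => (low (x a))%:R
    + 16 / (gamma * #|I|%:R) ^+ 2 * dev a x ^+ 2))); last first.
  rewrite meanD (mean_coord a (fun v => (low v)%:R)) // meanZ; apply: lerD.
    by rewrite mean_card ler_pdivrMr.
  apply: le_trans (ler_wpM2l _ (mean_dev_sqr a)) _.
    by rewrite divr_ge0 // sqr_ge0.
  by rewrite le_eqVlt; apply/orP; left; apply/eqP; field; rewrite !gt_eqF.
apply: ler_mean => x; have c0 : 0 <= 16 / (gamma * #|I|%:R) ^+ 2 * dev a x ^+ 2.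
  by rewrite mulr_ge0 ?divr_ge0 ?sqr_ge0.
have [l|l] := boolP (low (x a)).
  by apply: le_trans (_ : 1 <= _); [case: (_ < _)|rewrite lerDl].
rewrite add0r; case: ltP => [bad|//].
have cnt : #|[set b | ~~ w (x a) (x b)]|%:R = 1 + \sum_(b | b != a) (~~ w (x a) (x b))%:R :> R.
  rewrite -sum1_card natr_sum big_mkcond (bigD1 a) //= inE wi; congr (_ + _).
  by apply: eq_bigr => b _; rewrite inE; case: (w _ _).
have devE : dev a x = #|[set b | ~~ w (x a) (x b)]|%:R - 1 - (#|I|%:R - 1) * mu (x a).
  rewrite cnt /dev /g sumrB sumr_const -[mu (x a) *+ _]mulr_natl.
  rewrite [X in X * mu _](_ : _ = #|I|%:R - 1); first by ring.
  rewrite (@eq_card _ _ (predC1 a)) // cardC1 -subn1 natrB //.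
  by apply/card_gt0P; exists a.
have muB : mu (x a) <= beta - gamma.
  by move: l; rewrite -leNgt /mu => l; rewrite ler_pdivrMr.
have mu0 : 0 <= mu (x a) by rewrite divr_ge0.
(* The gap between [beta - gamma / 2] and [beta - gamma] gives gamma q / 2. The sample [a] itself,
   always counted as a non-neighbour, costs 1, and this is at most gamma q / 4 by [qbig]. *)
have big : gamma * #|I|%:R / 4 <= dev a x.
  move: bad qbig; rewrite ler_pdivrMr // devE.
  set B := #|_|%:R; set q := #|I|%:R in q0 *; move=> bad qbig.
  have : q * mu (x a) <= q * (beta - gamma) by rewrite ler_pM2l.
  by lra.
rewrite -[leLHS](_ : (16 / (gamma * #|I|%:R) ^+ 2) * (gamma * #|I|%:R / 4) ^+ 2 = 1).
  rewrite ler_wpM2l ?divr_ge0 ?sqr_ge0 // lerXn2r ?nnegrE //.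
    by rewrite divr_ge0 // mulr_ge0 // ltW.
  by apply: le_trans big; rewrite divr_ge0 // mulr_ge0 // ltW.
by field; rewrite !gt_eqF.
Qed.

End Sampling.

(** * A robust Andrasfai-Erdos-Sos theorem for dense graphs *)

Lemma aes_subtype (T : finType) (w : rel T) (r : nat) (Q : {set T}) :
  (2 <= r)%N -> symmetric w -> irreflexive w ->
  (forall P, clique w P -> (#|P| < r)%N) ->
  {in Q, forall v, (3 * r - 4) * #|nonadj w v| < 3 * #|Q|}%N ->
  exists f : {v | v \in Q} -> 'I_r.-1, forall x y, w (val x) (val y) -> f x != f y.
Proof.
move=> r2 ws wi free miss.
apply: (andrasfai_erdos_sos r2 (w := fun x y : {v | v \in Q} => w (val x) (val y))).
- by move=> x y; apply: ws.
- by move=> x; apply: wi.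
- move=> P /cliqueP cP; rewrite -(card_imset _ val_inj); apply: free.
  apply/cliqueP => _ _ /imsetP[x xP ->] /imsetP[y yP ->] nxy.
  by apply: (cP x y xP yP); apply: contraNneq nxy => ->.
- move=> v; rewrite card_sig; apply: leq_ltn_trans (miss _ (valP v)).
  rewrite leq_mul2l -(card_imset _ val_inj); apply/orP; right.
  apply: subset_leq_card; apply/subsetP => _ /imsetP[x xP ->].
  by move: xP; rewrite !inE.
Qed.

(** For irreflexive [w] such a tuple is injective, hence an ordered copy of the complete graph on
    [r] vertices. *)
Definition complete (T : finType) (w : rel T) (r : nat) (y : {ffun 'I_r -> T}) : bool :=
  [forall i, forall j, (i != j) ==> w (y i) (y j)].

Lemma complete_of_clique (T : finType) (w : rel T) (r : nat) (Q : {set T}) :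
  clique w Q -> (r <= #|Q|)%N -> exists y : {ffun 'I_r -> T}, complete w y.
Proof.
move=> /cliqueP cQ rQ; exists [ffun i => enum_val (widen_ord rQ i)].
apply/forallP => i; apply/forallP => j; apply/implyP => ij; rewrite !ffunE.
apply: cQ; rewrite ?enum_valP //; apply: contra ij => /eqP/enum_val_inj e.
by apply/eqP/val_inj; have := congr1 val e.
Qed.

(** Take [M] independent samples of the kind given by [far_samples]. If the graph is far from
    (r-1)-partite, about [c * M] of these blocks are expected to be uncolourable. Without an
    r-clique, almost all of the joint sample is (r-1)-colourable by the exact theorem, so
    uncolourable blocks must contain points of low sample degree. Chebyshev bounds the expected
    number of such points by an arbitrarily small multiple of [M] plus a constant independent of
    [M], so a large [M] gives a contradiction. *)
Theorem dense_aes (R : realType) (r : nat) (gamma e : R) :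
  (2 <= r)%N -> 0 < gamma -> 0 < e ->
  exists eta kappa : R, [/\ 0 < eta, 0 < kappa &
  forall (T : finType) (w : rel T), symmetric w -> irreflexive w -> (0 < #|T|)%N ->
    mean (fun y : {ffun 'I_r -> T} => (complete w y)%:R) <= kappa ->
    #|[set v | (3 / (3 * r%:R - 4) - gamma) * #|T|%:R < #|nonadj w v|%:R]|%:R
      <= eta * #|T|%:R ->
    exists f : T -> 'I_r.-1, (mono_edges w f)%:R < e * #|T|%:R ^+ 2].
Proof.
move=> r2 g0 e0.
have k0 : (0 < r.-1)%N by case: r r2 => [|[]].
have [J [c [c0 J0 far]]] := far_samples k0 e0.
set beta := 3 / (3 * r%:R - 4).
have r4 : 2 <= 3 * r%:R - 4 :> R by have : 2 <= r%:R :> R; [rewrite ler_nat|lra].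
have e34 : (3 * r - 4)%:R = 3 * r%:R - 4 :> R.
  rewrite natrB; first by rewrite (natrM _ 3 r).
  by move: r2; lia.
pose B : R := 1 + 3 / gamma.
have B0 : 0 < B by rewrite addr_gt0 // divr_gt0.
have x0 : 0 <= 4 / c * (B * 16 / gamma ^+ 2) by rewrite ltW // !(mulr_gt0, invr_gt0, exprn_gt0).
have y0 : 0 < 4 / gamma by rewrite divr_gt0.
have [M Mbig] : exists M, 4 / c * (B * 16 / gamma ^+ 2) + 4 / gamma < M%:R.
  by eexists; apply: archi_boundP; rewrite addr_ge0 // ltW.
have M0 : 0 < M%:R :> R by apply: le_lt_trans Mbig; rewrite addr_ge0 // ltW.
pose q : R := M%:R * #|J|%:R.
have J1 : 1 <= #|J|%:R :> R by rewrite ler1n.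
have qM : M%:R <= q by rewrite ler_peMr // ltW.
have q0 : 0 < q by apply: lt_le_trans qM.
(* The constants are chosen so that [B * q * eta] is [M * c / 4] and so that the expected number of
   r-cliques among the [q ^+ r] index tuples is at most [c / 4]. *)
pose eta := c / (4 * #|J|%:R * B).
pose kappa := c / (4 * q ^+ r).
exists eta, kappa; split.
- by rewrite divr_gt0 // !mulr_gt0 // (lt_le_trans _ J1).
- by rewrite divr_gt0 // !mulr_gt0 // exprn_gt0.
move=> T w ws wi T0 fewK few; apply: contrapT => /forallNP nf.
have {nf} /far cnon : forall f : T -> 'I_r.-1, e * #|T|%:R ^+ 2 <= (mono_edges w f)%:R.
  by move=> f; have /negP := nf f; rewrite -leNgt.
have {cnon} := cnon T0 => cnon.
pose I : finType := ('I_M * J)%type.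
have cI : #|I|%:R = q by rewrite card_prod card_ord natrM.
pose wx (x : {ffun I -> T}) (i j : I) := w (x i) (x j).
pose bad (a : I) (x : {ffun I -> T}) : bool :=
  ((beta - gamma / 2) * #|I|%:R < #|[set b | ~~ w (x a) (x b)]|%:R).
pose ncol (i : 'I_M) (x : {ffun I -> T}) : bool :=
  ~~ colourable w r.-1 (pullback (fun j : J => (i, j)) x).
pose KR (x : {ffun I -> T}) : bool := [exists h : {ffun 'I_r -> I}, complete w (pullback h x)].
(* Without an r-clique and with fewer than gamma q / 3 bad points, the good points are
   (r-1)-colourable, so each uncolourable block contains a bad point. In the other cases the right
   side is at least [M]. *)
have pt x : \sum_i (ncol i x)%:R <= B * \sum_a (bad a x)%:R + M%:R * (KR x)%:R.
  have leM : \sum_i (ncol i x)%:R <= M%:R :> R.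
    rewrite -[in leRHS](card_ord M) -sum1_card natr_sum; apply: ler_sum => i _.
    by case: (ncol i x).
  have bad0 : 0 <= \sum_a (bad a x)%:R :> R by apply: sumr_ge0.
  have [kr|nkr] := boolP (KR x).
    by rewrite mulr1; apply: le_trans leM _; rewrite lerDr mulr_ge0 // ltW.
  rewrite mulr0 addr0; have [many|fewbad] := lerP (gamma * q / 3) (\sum_a (bad a x)%:R).
    apply: le_trans leM (le_trans qM _).
    apply: (@le_trans _ _ (3 / gamma * \sum_a (bad a x)%:R)).
      rewrite -[leLHS](_ : 3 / gamma * (gamma * q / 3) = q); last by field; rewrite gt_eqF.
      by rewrite ler_wpM2l // divr_ge0 // ltW.
    by rewrite ler_wpM2r // lerDr.
  pose Q := [set a | ~~ bad a x].
  have cQ : #|Q|%:R = q - \sum_a (bad a x)%:R.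
    rewrite -cI -natr_sum; apply/eqP; rewrite eq_sym subr_eq -natrD eqr_nat; apply/eqP.
    rewrite -[#|I|]sum1_card -[#|Q|]sum1_card [X in _ = (X + _)%N]big_mkcond -big_split /=.
    by apply: eq_bigr => a _; rewrite inE; case: (bad a x).
  have [||||f fP] := @aes_subtype I (wx x) r Q r2.
  - by move=> a b; apply: ws.
  - by move=> a; apply: wi.
  - move=> P cP; rewrite ltnNge; apply: contra nkr => rP.
    have [h hK] := complete_of_clique cP rP; apply/existsP; exists h.
    apply/forallP => i; apply/forallP => j; apply/implyP => ij.
    by have /forallP/(_ i)/forallP/(_ j)/implyP/(_ ij) := hK; rewrite !ffunE.
  - move=> a; rewrite inE /bad -leNgt cI => ha.
    rewrite -(ltr_nat R) [ltLHS]natrM [ltRHS]natrM cQ e34.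
    (* Since 3r - 4 is at least 2, the slack gamma / 2 gains gamma q, which exceeds three times the
       number of deleted bad points. *)
    apply: (@le_lt_trans _ _ ((3 * r%:R - 4) * ((beta - gamma / 2) * q))).
      by rewrite ler_wpM2l //; lra.
    rewrite [ltLHS](_ : _ = 3 * q - (3 * r%:R - 4) * (gamma * q / 2)); last first.
      by rewrite /beta; field; rewrite gt_eqF //; lra.
    have : 2 * (gamma * q / 2) <= (3 * r%:R - 4) * (gamma * q / 2).
      by rewrite ler_wpM2r // divr_ge0 // mulr_ge0 // ltW.
    by lra.
  apply: (@le_trans _ _ (\sum_a (bad a x)%:R)); last first.
    by rewrite ler_peMl // /B lerDl divr_ge0 // ltW.
  rewrite [leRHS](_ : _ = \sum_i \sum_j (bad (i, j) x)%:R); last first.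
    by rewrite pair_bigA; apply: eq_bigr => -[].
  apply: ler_sum => i _.
  rewrite -natr_sum ler_nat.
  have [/existsP[j bj]|/existsPn nb] := boolP [exists j, bad (i, j) x].
    by rewrite (bigD1 j) //= bj; case: (ncol i x).
  suff -> : ncol i x = false by [].
  apply/negbTE; rewrite /ncol negbK.
  have Qi j : (i, j) \in Q by rewrite inE.
  apply/existsP; exists [ffun j => f (exist _ (i, j) (Qi j))].
  apply/forallP => j; apply/forallP => j'; rewrite !ffunE; apply/implyP => ww.
  exact: fP.
have Kle : mean (fun x => (KR x)%:R) <= c / 4 :> R.
  apply: (@le_trans _ _ (mean (fun x => \sum_(h : {ffun 'I_r -> I})
     (complete w (pullback h x))%:R))).
    apply: ler_mean => x; rewrite -natr_sum ler_nat /KR; case: existsP => // -[h hx].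
    by rewrite (bigD1 h) //= hx.
  rewrite mean_sum; apply: (@le_trans _ _ (\sum_(h : {ffun 'I_r -> I}) kappa)).
    apply: ler_sum => h _; have [/injectiveP inj|ninj] := boolP (injectiveb h).
      by rewrite (mean_pullback (fun y => (complete w y)%:R)).
    rewrite (eq_mean (G := fun=> 0)).
      by rewrite mean_cst ?card_ffun ?expn_gt0 ?T0 // ltW // divr_gt0 // mulr_gt0 // exprn_gt0.
    move=> x; case: (boolP (complete w _)) => // cx; case/injectivePn: ninj => i [j ij hij].
    have /forallP/(_ i)/forallP/(_ j) := cx.
    by rewrite eq_sym in ij; rewrite eq_sym ij !ffunE hij wi.
  rewrite sumr_const card_ffun card_ord -[kappa *+ _]mulr_natl natrX cI /kappa.
  have : 0 < q ^+ r by rewrite exprn_gt0.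
  move: (q ^+ r) => z z0.
  by rewrite le_eqVlt; apply/orP; left; apply/eqP; field; rewrite gt_eqF.
have lhs : M%:R * c <= mean (fun x => \sum_i (ncol i x)%:R).
  rewrite mean_sum -[in leLHS](card_ord M) mulr_natl -sumr_const; apply: ler_sum => i _.
  rewrite (mean_pullback (fun y => (~~ colourable w r.-1 y)%:R)) //.
  by move=> j j' [].
have rhs : mean (fun x => \sum_i (ncol i x)%:R)
    <= B * (q * (eta + 16 / (gamma ^+ 2 * q))) + M%:R * (c / 4).
  apply: le_trans (ler_mean pt) _; rewrite meanD !meanZ; apply: lerD; last first.
    by rewrite ler_wpM2l.
  rewrite ler_wpM2l ?(ltW B0) // mean_sum -cI mulr_natl -sumr_const.
  apply: ler_sum => a _; apply: mean_bad_degree => //.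
  by rewrite cI; apply: le_trans qM; apply: ltW; apply: le_lt_trans Mbig; rewrite lerDr.
have := le_trans lhs rhs; apply/negP; rewrite -ltNge.
rewrite [B * _](_ : _ = M%:R * c / 4 + B * 16 / gamma ^+ 2); last first.
  by rewrite /eta /q; field; rewrite !gt_eqF // (lt_le_trans _ J1).
have : B * 16 / gamma ^+ 2 <= M%:R * c / 4; last first.
  by have := mulr_gt0 M0 c0; lra.
rewrite -[leLHS](_ : c / 4 * (4 / c * (B * 16 / gamma ^+ 2)) = _); last first.
  by field; rewrite !gt_eqF.
rewrite [leRHS](_ : _ = c / 4 * M%:R); last by ring.
rewrite ler_wpM2l //; first by rewrite divr_ge0 // ltW.
by apply: ltW; apply: le_lt_trans Mbig; rewrite lerDl ltW.
Qed.


(** * Supersaturation: many cliques give many copies of every [r]-colourable graph *)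

Section Supersaturation.
Variables (R : realType) (T B : finType) (w : rel T) (r : nat) (b0 : B).
Hypothesis T0 : (0 < #|T|)%N.

Let Y := {ffun B -> T}.

(* The first j coordinates have been blown up. *)
Definition blown_up (j : nat) (z : {ffun 'I_r -> Y}) : bool :=
  [forall s : {ffun 'I_r -> B}, [forall i : 'I_r, (j <= i)%N ==> (s i == b0)] ==>
     complete w [ffun i => z i (s i)]].

Definition curry_ffun (x : {ffun 'I_r * B -> T}) : {ffun 'I_r -> Y} :=
  [ffun i => [ffun b => x (i, b)]].

Lemma curry_ffun_bij : bijective curry_ffun.
Proof.
exists (fun z : {ffun 'I_r -> Y} => [ffun p => z p.1 p.2]) => x.
  by apply/ffunP => -[i b]; rewrite !ffunE.
by apply/ffunP => i; apply/ffunP => b; rewrite !ffunE.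
Qed.

Let Y0 : (0 < #|Y|)%N.
Proof. by rewrite card_ffun expn_gt0 T0. Qed.

Lemma mean_blown_up0 :
  mean (fun z => (blown_up 0 z)%:R) = mean (fun y : {ffun 'I_r -> T} => (complete w y)%:R) :> R.
Proof.
rewrite -(mean_bij _ curry_ffun_bij).
rewrite -[RHS](mean_pullback (I := ('I_r * B)%type) (h := fun i => (i, b0))) //; last first.
  by move=> i j [].
apply: eq_mean => x; congr (_ : bool)%:R; apply/forallP/idP => [H|H s].
  have /implyP := H [ffun=> b0].
  rewrite (_ : [ffun i => _] = pullback (fun i => (i, b0)) x).
    by apply; apply/forallP => i; rewrite ffunE eqxx.
  by apply/ffunP => i; rewrite !ffunE.
apply/implyP => /forallP sb.
rewrite (_ : [ffun i => _] = pullback (fun i => (i, b0)) x) //.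
by apply/ffunP => i; rewrite !ffunE (eqP (sb i)).
Qed.

(** Fix all coordinates but [j]. If one random vertex at [j] completes the structure with
    probability zeta, then #|B| independent ones all do so with probability zeta ^ #|B|, and
    Jensen's inequality averages this over the other coordinates. *)
Lemma mean_blown_up_succ (j : 'I_r) :
  mean (fun z => (blown_up j z)%:R) ^+ #|B| <= mean (fun z => (blown_up j.+1 z)%:R) :> R.
Proof.
pose Z (z : {ffun 'I_r -> Y}) (t : T) : bool :=
  [forall s : {ffun 'I_r -> B}, [forall i : 'I_r, (j <= i)%N ==> (s i == b0)] ==>
     complete w [ffun i => if i == j then t else z i (s i)]].
pose zeta z : R := mean (fun t => (Z z t)%:R).
have zeta_lo z : mean (fun y : Y => (blown_up j (upd z j y))%:R) = zeta z.
  rewrite -[RHS](mean_coord (I := B) b0) //; apply: eq_mean => y; congr (_ : bool)%:R.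
  apply: eq_forallb => s; case: (boolP [forall i, _]) => //= /forallP sb.
  congr complete; apply/ffunP => i; rewrite !ffunE; case: eqP => // ->.
  by have /implyP/(_ (leqnn _))/eqP -> := sb j.
have zeta_hi z : mean (fun y : Y => (blown_up j.+1 (upd z j y))%:R) = zeta z ^+ #|B|.
  rewrite -prodr_const -(mean_prod (fun _ t => (Z z t)%:R)); apply: eq_mean => y.
  have [/forallP H|/forallPn[b nb]] := boolP [forall b, Z z (y b)].
    rewrite big1 => [|b _]; last by rewrite H.
    suff -> : blown_up j.+1 (upd z j y) by [].
    apply/forallP => s; apply/implyP => /forallP sb.
    have /forallP/(_ [ffun i => if i == j then b0 else s i])/implyP := H (s j).
    rewrite (_ : [ffun i => _] = [ffun i => upd z j y i (s i)]).
      apply; apply/forallP => i; rewrite !ffunE.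
      have [_|ij] := eqVneq i j; first by rewrite eqxx implybT.
      apply/implyP => ji; have /implyP := sb i; apply.
      by rewrite ltn_neqAle eq_sym ji andbT; apply: contra ij => /eqP e; apply/eqP/val_inj.
    by apply/ffunP => i; rewrite !ffunE; case: eqP => [->|].
  rewrite (bigD1 b) //= (negPf nb) mul0r.
  suff /negPf-> : ~~ blown_up j.+1 (upd z j y) by [].
  apply/negP => /forallP H; move/negP: nb; apply; apply/forallP => s.
  apply/implyP => /forallP sb.
  have /implyP := H [ffun i => if i == j then b else s i].
  rewrite (_ : [ffun i => _] = [ffun i => if i == j then y b else z i (s i)]).
    apply; apply/forallP => i; rewrite !ffunE; apply/implyP => ji.
    rewrite ifN; last by apply: contraTneq ji => ->; rewrite ltnn.
    by have /implyP := sb i; apply; apply: ltnW.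
  by apply/ffunP => i; rewrite !ffunE; case: (i == j).
rewrite -(mean_upd j (fun z => (blown_up j z)%:R)) //.
rewrite -(mean_upd j (fun z => (blown_up j.+1 z)%:R)) //.
under eq_mean do rewrite zeta_lo; under [leRHS]eq_mean do rewrite zeta_hi.
apply: mean_pow => [|z]; first by rewrite card_ffun expn_gt0 Y0.
exact: mean_ge0.
Qed.

Lemma mean_blown_up j : (j <= r)%N ->
  mean (fun y : {ffun 'I_r -> T} => (complete w y)%:R) ^+ (#|B| ^ j)
    <= mean (fun z => (blown_up j z)%:R) :> R.
Proof.
elim: j => [|j IH] jr; first by rewrite expn0 expr1 mean_blown_up0.
apply: le_trans (mean_blown_up_succ (Ordinal jr)).
rewrite expnSr exprM; apply: lerXn2r; rewrite ?nnegrE ?exprn_ge0 ?mean_ge0 //.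
exact: IH (ltnW jr).
Qed.

End Supersaturation.

Definition hom (U T : finType) (h : rel U) (w : rel T) (x : {ffun U -> T}) : bool :=
  [forall a, forall b, h a b ==> w (x a) (x b)].

(** A complete [r]-partite graph with classes indexed by [U] receives a homomorphism from [h] that
    sends [u] to its own copy in class [phi u]. *)
Lemma supersaturation (R : realType) (U T : finType) (h : rel U) (w : rel T)
    (r : nat) (phi : U -> 'I_r) : (0 < #|T|)%N -> (0 < #|U|)%N ->
  (forall a b, h a b -> phi a != phi b) ->
  mean (fun y : {ffun 'I_r -> T} => (complete w y)%:R) ^+ (#|U| ^ r)
    <= mean (fun x => (hom h w x)%:R) :> R.
Proof.
move=> T0 /card_gt0P[u0 _] hphi.
apply: le_trans (mean_blown_up R w u0 T0 (leqnn r)) _.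
rewrite -(mean_bij _ (@curry_ffun_bij T U r)).
rewrite -[leRHS](mean_pullback (I := ('I_r * U)%type) (h := fun u => (phi u, u))) //; last first.
  by move=> a b [].
apply: ler_mean => x; rewrite ler_nat; apply: leq_bool => /forallP H.
apply/forallP => a; apply/forallP => b; apply/implyP => hab.
have /implyP := H [ffun i => if i == phi a then a else b].
move=> /(_ _)/forallP/(_ (phi a))/forallP/(_ (phi b))/implyP.
rewrite !ffunE eqxx [phi b == _]eq_sym (negPf (hphi _ _ hab)) => -> //.
by apply/forallP => i; rewrite leqNgt ltn_ord.
Qed.

Lemma mean_noninjective (R : realType) (U T : finType) : (0 < #|T|)%N ->
  mean (fun x : {ffun U -> T} => (~~ injectiveb x)%:R) <= #|U|%:R ^+ 2 / #|T|%:R :> R.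
Proof.
move=> T0.
apply: (@le_trans _ _ (mean (fun x : {ffun U -> T} =>
    \sum_(p : U * U | p.1 != p.2) (x p.1 == x p.2)%:R))).
  apply: ler_mean => x; rewrite -natr_sum ler_nat.
  case: injectivePn => // -[a [b ab xab]].
  by rewrite (bigD1 (a, b)) //= xab eqxx.
rewrite mean_sum; apply: (@le_trans _ _ (\sum_(p : U * U) (#|T|%:R)^-1)); last first.
  by rewrite sumr_const card_prod -[_ *+ _]mulr_natl natrM expr2.
rewrite big_mkcond; apply: ler_sum => -[a b] _; case: ifP => /= ab; last by rewrite invr_ge0.
rewrite -(mean_upd a) //.
have mE (x : {ffun U -> T}) : mean (fun t => (upd x a t a == upd x a t b)%:R) = (#|T|%:R)^-1 :> R.
  under eq_mean do rewrite !ffunE eqxx [b == a]eq_sym (negPf ab).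
  rewrite mean_card (_ : [set t | _] = [set x b]) ?cards1 ?div1r //.
  by apply/setP => t; rewrite !inE eq_sym.
under eq_mean do rewrite mE.
by rewrite mean_cst // card_ffun expn_gt0 T0.
Qed.

(** Supersaturation turns few copies into few cliques. The bound on [eps^-1] makes the number of
    vertices large enough for the non-injective maps to be negligible. *)
Theorem dense_hom (R : realType) (U : finType) (h : rel U) (r : nat) (phi : U -> 'I_r)
    (gamma e : R) : (2 <= r)%N -> (0 < #|U|)%N ->
  (forall a b, h a b -> phi a != phi b) -> 0 < gamma -> 0 < e ->
  exists eta eps : R, [/\ 0 < eta, 0 < eps &
  forall (T : finType) (w : rel T), symmetric w -> irreflexive w -> (0 < #|T|)%N ->
    eps^-1 <= #|T|%:R ->
    #|[set x : {ffun U -> T} | injectiveb x && hom h w x]|%:R <= eps * #|T|%:R ^+ #|U| ->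
    #|[set v | (3 / (3 * r%:R - 4) - gamma) * #|T|%:R < #|nonadj w v|%:R]|%:R
      <= eta * #|T|%:R ->
    exists f : T -> 'I_r.-1, (mono_edges w f)%:R < e * #|T|%:R ^+ 2].
Proof.
move=> r2 U0 hphi g0 e0.
have [eta [kappa [eta0 kappa0 H]]] := dense_aes r2 g0 e0.
pose m := (#|U| ^ r)%N.
have m0 : (0 < m)%N by rewrite expn_gt0 U0.
pose B : R := 1 + #|U|%:R ^+ 2.
have B0 : 0 < B by rewrite ltr_pwDl // sqr_ge0.
pose eps := kappa ^+ m / B.
have eps0 : 0 < eps by rewrite divr_gt0 // exprn_gt0.
exists eta, eps; split=> // T w ws wi T0 big few low.
have n0 : 0 < #|T|%:R :> R by rewrite ltr0n.
apply: H => //; rewrite -(ler_pXn2r m0) ?nnegrE ?mean_ge0 ?(ltW kappa0) //.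
apply: le_trans (supersaturation R w T0 U0 hphi) _.
apply: (@le_trans _ _ (mean (fun x : {ffun U -> T} =>
    (injectiveb x && hom h w x)%:R + (~~ injectiveb x)%:R))).
  apply: ler_mean => x; rewrite -natrD ler_nat.
  by case: (injectiveb x); case: (hom h w x).
rewrite meanD mean_card card_ffun natrX.
apply: (@le_trans _ _ (eps + #|U|%:R ^+ 2 * eps)).
  apply: lerD; first by rewrite ler_pdivrMr // exprn_gt0.
  apply: le_trans (mean_noninjective _ _ T0) _; rewrite ler_wpM2l ?sqr_ge0 //.
  by rewrite -[leRHS]invrK lef_pV2 // posrE ?invr_gt0.
by rewrite -[X in X + _]mul1r -mulrDl -/B mulrC /eps divfK // gt_eqF.
Qed.


(** * A hypergraph container lemma *)

Section Containers.
Variables (R : realType) (V Om : finType).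
Implicit Types (A B : {set Om}) (e : Om -> {set V}) (I J S X : {set V}).

(** Edges are indexed by [Om] and counted with multiplicity, because links of distinct edges may
    coincide as sets. *)
Definition hdeg A e J : nat := #|[set w in A | J \subset e w]|.

Definition indep A e I : bool := [forall w in A, ~~ (e w \subset I)].

Lemma hdegS A B e J : A \subset B -> (hdeg A e J <= hdeg B e J)%N.
Proof.
move=> /subsetP AB; apply: subset_leq_card; apply/subsetP => w.
by rewrite !inE => /andP[/AB-> ->].
Qed.

Lemma sum_hdeg1 A e X : (\sum_(v in X) hdeg A e [set v] = \sum_(w in A) #|e w :&: X|)%N.
Proof.
rewrite /hdeg.
under eq_bigr do rewrite -sum1_card big_mkcond /=.
under [RHS]eq_bigr do rewrite -sum1_card big_mkcond /=.
rewrite exchange_big /= [RHS]big_mkcond /=; apply: eq_bigr => w _.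
rewrite big_mkcond /=; case wA: (w \in A); last first.
  by rewrite big1 // => v _; rewrite inE wA; case: ifP.
apply: eq_bigr => v _; rewrite !inE wA sub1set.
by case: (v \in X); case: (v \in e w).
Qed.

Lemma sum_hdeg_nonempty A e l : {in A, forall w, #|e w| = l} ->
  (\sum_(J | J != set0) hdeg A e J <= 2 ^ l * #|A|)%N.
Proof.
move=> el; rewrite /hdeg.
under eq_bigr do rewrite -sum1_card big_mkcond /=.
rewrite exchange_big /= mulnC -sum_nat_const [leqRHS]big_mkcond /=.
apply: leq_sum => w _; case wA: (w \in A); last first.
  by rewrite big1 // => J _; rewrite inE wA.
rewrite -(el _ wA) -card_powerset -sum1_card [leqRHS]big_mkcond /=.
rewrite big_mkcond /=; apply: leq_sum => J _; rewrite !inE wA /=.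
by case: ifP => //; case: ifP.
Qed.

(* The vertices are scanned in a fixed order.  A vertex v is put into the
   fingerprint S if it lies in I and has large degree among the edges which
   are still alive; the links of the chosen vertices form the edges (B, f) of a
   hypergraph of smaller uniformity, in which th bounds the degrees.  Since
   only S matters, scanning with S in place of I has the same outcome. *)
Record state := State { fprint : {set V}; links : {set Om}; link : Om -> {set V} }.

Section Scan.
Variables (A : {set Om}) (e : Om -> {set V}) (d : R) (m : nat) (th : nat -> R).

Definition saturated (s : state) J : bool :=
  (J != set0) && (th #|J| <= (hdeg (links s) (link s) J)%:R).

(** An edge stops being available once it meets the fingerprint or contains a set whose degree among
    the links has reached its threshold; this keeps all degrees of the link hypergraph bounded. *)
Definition alive (s : state) : {set Om} :=
  [set w in A | [disjoint e w & fprint s] &&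
     [forall J : {set V}, (J \subset e w) ==> ~~ saturated s J]].

Definition pick_vertex (s : state) (v : V) : state :=
  State (v |: fprint s) (links s :|: [set w in alive s | v \in e w])
    (fun w => if (w \in alive s) && (v \in e w) then e w :\ v else link s w).

Definition scan_cond (s : state) I v : bool :=
  [&& v \in I, d <= (hdeg (alive s) e [set v])%:R & (#|fprint s| < m)%N].

Fixpoint scan (I : {set V}) (vs : seq V) (s : state) : state :=
  if vs is v :: vs' then scan I vs' (if scan_cond s I v then pick_vertex s v else s)
  else s.

Lemma scan_ind (P : state -> Prop) I vs s : P s ->
  (forall s v, P s -> scan_cond s I v -> P (pick_vertex s v)) -> P (scan I vs s).
Proof.
move=> + step; elim: vs s => //= v vs IH s Ps; apply: IH.
by case: ifP => // h; apply: step.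
Qed.

Lemma scan_fprint_mono I vs s : fprint s \subset fprint (scan I vs s).
Proof.
elim: vs s => //= v vs IH s; apply: subset_trans (IH _).
by case: ifP => // _; apply: subsetUr.
Qed.

Lemma scan_fprint_sub I vs s : fprint s \subset I -> fprint (scan I vs s) \subset I.
Proof.
move=> sI; apply: (scan_ind (P := fun s => fprint s \subset I)) => // s' v s'I.
by case/and3P => vI _ _; rewrite subUset sub1set vI.
Qed.

(** A vertex is selected only if it lies in [I], and every selected vertex ends up in the
    fingerprint, so membership in [I] and in the fingerprint decide each step alike. Hence the
    fingerprint alone reproduces the scan. *)
Lemma scan_fprint I vs s : fprint s \subset I ->
  scan (fprint (scan I vs s)) vs s = scan I vs s.
Proof.
elim: vs s => //= v vs IH s sI.
have [c|c] := boolP (scan_cond s I v).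
  have sI' : fprint (pick_vertex s v) \subset I.
    by rewrite subUset sI sub1set andbT; case/and3P: c.
  rewrite {1}/scan_cond; have -> : v \in fprint (scan I vs (pick_vertex s v)).
    by apply: (subsetP (scan_fprint_mono _ _ _)); rewrite setU11.
  by case/and3P: (c) => _ -> -> /=; apply: IH.
have -> : scan_cond s (fprint (scan I vs s)) v = false; last exact: IH.
apply: contraNF c => /and3P[h d' m']; apply/and3P; split=> //.
exact: subsetP (scan_fprint_sub _ sI) _ h.
Qed.

(* links s never shrinks and link s w never changes once w is a link. *)
Definition scan_inv (s : state) : Prop :=
  [/\ links s \subset A, (#|fprint s| <= m)%N,
      {in links s, forall w, exists2 v, v \in fprint s &
         v \in e w /\ link s w = e w :\ v}
    & d * #|fprint s|%:R <= #|links s|%:R].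

Lemma alive_links s : scan_inv s -> {in alive s, forall w, w \notin links s}.
Proof.
move=> [_ _ lk _] w; rewrite inE => /and3P[_ dis _]; apply/negP => /lk[v vS [ve _]].
by move/pred0P/(_ v): dis; rewrite /= ve vS.
Qed.

Lemma hdeg_pick s v J : scan_inv s ->
  hdeg (links (pick_vertex s v)) (link (pick_vertex s v)) J =
  (hdeg (links s) (link s) J
    + #|[set w in alive s | (v \in e w) && (J \subset e w :\ v)]|)%N.
Proof.
move=> /alive_links; rewrite /hdeg /pick_vertex /=.
move: (alive s) => a al; rewrite -cardsUI.
rewrite [X in (_ + #|pred_of_set X|)%N](_ : _ = set0) ?cards0 ?addn0.
  apply: eq_card => w; rewrite !inE.
  have [wa|wa] := boolP (w \in a); last by rewrite /= !orbF.
  by rewrite (negPf (al _ wa)) /=; case: (v \in e w).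
apply/setP => w; rewrite !inE.
have [wa|wa] := boolP (w \in a); last by rewrite andbF.
by rewrite (negPf (al _ wa)).
Qed.

Lemma scan_inv_pick s I v : scan_inv s -> scan_cond s I v -> scan_inv (pick_vertex s v).
Proof.
move=> inv /and3P[vI dv ltm]; have [sA sm lk ds] := inv; split.
- rewrite subUset sA; apply/subsetP => w; rewrite !inE.
  by move=> /andP[/andP[->]].
- by rewrite /= cardsU1; case: (v \notin _) => /=; lia.
- move=> w; rewrite /= in_setU inE => /orP[wl|/andP[wa vw]]; last first.
    by exists v; rewrite ?setU11 // wa vw.
  have [u uS [ue ul]] := lk w wl; exists u; first by rewrite setU1r.
  split=> //; case: ifP => // /andP[/(alive_links inv)].
  by rewrite wl.
- have [vS|vS] := boolP (v \in fprint s).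
    rewrite /= (setUidPr _) ?sub1set //; apply: le_trans ds _; rewrite ler_nat.
    by apply: subset_leq_card; apply: subsetUl.
  rewrite /= cardsU1 vS natrD mulrDr mulr1.
  rewrite cardsU disjoint_setI0 ?cards0 ?subn0; last first.
    rewrite disjoint_sym; apply/pred0P => w /=; rewrite !inE -!andbA.
    apply/negP => /and5P[wA d1 f1 _ wl].
    have := alive_links inv (x := w); rewrite inE wA d1 f1 => /(_ isT).
    by rewrite wl.
  rewrite natrD addrC; apply: lerD => //; apply: le_trans dv _.
  rewrite ler_nat; apply: subset_leq_card; apply/subsetP => w.
  by rewrite !inE sub1set.
Qed.

Lemma hdeg_pick_ge s v J : scan_inv s ->
  (hdeg (links s) (link s) J <= hdeg (links (pick_vertex s v)) (link (pick_vertex s v)) J)%N.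
Proof. by move=> inv; rewrite hdeg_pick // leq_addr. Qed.

Lemma alive_pick s v : scan_inv s -> alive (pick_vertex s v) \subset alive s.
Proof.
move=> inv; apply/subsetP => w; rewrite !inE => /and3P[-> dis /forallP sat] /=.
apply/andP; split.
  by apply: disjointWr dis; apply: subsetUr.
apply/forallP => J; apply/implyP => Je; have /implyP/(_ Je) := sat J.
apply: contra; rewrite /saturated => /andP[-> h] /=.
by apply: le_trans h _; rewrite ler_nat hdeg_pick_ge.
Qed.

Lemma scan_alive I vs s : scan_inv s -> alive (scan I vs s) \subset alive s.
Proof.
elim: vs s => //= v vs IH s inv.
case: ifP => [c|_]; last exact: IH.
apply: subset_trans (alive_pick v inv); apply: IH; exact: scan_inv_pick inv c.
Qed.

(** If the fingerprint never filled up, a vertex of [I] was either selected, and then lies in no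
    alive edge, or rejected for small degree, and degrees in the alive edges only decrease. *)
Lemma scan_deg_lt I vs s : 0 < d -> scan_inv s ->
  (#|fprint (scan I vs s)| < m)%N ->
  {in vs, forall v, v \in I -> (hdeg (alive (scan I vs s)) e [set v])%:R < d}.
Proof.
move=> d0; elim: vs s => //= v vs IH s inv ltm u; rewrite inE => /orP[/eqP->|uvs uI].
  move=> vI; rewrite ltNge; apply/negP => dv; move: ltm dv.
  case: ifP => [c|c] ltm dv.
    have : (hdeg (alive (scan I vs (pick_vertex s v))) e [set v] = 0)%N.
      apply/eqP; rewrite cards_eq0; apply/eqP/setP => w; rewrite !inE sub1set.
      apply/negP => /andP[/and3P[_ dis _] vw]; move/pred0P/(_ v): dis.
      rewrite /= vw (subsetP (scan_fprint_mono _ _ _)) //.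
      by rewrite setU11.
    by move=> h; move: dv; rewrite h leNgt d0.
  move: c; rewrite /scan_cond vI /= => /negbT; rewrite negb_and -leqNgt => /orP[].
    rewrite -ltNge => lt; suff le : (hdeg (alive (scan I vs s)) e [set v])%:R
        <= (hdeg (alive s) e [set v])%:R :> R.
      by have := le_lt_trans (le_trans dv le) lt; rewrite ltxx.
    by rewrite ler_nat; apply: hdegS; apply: scan_alive.
  move=> /leq_trans /(_ (subset_leq_card (scan_fprint_mono I vs s))).
  by rewrite leqNgt ltm.
case: ifP ltm => [c|c] ltm; last exact: IH.
by apply: IH => //; apply: scan_inv_pick inv c.
Qed.

Lemma card_touching S :
  (#|[set w in A | ~~ [disjoint e w & S]]| <= \sum_(v in S) hdeg A e [set v])%N.
Proof.
rewrite sum_hdeg1 -sum1_card big_mkcond [leqRHS]big_mkcond /=.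
apply: leq_sum => w _; rewrite inE; case: (w \in A) => //=.
by rewrite -setI_eq0 -card_gt0; case: ifP.
Qed.

End Scan.

End Containers.

(** The usual co-degree condition, where [#|A| / N] stands for the average degree. *)
Definition codeg_bounded (R : realType) (V Om : finType) (A : {set Om})
    (e : Om -> {set V}) (K tau N : R) : Prop :=
  forall J : {set V}, J != set0 ->
    (hdeg A e J)%:R <= K * tau ^+ #|J|.-1 * (#|A|%:R / N).

Section ContainerStep.
Variables (R : realType) (V Om : finType) (A : {set Om}) (e : Om -> {set V}).
Variables (X : {set V}) (tau N K : R) (m l : nat).
Hypotheses (K1 : 1 <= K) (tau0 : 0 < tau) (tauK : tau <= (8 * K)^-1) (N0 : 0 < N).
Hypotheses (mtau : m%:R <= 2 * tau * N) (taum : tau * N <= m%:R).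
Hypotheses (A0 : A != set0) (el : {in A, forall w, #|e w| = l.+2}).
Hypotheses (eX : {in A, forall w, e w \subset X}) (XN : #|X|%:R <= N).
Hypothesis (eK : codeg_bounded A e K tau N).

Let a : R := #|A|%:R / N.
(** The power of two makes the loss to saturated sets in [container_alive], namely 2^(l+2) K^2 / K'
    times #|A|, equal to a quarter of the edges. *)
Let K' : R := 2 ^+ l.+4 * K ^+ 2.
Let th (j : nat) : R := K' * tau ^+ j * a.
Let d : R := a / 4.
Let st0 : state V Om := State set0 set0 e.

Definition container_scan (I : {set V}) : state V Om :=
  scan A e d m th I (enum V) st0.

Let a_gt0 : 0 < a.
Proof. by rewrite divr_gt0 // ltr0n card_gt0. Qed.

Let K_gt0 : 0 < K.
Proof. exact: lt_le_trans K1. Qed.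

Let Ka_ge0 : 0 <= K * a.
Proof. exact: mulr_ge0 (ltW K_gt0) (ltW a_gt0). Qed.

Let K'_gt0 : 0 < K'.
Proof. by rewrite mulr_gt0 // exprn_gt0. Qed.

Let th_ge0 j : 0 <= th j.
Proof. exact: mulr_ge0 (mulr_ge0 (ltW K'_gt0) (exprn_ge0 _ (ltW tau0))) (ltW a_gt0). Qed.

Let d_gt0 : 0 < d.
Proof. exact: divr_gt0. Qed.

Let KK'tau_ge0 : 0 <= K / (K' * tau).
Proof. exact: divr_ge0 (ltW K_gt0) (mulr_ge0 (ltW K'_gt0) (ltW tau0)). Qed.

Let aN : a * N = #|A|%:R.
Proof. by rewrite /a divfK // gt_eqF. Qed.

Let inv0 : scan_inv A e d m st0.
Proof.
by split; rewrite /= ?sub0set ?cards0 ?mulr0 // => w; rewrite inE.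
Qed.

Let deg1 (v : V) : (hdeg A e [set v])%:R <= K * a.
Proof.
have := eK (J := [set v]); rewrite cards1 expr0 mulr1; apply.
by rewrite -card_gt0 cards1.
Qed.

Lemma container_scan_inv I : scan_inv A e d m (container_scan I).
Proof. by apply: scan_ind inv0 _ => s v; apply: scan_inv_pick. Qed.

Lemma container_touch I :
  #|[set w in A | ~~ [disjoint e w & fprint (container_scan I)]]|%:R
    <= 2 * tau * K * #|A|%:R.
Proof.
have [_ Sm _ _] := container_scan_inv I.
set S := fprint _ in Sm *.
have h1 : #|[set w in A | ~~ [disjoint e w & S]]|%:R
    <= (\sum_(v in S) hdeg A e [set v])%:R :> R by rewrite ler_nat card_touching.
have h2 : (\sum_(v in S) hdeg A e [set v])%:R <= #|S|%:R * (K * a) :> R.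
  rewrite natr_sum -sum1_card natr_sum mulr_suml; apply: ler_sum => v _.
  by rewrite mul1r.
have h3 : #|S|%:R * (K * a) <= 2 * tau * N * (K * a).
  rewrite (ler_wpM2r Ka_ge0) //.
  by apply: (le_trans _ mtau); rewrite ler_nat.
apply: le_trans h1 (le_trans h2 (le_trans h3 _)).
by rewrite -aN; lra.
Qed.

Lemma container_links I :
  #|links (container_scan I)|%:R <= 2 * tau * K * #|A|%:R.
Proof.
have [lA _ lk _] := container_scan_inv I.
apply: (le_trans _ (container_touch I)); rewrite ler_nat.
apply: subset_leq_card; apply/subsetP => w wl; rewrite inE (subsetP lA) //=.
have [v vS [ve _]] := lk w wl; apply/negP => /pred0P/(_ v).
by rewrite /= ve vS.
Qed.

Lemma container_link_uniform I :
  {in links (container_scan I), forall w, #|link (container_scan I) w| = l.+1}.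
Proof.
have [/subsetP lA _ lk _] := container_scan_inv I => w wl.
have [v vS [ve ->]] := lk w wl.
by have := cardsD1 v (e w); rewrite ve el ?lA // add1n => -[].
Qed.

(** Edges meeting the small fingerprint are at most a quarter of all by the degree bound and the
    choice of [tau]. A saturated set has large degree among the links; as there are few links, the
    saturated sets together lie in at most another quarter of the edges. *)
Lemma container_alive I :
  #|A|%:R / 2 <= #|alive A e th (container_scan I)|%:R :> R.
Proof.
set s := container_scan I.
pose B1 := [set w in A | ~~ [disjoint e w & fprint s]].
pose B2 := [set w in A | [exists J : {set V}, (J \subset e w) && saturated th s J]].
have Asub : A \subset alive A e th s :|: (B1 :|: B2).
  apply/subsetP => w wA; rewrite /B1 /B2 !inE wA /=.
  case: [disjoint _ & _] => //=; case: existsP => [//|nex]; first by rewrite orbT.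
  rewrite orbF; apply/forallP => J; apply/implyP => Je; apply/negP => sJ.
  by apply: nex; exists J; rewrite Je.
have b1 : #|B1|%:R <= #|A|%:R / 4 :> R.
  apply: le_trans (container_touch I) _; rewrite [leRHS]mulrC ler_wpM2r //.
  have : tau * (8 * K) <= 1 by rewrite -ler_pdivlMr ?div1r ?mulr_gt0.
  by lra.
have b2 : #|B2|%:R <= #|A|%:R / 4 :> R.
  have h1 : (#|B2| <= \sum_(J | saturated th s J) hdeg A e J)%N.
    rewrite /hdeg; under eq_bigr do rewrite -sum1_card big_mkcond /=.
    rewrite exchange_big /= -sum1_card big_mkcond /=; apply: leq_sum => w _.
    rewrite !inE; case wA: (w \in A) => //=; case: existsP => // -[J /andP[Je sJ]].
    by rewrite (bigD1 J) //= inE Je wA.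
  have h2 : (\sum_(J | saturated th s J) hdeg A e J)%:R <=
      K / (K' * tau) * \sum_(J : {set V} | J != set0) (hdeg (links s) (link s) J)%:R :> R.
    rewrite natr_sum mulr_sumr [leLHS]big_mkcond [leRHS]big_mkcond /=.
    apply: ler_sum => J _; rewrite /saturated.
    case: (boolP (J != set0)) => //= J0; case: ifP => [thJ|_]; last first.
      exact: mulr_ge0.
    apply: le_trans (eK J0) _.
    apply: (@le_trans _ _ (K / (K' * tau) * th #|J|)); last first.
      by rewrite (ler_wpM2l KK'tau_ge0).
    rewrite /th -/a; have : (0 < #|J|)%N by rewrite card_gt0.
    case: #|J| => // j _ /=; rewrite exprS le_eqVlt; apply/orP; left; apply/eqP.
    by field; rewrite !gt_eqF.
  have h3 : \sum_(J : {set V} | J != set0) (hdeg (links s) (link s) J)%:R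
      <= 2 ^+ l.+1 * (2 * tau * K * #|A|%:R) :> R.
    rewrite -natr_sum; apply: le_trans (_ : (2 ^ l.+1 * #|links s|)%:R <= _).
      by rewrite ler_nat; apply: sum_hdeg_nonempty; apply: container_link_uniform.
    by rewrite natrM natrX ler_wpM2l ?exprn_ge0 //; apply: container_links.
  apply: (@le_trans _ _ (K / (K' * tau) * (2 ^+ l.+1 * (2 * tau * K * #|A|%:R)))).
    apply: le_trans (_ : (\sum_(J | saturated th s J) hdeg A e J)%:R <= _).
      by rewrite ler_nat.
    by apply: le_trans h2 _; rewrite (ler_wpM2l KK'tau_ge0).
  rewrite /K' !exprS [leLHS](_ : _ = #|A|%:R / 4) //.
  by field; rewrite !gt_eqF ?exprn_gt0.
have := leq_trans (subset_leq_card Asub) (leq_card_setU _ _).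
move=> /leq_trans /(_ (leq_add (leqnn _) (leq_card_setU _ _))).
by rewrite -(ler_nat R) !natrD; lra.
Qed.

(** Despite the name, the vertices that still have large degree among the alive edges; after a scan
    that stops early none of them can lie in [I]. *)
Definition light_part (s : state V Om) : {set V} :=
  [set v in X | d <= (hdeg (alive A e th s) e [set v])%:R].

(** The alive edges are at least half of all. Vertices of degree below [d] account for at most a
    quarter of the edges, so those of degree at least [d], each of degree at most [K * a], must be
    numerous. *)
Lemma container_small I : (#|fprint (container_scan I)| < m)%N ->
  [disjoint light_part (container_scan I) & I] /\
  N / (4 * K) <= #|light_part (container_scan I)|%:R.
Proof.
move=> Sm; set s := container_scan I; split.
  apply/pred0P => v /=; rewrite inE; apply/negP => /andP[/andP[_ dv] vI].
  have := scan_deg_lt (vs := enum V) (I := I) _ inv0 Sm (x := v).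
  rewrite -/st0 -/(container_scan I) -/s mem_enum => /(_ d_gt0 isT vI).
  by rewrite ltNge dv.
have := container_alive I; rewrite -/s; set B := alive _ _ _ s => hB.
have h1 : (#|B| <= \sum_(v in X) hdeg B e [set v])%N.
  rewrite sum_hdeg1 -sum1_card; apply: leq_sum => w; rewrite inE => /andP[wA _].
  by rewrite (setIidPl _) ?eX // el.
have h2 : (\sum_(v in X) hdeg B e [set v])%:R
    <= #|light_part s|%:R * (K * a) + #|X|%:R * d :> R.
  rewrite natr_sum (bigID (mem (light_part s))) /=; apply: lerD.
    rewrite mulr_natl -sumr_const big_mkcond [leRHS]big_mkcond /=.
    apply: ler_sum => v _; rewrite inE; case: (v \in X) => //=.
    case: ifP => // _; apply: (le_trans _ (deg1 v)).
    by rewrite ler_nat hdegS //; apply/subsetP => w; rewrite inE => /andP[].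
  rewrite mulr_natl -sumr_const big_mkcond [leRHS]big_mkcond /=.
  apply: ler_sum => v _; rewrite inE; case: (v \in X) => //=.
  by case: ifP => [|_]; [rewrite -ltNge => /ltW|exact: ltW].
have h3 : #|X|%:R * d <= #|A|%:R / 4.
  rewrite /d mulrA -aN ler_wpM2r // mulrC ler_wpM2l // ltW //.
rewrite ler_pdivrMr ?mulr_gt0 //.
have h4 : #|A|%:R / 4 <= #|light_part s|%:R * (K * a).
  by have : #|B|%:R <= (\sum_(v in X) hdeg B e [set v])%:R :> R; [rewrite ler_nat|lra].
rewrite -(ler_pM2l a_gt0) aN; lra.
Qed.

(** A full fingerprint yields at least [d * m] links, that is, at least [tau / 4 * #|A|]. The degree
    of [J] grows only while it is below its threshold, and one step adds at most the degree of
    [v |: J] in [A]. As the fingerprint lies in [I], a link inside [I] would extend to an edge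
    inside [I]. *)
Lemma container_large I : (m <= #|fprint (container_scan I)|)%N ->
  [/\ links (container_scan I) != set0,
      codeg_bounded (links (container_scan I)) (link (container_scan I))
        (4 * (K' + K)) tau N
    & indep A e I -> indep (links (container_scan I)) (link (container_scan I)) I].
Proof.
move=> Sm; have [lA _ lk dl] := container_scan_inv I; set s := container_scan I in Sm lA lk dl *.
have big : tau / 4 * #|A|%:R <= #|links s|%:R.
  apply: (le_trans _ dl); rewrite -aN /d.
  apply: (@le_trans _ _ (a / 4 * m%:R)); last first.
    by rewrite (ler_wpM2l (ltW d_gt0)) ?ler_nat.
  apply: (@le_trans _ _ (a / 4 * (tau * N))); first by lra.
  by rewrite (ler_wpM2l (ltW d_gt0)).
have deg (J : {set V}) : J != set0 -> (hdeg (links s) (link s) J)%:R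
    <= th #|J| + K * tau ^+ #|J| * a.
  move=> J0; pose P (s : state V Om) := scan_inv A e d m s /\
    (hdeg (links s) (link s) J)%:R <= th #|J| + K * tau ^+ #|J| * a.
  suff : P s by case.
  have x0 : 0 <= K * tau ^+ #|J| * a.
    exact: mulr_ge0 (mulr_ge0 (ltW K_gt0) (exprn_ge0 _ (ltW tau0))) (ltW a_gt0).
  apply: scan_ind => [|s' v [inv hJ] c].
    split=> //; rewrite /hdeg /=.
    rewrite (_ : [set w in set0 | _] = set0) ?cards0 ?addr_ge0 //.
    by apply/setP => w; rewrite !inE.
  split; first exact: scan_inv_pick inv c.
  rewrite (hdeg_pick th v J inv).
  set E := [set w in _ | _].
  have [sat|nsat] := boolP (saturated th s' J).
    rewrite (_ : E = set0) ?cards0 ?addn0 //.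
    apply/setP => w; rewrite !inE; apply/negP => /and3P[/and3P[_ _ /forallP/(_ J)]].
    by rewrite sat /= implybF => /negP nJ _ /subset_trans /(_ (subD1set _ _)).
  rewrite natrD; apply: lerD.
    by move: nsat; rewrite /saturated J0 /= -ltNge => /ltW.
  have [vJ|vJ] := boolP (v \in J).
    rewrite (_ : E = set0) ?cards0 //.
    apply/setP => w; rewrite in_set in_set0; apply/negP => /and3P[_ _ /subsetP/(_ v vJ)].
    by rewrite !inE eqxx.
  have := eK (J := v |: J); rewrite cardsU1 vJ add1n /= => h.
  apply: (le_trans _ (h _)); last by apply/set0Pn; exists v; rewrite setU11.
  rewrite ler_nat; apply: subset_leq_card; apply/subsetP => w.
  rewrite !inE => /and3P[/and3P[-> _ _] vw Jw] /=.
  by rewrite subUset sub1set vw (subset_trans Jw) // subD1set.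
split.
- apply: contraTneq big => ->; rewrite cards0 -ltNge mulr_gt0 ?divr_gt0 //.
  by rewrite ltr0n card_gt0.
- move=> J J0; apply: le_trans (deg J J0) _; rewrite /th.
  have : (0 < #|J|)%N by rewrite card_gt0.
  case: #|J| => // j _ /=; rewrite exprS.
  have t0 : 0 < tau ^+ j by rewrite exprn_gt0.
  rewrite [leLHS](_ : _ = (K' + K) * tau ^+ j / N * (tau * #|A|%:R)); last first.
    by rewrite /a; field; rewrite gt_eqF.
  rewrite [leRHS](_ : _ = (K' + K) * tau ^+ j / N * (4 * #|links s|%:R)); last by ring.
  have C0 : 0 <= (K' + K) * tau ^+ j / N.
    by rewrite divr_ge0 ?(ltW N0) // mulr_ge0 ?(ltW t0) // addr_ge0 // ltW.
  by rewrite (ler_wpM2l C0) //; move: big; lra.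
- move=> /forall_inP ind; apply/forall_inP => w wl.
  have [v vS [ve lw]] := lk w wl; apply: contra (ind _ (subsetP lA _ wl)).
  rewrite lw => sub; rewrite -(setD1K ve) subUset sub andbT sub1set.
  have sI : fprint s \subset I by apply: scan_fprint_sub; apply: sub0set.
  exact: subsetP sI _ vS.
Qed.

End ContainerStep.

(** Induction on the uniformity. After one scan, either the fingerprint is small and the vertices of
    large remaining degree are removed, or the link hypergraph satisfies the hypotheses with
    uniformity one less and a larger [K]. Either way the removed set depends only on the
    fingerprints. *)
Theorem container (R : realType) (l : nat) (K : R) : 1 <= K ->
  exists2 c : R, 0 < c & forall (V Om : finType) (A : {set Om})
    (e : Om -> {set V}) (X : {set V}) (tau N : R) (m : nat),
  0 < tau <= c -> 0 < N -> tau * N <= m%:R <= 2 * tau * N ->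
  A != set0 -> {in A, forall w, #|e w| = l.+1} ->
  {in A, forall w, e w \subset X} -> #|X|%:R <= N ->
  codeg_bounded A e K tau N ->
  exists Rm : seq {set V} -> {set V}, forall I, indep A e I ->
    exists ss : seq {set V}, [/\ size ss = l,
      all (fun S : {set V} => (S \subset I) && (#|S| <= m)%N) ss,
      Rm ss \subset X, [disjoint Rm ss & I] & c * N <= #|Rm ss|%:R].
Proof.
elim: l K => [|l IH] K K1; have K0 : 0 < K by exact: lt_le_trans K1.
  exists K^-1; first by rewrite invr_gt0.
  move=> V Om A e X tau N m _ N0 _ A0 el eX XN eK.
  exists (fun=> \bigcup_(w in A) e w) => I /forall_inP ind; exists [::]; split=> //.
  - by apply/bigcupsP => w /eX.
  - apply/pred0P => v /=; apply/negP => /andP[/bigcupP[w wA vw] vI].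
    have /eqP/cards1P[u eu] := el _ wA.
    move: (ind _ wA); rewrite eu sub1set => /negP; apply.
    by move: vw; rewrite eu => /set1P <-.
  - have a0 : 0 < #|A|%:R :> R by rewrite ltr0n card_gt0.
    set Y := \bigcup_(w in A) e w.
    have h1 : (#|A| <= \sum_(v in Y) hdeg A e [set v])%N.
      rewrite sum_hdeg1 -sum1_card; apply: leq_sum => w wA.
      by rewrite (setIidPl _) ?el //; apply: bigcup_sup.
    have h2 : (\sum_(v in Y) hdeg A e [set v])%:R <= #|Y|%:R * (K * (#|A|%:R / N)).
      rewrite natr_sum mulr_natl -sumr_const; apply: ler_sum => v _.
      have := eK [set v]; rewrite cards1 expr0 mulr1; apply.
      by rewrite -card_gt0 cards1.
    have {h1 h2} h : #|A|%:R * 1 <= #|A|%:R * (#|Y|%:R * (K / N)) :> R.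
      rewrite mulr1 [leRHS](_ : _ = #|Y|%:R * (K * (#|A|%:R / N))); last by ring.
      by apply: (le_trans _ h2); rewrite ler_nat.
    move: h; rewrite ler_pM2l // mulrA ler_pdivlMr // mul1r => h.
    by rewrite mulrC ler_pdivrMr.
(* The co-degree constant of the link hypergraph in [container_large]. *)
pose K2 : R := 4 * (2 ^+ l.+4 * K ^+ 2 + K).
have K21 : 1 <= K2.
  have : 0 <= 2 ^+ l.+4 * K ^+ 2 :> R by rewrite mulr_ge0 ?exprn_ge0 // ltW.
  by rewrite /K2; lra.
have [c c0 IHc] := IH K2 K21.
pose c1 := Num.min c (8 * K)^-1.
exists c1; first by rewrite lt_min c0 invr_gt0 mulr_gt0.
move=> V Om A e X tau N m /andP[tau0]; rewrite le_min => /andP[tauc tauK] N0.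
move=> /andP[taum mtau] A0 el eX XN eK.
pose st S := container_scan A e tau N K m l S.
have /choice[F FP] : forall S : {set V}, exists Rm : seq {set V} -> {set V},
    (m <= #|fprint (st S)|)%N -> forall I, indep (links (st S)) (link (st S)) I ->
    exists ss : seq {set V}, [/\ size ss = l,
      all (fun S : {set V} => (S \subset I) && (#|S| <= m)%N) ss,
      Rm ss \subset X, [disjoint Rm ss & I] & c * N <= #|Rm ss|%:R].
  move=> S; have [mS|mS] := leqP m #|fprint (st S)|; last by exists (fun=> set0).
  have [lk0 cod _] := container_large K1 tau0 N0 taum A0 eK mS.
  have [lA _ lk _] := container_scan_inv A e tau N K m l S.
  have [||||||||Rm RmP] := IHc V Om (links (st S)) (link (st S)) X tau N m.
  - by rewrite tau0.
  - by [].
  - by rewrite taum.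
  - by [].
  - exact: container_link_uniform.
  - move=> w wl; have [v vS [ve ->]] := lk w wl.
    by apply: subset_trans (subD1set _ _) (eX _ (subsetP lA _ wl)).
  - by [].
  - by [].
  by exists Rm => _; apply: RmP.
pose Rm (ss : seq {set V}) := if ss is P :: ss' then
   if (#|fprint (st P)| < m)%N then light_part A e X tau N K l (st P) else F P ss'
   else set0.
exists Rm => I ind; pose S := fprint (st I).
have stS : st S = st I by apply: scan_fprint; apply: sub0set.
have SI : S \subset I by apply: scan_fprint_sub; apply: sub0set.
have Sm : (#|S| <= m)%N by have [] := container_scan_inv A e tau N K m l I.
have [mS|mS] := leqP m #|S|.
  have [_ _ ind'] := container_large K1 tau0 N0 taum A0 eK mS.
  have mS' : (m <= #|fprint (st S)|)%N by rewrite stS.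
  have indS : indep (links (st S)) (link (st S)) I by rewrite stS; apply: ind'.
  have [ss [ss1 ss2 ss3 ss4 ss5]] := FP S mS' I indS.
  exists (S :: ss); rewrite /= ss1 SI Sm ss2 stS ltnNge mS; split=> //.
  by apply: (le_trans _ ss5); rewrite ler_wpM2r ?(ltW N0) // ge_min lexx.
have [dis big] := container_small K1 tau0 tauK N0 mtau A0 el eX XN eK mS.
(* The list is padded with empty sets so that its length is always the same. *)
exists (S :: nseq l set0); rewrite /= size_nseq SI Sm stS mS; split=> //.
- by apply/allP => T /nseqP[-> _]; rewrite sub0set cards0.
- by apply/subsetP => v; rewrite inE => /andP[].
- apply: (le_trans _ big); rewrite mulrC ler_wpM2l ?(ltW N0) // ge_min.
  by apply/orP; right; rewrite lef_pV2 ?posrE ?mulr_gt0 // ler_wpM2r ?(ltW K0) // ler_nat.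
Qed.


(** * Iterated containers for the hypergraph of copies of [H] *)

Definition edges_in (V Om : finType) (A : {set Om}) (e : Om -> {set V}) (C : {set V}) :
  {set Om} := [set w in A | e w \subset C].

Lemma indepS (V Om : finType) (A B : {set Om}) (e : Om -> {set V}) (I : {set V}) :
  A \subset B -> indep B e I -> indep A e I.
Proof. by move=> /subsetP AB /forall_inP ind; apply/forall_inP => w /AB/ind. Qed.

(** While the current set [C] spans at least [thr] edges, another [c * N] vertices outside [I] can
    be removed, so [j] rounds suffice. The fingerprint of the first round, read by [take],
    determines what the later rounds act on. *)
Lemma container_rounds (R : realType) (V Om : finType) (A : {set Om})
    (e : Om -> {set V}) (X : {set V}) (thr c N : R) (l m j : nat) (C : {set V}) :
  0 < thr -> {in A, forall w, e w != set0} ->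
  (forall C : {set V}, C \subset X -> thr <= #|edges_in A e C|%:R ->
    exists Rm : seq {set V} -> {set V}, forall I, indep (edges_in A e C) e I ->
    exists ss : seq {set V}, [/\ size ss = l,
      all (fun S : {set V} => (S \subset I) && (#|S| <= m)%N) ss,
      Rm ss \subset C, [disjoint Rm ss & I] & c * N <= #|Rm ss|%:R]) ->
  C \subset X -> #|C|%:R <= j%:R * (c * N) ->
  exists f : seq {set V} -> {set V}, forall I : {set V}, I \subset C -> indep A e I ->
    exists ss : seq {set V}, [/\ size ss = (j * l)%N,
      all (fun S : {set V} => (S \subset I) && (#|S| <= m)%N) ss,
      I \subset f ss, f ss \subset C & #|edges_in A e (f ss)|%:R < thr].
Proof.
move=> thr0 e0 step; elim: j C => [|j IH] C CX small.
  exists (fun=> C) => I IC _; exists [::]; split=> //.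
  move: small; rewrite mul0r lern0 cards_eq0 => /eqP C0.
  rewrite (_ : edges_in _ _ _ = set0) ?cards0 //; apply/setP => w; rewrite !inE.
  by apply/negP => /andP[/e0]; rewrite C0 subset0 => /negPf->.
have [big|few] := lerP thr #|edges_in A e C|%:R; last first.
  exists (fun=> C) => I IC _; exists (nseq (j.+1 * l)%N set0).
  rewrite size_nseq; split=> //.
  by apply/allP => S /nseqP[-> _]; rewrite sub0set cards0.
have [Rm RmP] := step C CX big.
have /choice[f fP] : forall ss, exists f : seq {set V} -> {set V},
    Rm ss \subset C -> c * N <= #|Rm ss|%:R ->
    forall I : {set V}, I \subset C :\: Rm ss -> indep A e I ->
    exists ss : seq {set V}, [/\ size ss = (j * l)%N,
      all (fun S : {set V} => (S \subset I) && (#|S| <= m)%N) ss,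
      I \subset f ss, f ss \subset C & #|edges_in A e (f ss)|%:R < thr].
  move=> ss; have [h|h] := pselect (Rm ss \subset C /\ c * N <= #|Rm ss|%:R); last first.
    by exists (fun=> set0) => h1 h2; case: h.
  case: h => sub large.
  have [||f fP] := IH (C :\: Rm ss).
  - exact: subset_trans (subsetDl _ _) CX.
  - move: small; rewrite -(cardsID (Rm ss) C) (setIidPr sub) natrD -natr1.
    by move: large; lra.
  exists f => _ _ I IC ind; have [ss' [h1 h2 h3 h4 h5]] := fP I IC ind.
  by exists ss'; split=> //; apply: subset_trans h4 (subsetDl _ _).
exists (fun ss => f (take l ss) (drop l ss)) => I IC ind.
have sub : edges_in A e C \subset A by apply/subsetP => w; rewrite inE => /andP[].
have [ss1 [s1 a1 R1 d1 b1]] := RmP I (indepS sub ind).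
have [|ss2 [s2 a2 i2 c2 t2]] := fP ss1 R1 b1 I _ ind.
  by rewrite subsetD IC disjoint_sym.
exists (ss1 ++ ss2); rewrite size_cat s1 s2 mulSn all_cat a1 a2; split=> //;
  by rewrite take_size_cat ?drop_size_cat.
Qed.

Section Copies.
Variables (U : finType) (H : graph U) (n : nat).

Lemma eset_card2 (T : finType) (G : graph T) (a : {set T}) : a \in eset G -> #|a| = 2%N.
Proof.
by move=> aG; have /forall_inP/(_ a aG)/andP[_ /eqP] := valP G.
Qed.

Lemma eset_sub_vset (T : finType) (G : graph T) (a : {set T}) :
  a \in eset G -> a \subset vset G.
Proof. by move=> aG; have /forall_inP/(_ a aG)/andP[] := valP G. Qed.

Definition pairs (T : finType) : {set {set T}} := [set a : {set T} | #|a| == 2].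

Lemma eset_pairs (T : finType) (G : graph T) : eset G \subset pairs T.
Proof. by apply/subsetP => a /eset_card2 a2; rewrite inE a2. Qed.

Lemma card_pairs (T : finType) : #|pairs T| = 'C(#|T|, 2).
Proof.
rewrite -[#|T|]cardsT -(cards_draws setT 2); apply: eq_card => a.
by rewrite !inE subsetT.
Qed.

(** Injections of the whole ambient type, including elements outside [vset H], so that counts
    compare with [n ^ #|U|]. *)
Definition embeddings : {set {ffun U -> 'I_n}} :=
  [set w : {ffun U -> 'I_n} | injectiveb w].

Definition image_edges (w : {ffun U -> 'I_n}) : {set {set 'I_n}} :=
  [set w @: a | a : {set U} in eset H].

Lemma imset_set_inj (w : {ffun U -> 'I_n}) : injective w ->
  injective (fun a : {set U} => w @: a).
Proof. by move=> inj; apply: imset_inj. Qed.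

Lemma card_image_edges w : w \in embeddings -> #|image_edges w| = #|eset H|.
Proof.
by rewrite inE => /injectiveP inj; apply: card_imset; apply: imset_set_inj.
Qed.

Lemma image_edges_pairs w : w \in embeddings -> image_edges w \subset pairs 'I_n.
Proof.
rewrite inE => /injectiveP inj; apply/subsetP => _ /imsetP[a /eset_card2 a2 ->].
by rewrite inE card_imset // a2.
Qed.

Lemma card_maps_into (R : realType) (W : {set U}) (Y : {set 'I_n}) :
  #|[set w : {ffun U -> 'I_n} | [forall x in W, w x \in Y]]|%:R
    = #|Y|%:R ^+ #|W| * n%:R ^+ (#|U| - #|W|) :> R.
Proof.
pose G (x : U) (t : 'I_n) : R := ((x \in W) ==> (t \in Y))%:R.
transitivity (\sum_(w : {ffun U -> 'I_n}) \prod_x G x (w x)).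
  rewrite -sum1_card natr_sum big_mkcond; apply: eq_bigr => w _; rewrite inE.
  case: (boolP [forall x in W, _]) => [/forall_inP h|].
    by rewrite big1 // => x _; rewrite /G; case: (boolP (x \in W)) => //= /h ->.
  rewrite negb_forall => /existsP[x]; rewrite negb_imply => /andP[xW xY].
  by rewrite (bigD1 x) //= /G xW (negPf xY) mul0r.
rewrite -(bigA_distr_bigA G) (bigID (mem W)) /=; congr (_ * _).
  rewrite -prodr_const; apply: eq_bigr => x xW.
  rewrite /G xW -natr_sum; congr _%:R.
  by rewrite -sum1_card [RHS]big_mkcond; apply: eq_bigr => t _; case: (t \in Y).
rewrite -(cardsC W) addKn -prodr_const.
apply: eq_big => [x|x xW]; first by rewrite inE.
by rewrite /G (negPf xW) /= sumr_const card_ord.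
Qed.

(** If the edges of an embedded copy include [J], then [J] is the image of some set [F] of edges of
    [H], and the vertices covered by [F] are mapped into the equally many vertices covered by [J].
    The other vertices are free, and the density hypothesis on [F] bounds the resulting power of
    [n]. *)
Lemma copies_degree (R : realType) (tau : R) (J : {set {set 'I_n}}) :
  0 < tau -> (0 < n)%N ->
  (forall F : {set {set U}}, F \subset eset H -> F != set0 ->
     n%:R ^+ 2 <= tau ^+ #|F|.-1 * n%:R ^+ #|\bigcup_(a in F) a|) ->
  J != set0 ->
  (hdeg embeddings image_edges J)%:R * n%:R ^+ 2 <=
    (2 ^ #|eset H| * #|U| ^ #|U|)%:R * tau ^+ #|J|.-1 * n%:R ^+ #|U| :> R.
Proof.
move=> tau0 n0 dens J0.
have n0' : 0 < n%:R :> R by rewrite ltr0n.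
pose Y := \bigcup_(a in J) a.
pose Fs := [set F in powerset (eset H) | (#|F| == #|J|) && (#|\bigcup_(a in F) a| == #|Y|)].
pose M (F : {set {set U}}) := [set w : {ffun U -> 'I_n} |
  [forall x in \bigcup_(a in F) a, w x \in Y]].
have h1 : (hdeg embeddings image_edges J <= \sum_(F in Fs) #|M F|)%N.
  rewrite /hdeg; under [leqRHS]eq_bigr do rewrite -sum1_card big_mkcond /=.
  rewrite exchange_big /= -sum1_card big_mkcond /=; apply: leq_sum => w _.
  rewrite inE; case: (boolP (w \in embeddings)) => //= wE; case: (boolP (J \subset _)) => // Jw.
  have inj : injective w by move: wE; rewrite inE => /injectiveP.
  pose F := [set a : {set U} in eset H | w @: a \in J].
  have JF : J = [set w @: a | a : {set U} in F].
    apply/setP => b; apply/idP/imsetP => [bJ|[a]]; last by rewrite inE => /andP[_ ?] ->.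
    have /imsetP[a aH eb] := subsetP Jw _ bJ.
    by exists a => //; rewrite inE aH -eb.
  have YF : Y = w @: (\bigcup_(a in F) a).
    rewrite /Y JF; apply/setP => t; apply/bigcupP/imsetP.
      move=> [_ /imsetP[a aF ->] /imsetP[x xa ->]].
      by exists x => //; apply/bigcupP; exists a.
    move=> [x /bigcupP[a aF xa] ->]; exists (w @: a); first exact: imset_f.
    exact: imset_f.
  have FF : F \in Fs.
    rewrite inE powersetE YF card_imset // eqxx andbT JF.
    rewrite (card_imset _ (imset_set_inj inj)) eqxx andbT.
    by apply/subsetP => a; rewrite inE => /andP[].
  rewrite (bigD1 F) //= inE (_ : [forall x in _, _]) //.
  by apply/forall_inP => x xF; rewrite YF; apply: imset_f.
have h2 F : F \in Fs -> #|M F|%:R * n%:R ^+ 2 <=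
    (#|U| ^ #|U|)%:R * (tau ^+ #|J|.-1 * n%:R ^+ #|U|) :> R.
  rewrite inE powersetE => /and3P[FH /eqP FJ /eqP FY]; rewrite /M card_maps_into -FY.
  set W := \bigcup_(a in F) a.
  have WU : (#|W| <= #|U|)%N by apply: max_card.
  rewrite -[in X in _ <= X](subnK WU) exprD.
  rewrite [leLHS](_ : _ = (#|W| ^ #|W|)%:R * (n%:R ^+ 2 * n%:R ^+ (#|U| - #|W|))); last first.
    by rewrite [(#|W| ^ #|W|)%:R]natrX -mulrA [n%:R ^+ 2 * _]mulrC.
  rewrite [tau ^+ _ * _](_ : _ = tau ^+ #|J|.-1 * n%:R ^+ #|W| * n%:R ^+ (#|U| - #|W|)); last first.
    by rewrite -[in RHS]mulrA [n%:R ^+ #|W| * _]mulrC.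
  apply: ler_pM; rewrite ?mulr_ge0 ?exprn_ge0 //.
    rewrite ler_nat subnK //; have [->|W0] := posnP #|W|.
      by rewrite expn0; have [->|] := posnP #|U|; rewrite ?expn_gt0 // => ->.
    apply: (@leq_trans (#|U| ^ #|W|)%N); first by rewrite leq_exp2r.
    by rewrite leq_pexp2l // (leq_trans W0).
  rewrite ler_wpM2r ?exprn_ge0 // -FJ; apply: dens => //.
  by rewrite -card_gt0 FJ card_gt0.
apply: (@le_trans _ _ (\sum_(F in Fs) (#|M F|%:R * n%:R ^+ 2))).
  by rewrite -mulr_suml -natr_sum ler_wpM2r ?exprn_ge0 // ler_nat.
apply: le_trans (ler_sum _ h2) _.
rewrite sumr_const -[_ *+ _]mulr_natl natrM -!mulrA ler_wpM2r //.
  by rewrite !mulr_ge0 ?exprn_ge0 // ltW.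
rewrite ler_nat -card_powerset; apply: subset_leq_card; apply/subsetP => F.
by rewrite inE => /andP[].
Qed.

End Copies.

(** As long as a container has at least [eps * n ^ #|U|] copies, the co-degree bounds of the full
    hypergraph hold for the copies inside it at the cost of a factor [1 / eps], so rounds can be
    repeated. *)
Theorem copy_containers (R : realType) (U : finType) (H : graph U) (eps : R) :
  eset H != set0 -> 0 < eps ->
  exists (k : nat) (c : R), 0 < c /\ forall (n m : nat) (tau : R),
  0 < tau <= c -> (0 < n)%N ->
  tau * n%:R ^+ 2 <= m%:R <= 2 * tau * n%:R ^+ 2 ->
  (forall F : {set {set U}}, F \subset eset H -> F != set0 ->
     n%:R ^+ 2 <= tau ^+ #|F|.-1 * n%:R ^+ #|\bigcup_(a in F) a|) ->
  exists f : seq {set {set 'I_n}} -> {set {set 'I_n}},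
  forall I : {set {set 'I_n}}, I \subset pairs 'I_n ->
    indep (embeddings U n) (@image_edges U H n) I ->
    exists ss : seq {set {set 'I_n}}, [/\ size ss = k,
      all (fun S : {set {set 'I_n}} => (S \subset I) && (#|S| <= m)%N) ss,
      I \subset f ss, f ss \subset pairs 'I_n &
      #|edges_in (embeddings U n) (@image_edges U H n) (f ss)|%:R < eps * n%:R ^+ #|U|].
Proof.
move=> H0 eps0; have Hl : #|eset H| = #|eset H|.-1.+1 by rewrite prednK // card_gt0.
set l := #|eset H|.-1 in Hl.
pose B : R := (2 ^ #|eset H| * #|U| ^ #|U|)%:R.
pose K := 1 + B / eps.
have K1 : 1 <= K by rewrite lerDl divr_ge0 // ltW.
have [c c0 cP] := container l K1.
pose j := Num.bound c^-1.
have jc : 1 <= j%:R * c.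
  by rewrite -ler_pdivrMr // div1r ltW // archi_boundP // ltW // invr_gt0.
exists (j * l)%N, c; split=> // n m tau /andP[tau0 tauc] n0 mtau dens.
have n0' : 0 < n%:R :> R by rewrite ltr0n.
have n2 : 0 < n%:R ^+ 2 :> R by rewrite exprn_gt0.
have X2 : #|pairs 'I_n|%:R <= n%:R ^+ 2 :> R.
  rewrite card_pairs card_ord -natrX ler_nat bin2 -divn2.
  by rewrite (leq_trans (leq_div _ _)) // expnS expn1 leq_mul // leq_pred.
apply: (@container_rounds R _ _ (embeddings U n) (@image_edges U H n)
  (pairs 'I_n) _ c (n%:R ^+ 2) l m j) => //.
- by rewrite mulr_gt0 // exprn_gt0.
- by move=> w wE; rewrite -card_gt0 card_image_edges // card_gt0.
- move=> C CX big; apply: (cP _ _ _ _ _ tau) => //.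
  + by rewrite tau0.
  + rewrite -card_gt0 -(ltr0n R); apply: lt_le_trans big.
    by rewrite mulr_gt0 // exprn_gt0.
  + by move=> w; rewrite inE => /andP[wE _]; rewrite card_image_edges.
  + by move=> w; rewrite inE => /andP[].
  + by apply: le_trans X2; rewrite ler_nat subset_leq_card.
  + move=> J J0; rewrite mulrA ler_pdivlMr //.
    apply: (@le_trans _ _ (B * tau ^+ #|J|.-1 * n%:R ^+ #|U|)).
      apply: le_trans (copies_degree tau0 n0 dens J0).
      rewrite ler_wpM2r ?exprn_ge0 // ler_nat; apply: hdegS.
      by apply/subsetP => w; rewrite inE => /andP[].
    have t0 : 0 <= tau ^+ #|J|.-1 by rewrite exprn_ge0 // ltW.
    apply: (@le_trans _ _ (B / eps * tau ^+ #|J|.-1 * (eps * n%:R ^+ #|U|))).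
      rewrite le_eqVlt; apply/orP; left; apply/eqP.
      by move: (tau ^+ _) (n%:R ^+ _) (B) => x y b; field; rewrite gt_eqF.
    have E0 : 0 <= eps * n%:R ^+ #|U| by rewrite mulr_ge0 ?exprn_ge0 // ltW.
    apply: (@le_trans _ _ (K * tau ^+ #|J|.-1 * (eps * n%:R ^+ #|U|))).
      by rewrite (ler_wpM2r E0) // (ler_wpM2r t0) // lerDr.
    by rewrite ler_wpM2l // mulr_ge0 // (le_trans _ K1).
- apply: le_trans X2 _; rewrite mulrA ler_peMl // ltW //.
Qed.


(** * Exponential moments and union bounds in the binomial random graph *)

Section Gnp.
Variables (R : realType) (n : nat) (p : R).
Hypothesis p01 : 0 <= p <= 1.

Let V := {set 'I_n}.
Let X : {set V} := pairs 'I_n.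

Let p0 : 0 <= p. Proof. by case/andP: p01. Qed.
Let q0 : 0 <= 1 - p. Proof. by rewrite subr_ge0; case/andP: p01. Qed.

Definition gnp_weight (E : {set V}) : R :=
  p ^+ #|E| * (1 - p) ^+ ('C(n, 2) - #|E|).

Lemma gnp_weight_ge0 (E : {set V}) : 0 <= gnp_weight E.
Proof. by rewrite mulr_ge0 // exprn_ge0. Qed.

Lemma is_graph_full (E : {set V}) : E \subset X -> is_graph ([set: 'I_n], E).
Proof.
move=> /subsetP EX; apply/forall_inP => a /EX; rewrite inE => -> /=.
by rewrite subsetT.
Qed.

Lemma is_graph_empty (T : finType) : is_graph (set0 : {set T}, set0 : {set {set T}}).
Proof. by apply/forall_inP => a; rewrite inE. Qed.

Definition full_graph (E : {set V}) : graph 'I_n :=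
  insubd (Graph (is_graph_empty 'I_n)) ([set: 'I_n], E).

Lemma full_graphE (E : {set V}) : E \subset X -> graph_val (full_graph E) = ([set: 'I_n], E).
Proof. by move=> EX; rewrite insubdK //; apply: is_graph_full. Qed.

Lemma sum_full_graphs (F : {set V} -> R) :
  \sum_(G : graph 'I_n | vset G == [set: 'I_n]) F (eset G) = \sum_(E : {set V} | E \subset X) F E.
Proof.
rewrite (reindex_onto full_graph (@eset _)) => [|G /eqP GT]; last first.
  by apply: val_inj; rewrite [LHS]full_graphE ?eset_pairs // -GT; case: G {GT} => -[].
apply: eq_big => E.
  have [EX|nEX] := boolP (E \subset X).
    by rewrite /vset /eset full_graphE //= !eqxx.
  apply/negbTE; apply: contra nEX => /andP[_ /eqP <-]; exact: eset_pairs.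
by move=> /andP[_ /eqP ->].
Qed.

(** Independence of the pairs: in each factor the first summand is the weight of [a] being an edge
    and the second that of its not being one, the latter zero when [a] is in [T]. *)
Lemma gnp_weight_prod (T D : {set V}) (lam : R) : T \subset X ->
  \sum_(E : {set V} | E \subset X) gnp_weight E * ((T \subset E)%:R * lam ^+ #|E :&: D|) =
  \prod_a ((if a \in X then p * (if a \in D then lam else 1) else 0) +
           (if a \in X then if a \in T then 0 else 1 - p else 1)).
Proof.
move=> /subsetP TX; rewrite bigA_distr [LHS]big_mkcond; apply: eq_big => [//|E _].
case: ifP => [EX|/negbT/subsetPn[a aE aX]]; last first.
  by rewrite (bigD1 a) //= aE (negPf aX) mul0r.
have [/subsetP TE|/subsetPn[a aT aE]] := boolP (T \subset E); last first.
  by rewrite mul0r mulr0 (bigD1 a) //= (negPf aE) aT TX // mul0r.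
rewrite mul1r (bigID (mem E)) /= [X in _ = X * _](_ : _ = p ^+ #|E| * lam ^+ #|E :&: D|).
  rewrite [X in _ = _ * X](_ : _ = (1 - p) ^+ ('C(n, 2) - #|E|)); first by rewrite mulrAC.
  have -> : ('C(n, 2) - #|E| = #|X :\: E|)%N.
    by rewrite cardsD (setIidPr EX) card_pairs card_ord.
  rewrite -prodr_const [LHS]big_mkcond [RHS]big_mkcond /=.
  apply: eq_bigr => a _; rewrite in_setD.
  case aE: (a \in E) => //=; rewrite (contraFF (TE a) aE).
  by case: (a \in X).
rewrite -prodr_const -prodr_const [X in _ = _ * X]big_mkcond [X in _ = X * _]big_mkcond.
rewrite -big_split /= big_mkcond; apply: eq_bigr => a _; rewrite !inE.
case aE: (a \in E) => /=; last by rewrite mulr1.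
by have := subsetP EX a aE; rewrite inE => ->.
Qed.

(** A pair of [T] contributes at most [lam * p]; a pair of [D] outside [T] contributes 1 + (lam - 1)
    p, which is at most its exponential. *)
Lemma gnp_exp_moment (T D : {set V}) (lam : R) : T \subset X -> 1 <= lam ->
  \sum_(E : {set V} | E \subset X) gnp_weight E * ((T \subset E)%:R * lam ^+ #|E :&: D|)
  <= (lam * p) ^+ #|T| * expR ((lam - 1) * p * #|D|%:R).
Proof.
move=> TX lam1; rewrite gnp_weight_prod //.
have e1 : 1 <= expR ((lam - 1) * p).
  by rewrite -[leLHS]expR0 ler_expR mulr_ge0 // subr_ge0.
have lamp : 0 <= lam * p by rewrite mulr_ge0 // (le_trans _ lam1).
have -> : expR ((lam - 1) * p * #|D|%:R) = \prod_(a in D) expR ((lam - 1) * p).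
  by rewrite prodr_const expRM_natr.
rewrite -prodr_const [X in _ <= X * _]big_mkcond [X in _ <= _ * X]big_mkcond.
rewrite -big_split /=; apply: ler_prod => a _.
have [aX|aX] := boolP (a \in X); last first.
  rewrite add0r ler01 (contraNF (subsetP TX a) aX) mul1r.
  by case: ifP => _ /=; rewrite ?e1 ?lexx.
have [aT|aT] := boolP (a \in T).
  rewrite addr0; case: ifP => _.
    rewrite mulr_ge0 ?(le_trans _ lam1) //=.
    by rewrite [p * lam]mulrC ler_peMr.
  by rewrite !mulr1 p0 /= ler_peMl.
rewrite mul1r; case: ifP => _.
  rewrite addr_ge0 ?mulr_ge0 ?(le_trans _ lam1) //=.
  by apply: le_trans (expR_ge1Dx _); rewrite le_eqVlt; apply/orP; left; apply/eqP; ring.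
by rewrite mulr1 addrC subrK ler01 lexx.
Qed.

Lemma gnp_weight_total : \sum_(E : {set V} | E \subset X) gnp_weight E = 1.
Proof.
pose Z (E : {set V}) : R := (set0 \subset E)%:R * 1 ^+ #|E :&: set0|.
rewrite (eq_bigr (fun E => gnp_weight E * Z E)); last first.
  by move=> E _; rewrite /Z sub0set expr1n !mulr1.
rewrite gnp_weight_prod ?sub0set //; apply: big1 => a _; rewrite in_set0.
by case: (a \in X); rewrite ?add0r // ?inE mulr1 addrC subrK.
Qed.

(** Markov's inequality for a variable that is at least 1 on the failures of [A]. *)
Lemma gnp_prob_union_bound (A : pred (graph 'I_n)) (Z : {set V} -> R) :
  (forall E, 0 <= Z E) ->
  (forall G, vset G = [set: 'I_n] -> ~~ A G -> 1 <= Z (eset G)) ->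
  1 - gnp_prob p A <= \sum_(E : {set V} | E \subset X) gnp_weight E * Z E.
Proof.
move=> Z0 ZA; rewrite -gnp_weight_total -sum_full_graphs.
rewrite -(sum_full_graphs (fun E => gnp_weight E * Z E)) (bigID A) /=.
rewrite /gnp_prob addrC addrK big_mkcondr; apply: ler_sum => G /eqP GT.
case: ifP => [nA|_]; last by rewrite mulr_ge0 ?gnp_weight_ge0.
by rewrite ler_peMr ?gnp_weight_ge0 ?ZA.
Qed.

Lemma gnp_prob_le1 (A : pred (graph 'I_n)) : gnp_prob p A <= 1.
Proof.
rewrite -gnp_weight_total -sum_full_graphs /gnp_prob big_mkcondr.
apply: ler_sum => G _; case: ifP => // _; exact: gnp_weight_ge0.
Qed.

(** At most 2^(k #|T|) tuples have union [T]. The factor exp(y (k m - #|T|)), at least 1 on the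
    allowed sizes, replaces the size restriction, and the remaining sum over all [T] is a product of
    factors 1 + v. *)
Lemma sum_fingerprints (k m : nat) (z y : R) : 0 <= z -> 0 <= y ->
  \sum_(s : {ffun 'I_k -> {set V}} |
      (\bigcup_i s i \subset X) && (#|\bigcup_i s i| <= k * m)%N)
    z ^+ #|\bigcup_i s i|
  <= expR (y * (k * m)%:R + 2 ^+ k * z * expR (- y) * n%:R ^+ 2).
Proof.
move=> z0 y0.
pose N (T : {set V}) := #|[set s : {ffun 'I_k -> {set V}} | \bigcup_i s i == T]|.
have Nle T : (N T <= 2 ^ (k * #|T|))%N.
  rewrite mulnC expnM -card_powerset -[k in X in (_ <= X)%N]card_ord -card_ffun_on.
  apply: subset_leq_card; apply/subsetP => s; rewrite inE => /eqP <-.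
  by apply/ffun_onP => i; rewrite powersetE; apply: bigcup_sup.
rewrite (partition_big (fun s : {ffun 'I_k -> {set V}} => \bigcup_i s i)
  (fun T : {set V} => T \subset X)) /=; last by move=> s /andP[].
pose v := 2 ^+ k * z * expR (- y).
have v0 : 0 <= v by rewrite !mulr_ge0 ?exprn_ge0 ?expR_ge0.
apply: (@le_trans _ _ (\sum_(T : {set V} | T \subset X) expR (y * (k * m)%:R) * v ^+ #|T|)).
  apply: ler_sum => T TX; have [Tk|Tk] := leqP #|T| (k * m)%N; last first.
    rewrite big1 ?mulr_ge0 ?exprn_ge0 ?expR_ge0 // => s /andP[/andP[_ +] /eqP e].
    by rewrite e leqNgt Tk.
  apply: (@le_trans _ _ ((N T)%:R * z ^+ #|T|)).
    rewrite mulr_natl -sumr_const big_mkcond [leRHS]big_mkcond /=.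
    apply: ler_sum => s _; rewrite inE; case: eqP => [->|_]; rewrite ?andbF //.
    by case: ifP => // _; rewrite exprn_ge0.
  apply: (@le_trans _ _ ((2 ^+ k) ^+ #|T| * z ^+ #|T|)).
    by rewrite ler_wpM2r ?exprn_ge0 // -exprM -natrX ler_nat.
  rewrite /v !exprMn -!mulrA [leRHS]mulrCA ler_wpM2l ?exprn_ge0 //.
  rewrite [leRHS]mulrCA ler_peMr ?exprn_ge0 // -expRM_natr -expRD -[leLHS]expR0 ler_expR.
  by rewrite mulNr subr_ge0 ler_wpM2l // ler_nat.
rewrite -mulr_sumr expRD ler_wpM2l ?expR_ge0 //.
have -> : \sum_(T : {set V} | T \subset X) v ^+ #|T| = \prod_(a in X) (v + 1).
  rewrite [RHS]big_mkcond /= (eq_bigr (fun a : V => (if a \in X then v else 0) + 1)).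
    rewrite bigA_distr [LHS]big_mkcond; apply: eq_big => [//|T _].
    case: ifP => [TX|/negbT/subsetPn[a aT aX]]; last first.
      by rewrite (bigD1 a) //= aT (negPf aX) mul0r.
    rewrite -prodr_const big_mkcond; apply: eq_bigr => a _.
    by case: ifP => // aT; rewrite (subsetP TX).
  by move=> a _; case: ifP => // _; rewrite add0r.
apply: (@le_trans _ _ (\prod_(a in X) expR v)).
  by apply: ler_prod => a _; rewrite addr_ge0 //= addrC expR_ge1Dx.
rewrite prodr_const -expRM_natr ler_expR ler_wpM2l //.
rewrite card_pairs card_ord -natrX ler_nat bin2 -divn2.
by rewrite (leq_trans (leq_div _ _)) // expnS expn1 leq_mul // leq_pred.
Qed.

Lemma expR_le_quad (h : R) : 0 <= h -> h <= 2^-1 -> expR h <= 1 + h + 2 * h ^+ 2.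
Proof.
move=> h0 h1; have e0 : 0 < 1 - h by lra.
apply: (@le_trans _ _ (1 - h)^-1).
  rewrite -[leLHS]invrK lef_pV2 ?posrE ?invr_gt0 ?expR_gt0 // -expRN.
  exact: expR_ge1Dx.
rewrite -div1r ler_pdivrMr // -subr_ge0.
rewrite [X in 0 <= X](_ : _ = h ^+ 2 * (1 - 2 * h)); last by ring.
by rewrite mulr_ge0 ?sqr_ge0 //; lra.
Qed.

(** A union bound over fingerprints and test sets. The joint exponential moment covers both the
    presence of the fingerprint, about p^(size), and the deviation on the test set, although the two
    may overlap. *)
Lemma gnp_container_bound (A : pred (graph 'I_n)) (k m : nat)
    (D : {ffun 'I_k -> {set V}} -> {set {set V}}) (eta y B : R) :
  0 < eta -> eta <= 2 -> 0 <= y ->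
  (forall s d, d \in D s -> d \subset X) -> (forall s, #|D s|%:R <= B) ->
  (forall G, vset G = [set: 'I_n] -> ~~ A G -> exists s : {ffun 'I_k -> {set V}},
     (forall i, s i \subset eset G /\ (#|s i| <= m)%N) /\
     exists2 d, d \in D s & p * #|d|%:R + eta * p * n%:R ^+ 2 < #|eset G :&: d|%:R) ->
  1 - gnp_prob p A <= B * expR (y * (k * m)%:R + 2 ^+ k.+1 * p * expR (- y) * n%:R ^+ 2
     - eta ^+ 2 / 8 * p * n%:R ^+ 2).
Proof.
move=> eta0 eta2 y0 DX DB bad.
(* This tilt gives the exponent 2 h^2 - eta h = - eta^2 / 8 in units of p n^2, and it keeps [lam] at
   most 2. *)
pose h := eta / 4; have h0 : 0 <= h by rewrite divr_ge0 // ltW.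
have h1 : h <= 2^-1 by rewrite /h; lra.
pose lam := expR h; have lam1 : 1 <= lam by rewrite -[leLHS]expR0 ler_expR.
have lam2 : lam <= 2.
  apply: le_trans (expR_le_quad h0 h1) _.
  have : h ^+ 2 <= 2^-1 ^+ 2 by rewrite lerXn2r ?nnegrE.
  by rewrite expr2; lra.
pose cov (s : {ffun 'I_k -> {set V}}) := \bigcup_i s i.
pose ok s := (cov s \subset X) && (#|cov s| <= k * m)%N.
pose wD (d : {set V}) := expR (- (h * (p * #|d|%:R + eta * p * n%:R ^+ 2))).
pose Z (E : {set V}) := \sum_(s | ok s) \sum_(d in D s) ((cov s \subset E)%:R * lam ^+ #|E :&: d|) * wD d.
have Z0 E : 0 <= Z E.
  apply: sumr_ge0 => s _; apply: sumr_ge0 => d _.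
  by rewrite !mulr_ge0 ?exprn_ge0 ?expR_ge0.
apply: le_trans (gnp_prob_union_bound (A := A) Z0 _) _.
  move=> G GT nA; have [s [sG [d dD dev]]] := bad G GT nA.
  have covG : cov s \subset eset G by apply/bigcupsP => i _; have [] := sG i.
  have oks : ok s.
    rewrite /ok (subset_trans covG) ?eset_pairs //=.
    apply: (@leq_trans (\sum_(i < k) #|s i|)%N).
      apply: (big_ind2 (fun (a : {set V}) b => #|a| <= b)%N) => // [|a b a' b' ab ab'].
        by rewrite cards0.
      by apply: leq_trans (leq_card_setU _ _) (leq_add ab ab').
    apply: (@leq_trans (\sum_(i < k) m)%N); first by apply: leq_sum => i _; have [] := sG i.
    by rewrite sum_nat_const card_ord.
  rewrite /Z (bigD1 s) //= (bigD1 d) //= covG mul1r.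
  apply: (@le_trans _ _ (lam ^+ #|eset G :&: d| * wD d)).
    rewrite /lam /wD -expRM_natr -expRD -[leLHS]expR0 ler_expR -mulrBr.
    by rewrite mulr_ge0 // subr_ge0 ltW.
  rewrite -addrA lerDl addr_ge0 //; first apply: sumr_ge0 => d' _.
    by rewrite !mulr_ge0 ?exprn_ge0 ?expR_ge0.
  apply: sumr_ge0 => s' _; apply: sumr_ge0 => d' _.
  by rewrite !mulr_ge0 ?exprn_ge0 ?expR_ge0.
have B0 : 0 <= B by apply: le_trans (DB [ffun=> set0]).
pose c := expR (- (eta ^+ 2 / 8 * p * n%:R ^+ 2)).
have term s d : ok s -> d \in D s ->
    wD d * \sum_(E : {set V} | E \subset X)
      gnp_weight E * ((cov s \subset E)%:R * lam ^+ #|E :&: d|)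
    <= (2 * p) ^+ #|cov s| * c.
  move=> /andP[sX _] dD.
  apply: le_trans (ler_wpM2l (expR_ge0 _) (gnp_exp_moment d sX lam1)) _.
  rewrite mulrCA; apply: ler_pM; rewrite ?exprn_ge0 ?mulr_ge0 ?expR_ge0 //.
    by rewrite lerXn2r ?nnegrE ?mulr_ge0 ?(le_trans _ lam1) // ler_wpM2r.
  rewrite /wD /c -expRD ler_expR.
  have dn : #|d|%:R <= n%:R ^+ 2 :> R.
    apply: (@le_trans _ _ #|X|%:R); first by rewrite ler_nat subset_leq_card // (DX s).
    rewrite card_pairs card_ord -natrX ler_nat bin2 -divn2.
    by rewrite (leq_trans (leq_div _ _)) // expnS expn1 leq_mul // leq_pred.
  have l1 : (lam - 1 - h) * (p * #|d|%:R) <= 2 * h ^+ 2 * (p * n%:R ^+ 2).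
    have lamh : lam - 1 - h <= 2 * h ^+ 2 by have := expR_le_quad h0 h1; rewrite -/lam; lra.
    have lam0 : 0 <= lam - 1 - h by rewrite /lam; have := expR_ge1Dx h; lra.
    by apply: ler_pM => //; rewrite ?mulr_ge0 // ler_wpM2l.
  move: l1; rewrite /h; move: (n%:R ^+ 2) (#|d|%:R) => N x l1.
  by move: l1; clearbody lam; lra.
rewrite /Z; under eq_bigr do rewrite mulr_sumr.
rewrite exchange_big /=.
apply: (@le_trans _ _ (\sum_(s | ok s) B * ((2 * p) ^+ #|cov s| * c))).
  apply: ler_sum => s oks; under eq_bigr do rewrite mulr_sumr.
  rewrite exchange_big /=; apply: (@le_trans _ _ (\sum_(d in D s) ((2 * p) ^+ #|cov s| * c))).
    apply: ler_sum => d dD; apply: le_trans (term s d oks dD).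
    by rewrite mulr_sumr; apply: ler_sum => E _; rewrite [leRHS]mulrC -[leRHS]mulrA.
  rewrite sumr_const -[leLHS]mulr_natl ler_wpM2r // mulr_ge0 ?expR_ge0 ?exprn_ge0 //.
  by rewrite mulr_ge0.
rewrite -mulr_sumr ler_wpM2l // -mulr_suml expRD ler_wpM2r ?expR_ge0 //.
apply: le_trans (sum_fingerprints k m (z := 2 * p) _ y0) _; first by rewrite mulr_ge0.
by rewrite ler_expR lerD2l (exprSr 2 k) -!mulrA.
Qed.

End Gnp.


(** * From a subgraph to its container and back *)

Lemma extend_embedding (U T : finType) (g : U -> T) (C S : {set U}) (Y : {set T}) :
  C \subset S -> {in C &, injective g} -> g @: C \subset Y -> (#|S| <= #|Y|)%N ->
  exists f : {ffun U -> T},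
    [/\ {in C, f =1 g}, {in S &, injective f} & {in S, forall x, f x \in Y}].
Proof.
move=> CS injg gY SY.
pose s := enum (S :\: C); pose t := enum (Y :\: (g @: C)).
have st : (size s <= size t)%N.
  rewrite -!cardE !cardsD (setIidPr CS) (setIidPr gY) card_in_imset //.
  exact: leq_sub2r.
have sP x : x \in S -> x \notin C -> (index x s < size t)%N.
  by move=> xS xC; apply: leq_trans st; rewrite index_mem mem_enum inE xC.
pose f : {ffun U -> T} := [ffun x => if x \in C then g x else nth (g x) t (index x s)].
have ft x : x \in S -> x \notin C -> f x \in Y :\: (g @: C).
  move=> xS xC; rewrite ffunE (negPf xC).
  by have := mem_nth (g x) (sP x xS xC); rewrite mem_enum.
exists f; split.
- by move=> x xC; rewrite ffunE xC.
- move=> x x' xS x'S; have [xC|xC] := boolP (x \in C); have [x'C|x'C] := boolP (x' \in C).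
  + by rewrite !ffunE xC x'C; apply: injg.
  + move=> e; have := ft x' x'S x'C; rewrite -e inE ffunE xC.
    by rewrite imset_f.
  + move=> e; have := ft x xS xC; rewrite e inE ffunE x'C.
    by rewrite imset_f.
  + rewrite !ffunE (negPf xC) (negPf x'C) (set_nth_default (g x')) ?sP // => /eqP.
    rewrite nth_uniq ?sP ?enum_uniq // => /eqP e.
    have xs : x \in s by rewrite mem_enum inE xC.
    have x's : x' \in s by rewrite mem_enum inE x'C.
    by rewrite -(nth_index x xs) e nth_index.
- move=> x xS; have [xC|xC] := boolP (x \in C).
    by rewrite ffunE xC (subsetP gY) // imset_f.
  by have := ft x xS xC; rewrite inE => /andP[].
Qed.

(* The vertices outside C are isolated in H, so only their number matters. *)
Lemma contains_copy_extend (U T : finType) (H : graph U) (G : graph T) (g : U -> T)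
    (C : {set U}) :
  C \subset vset H -> {in eset H, forall a : {set U}, a \subset C} ->
  {in C &, injective g} -> {in eset H, forall a : {set U}, g @: a \in eset G} ->
  g @: C \subset vset G -> (#|vset H| <= #|vset G|)%N -> contains_copy H G.
Proof.
move=> CH HC injg gE gC HG.
have [f [fg finj fY]] := extend_embedding CH injg gC HG.
apply/existsP; exists f; apply/and3P; split.
- apply/forall_inP => x xH; apply/forall_inP => y yH; apply/implyP => /eqP e.
  by apply/eqP; apply: finj.
- by apply/forall_inP.
- apply/forall_inP => a aH; rewrite (_ : f @: a = g @: a) ?gE //.
  by apply: eq_in_imset => x xa; apply: fg; apply: subsetP (HC a aH) _ xa.
Qed.

(** An embedding of the edges of [H] extends to the isolated vertices of [H] if [G] has enough
    vertices, which the size hypothesis ensures. *)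
Lemma free_indep (U : finType) (H : graph U) (n : nat) (G : graph 'I_n) :
  free_of H G -> (#|vset H| <= #|vset G|)%N ->
  indep (embeddings U n) (@image_edges U H n) (eset G).
Proof.
move=> free HG; apply/forall_inP => w; rewrite inE => /injectiveP inj.
apply: contra free => /subsetP wG; pose C := \bigcup_(a in eset H) a.
have wE a : a \in eset H -> w @: a \in eset G.
  by move=> aH; apply: wG; apply: imset_f.
apply: (@contains_copy_extend _ _ _ _ w C) => //.
- by apply/bigcupsP => a /eset_sub_vset.
- by move=> a aH; apply: bigcup_sup.
- by move=> x y _ _; apply: inj.
- apply/subsetP => _ /imsetP[x /bigcupP[a aH xa] ->].
  by apply: (subsetP (eset_sub_vset (wE a aH))); apply: imset_f.
Qed.

Lemma min_deg_le (T : finType) (G : graph T) v : v \in vset G -> (min_deg G <= deg G v)%N.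
Proof.
move=> vG; rewrite /min_deg; elim: (index_enum T) (mem_index_enum v) => // u s IH.
rewrite inE big_cons => /orP[/eqP <-|vs]; first by rewrite vG geq_minl.
by case: ifP => _; [apply: leq_trans (geq_minr _ _) (IH vs)|apply: IH].
Qed.

Lemma is_graph_delete (T : finType) (G : graph T) (D : {set {set T}}) :
  is_graph (vset G, eset G :\: D).
Proof.
apply/forall_inP => a; rewrite inE => /andP[_ aG].
by rewrite (eset_sub_vset aG) (eset_card2 aG).
Qed.

(** [D] may be any set containing the monochromatic edges, and [None] is for points outside the
    vertex set. *)
Lemma close_to_partite_colouring (R : realType) (T : finType) (k : nat) (x : R)
    (G : graph T) (f : T -> option 'I_k) (D : {set {set T}}) :
  {in vset G, forall v, f v != None} ->
  {in eset G, forall a : {set T}, forall i, {in a, forall v, f v = Some i} -> a \in D} ->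
  #|eset G :&: D|%:R <= x -> close_to_partite k x G.
Proof.
move=> fG mono small; apply/existsP; exists (Graph (is_graph_delete G D)).
rewrite {1}/vset /= eqxx {1}/eset /= subsetDl /=; apply/andP; split.
  by rewrite /eset /= setDDr setDv set0U.
apply/existsP; exists [ffun i => [set v in vset G | f v == Some i]]; apply/and3P; split.
- apply/eqP/setP => v; apply/bigcupP/idP => [[i _]|vG].
    by rewrite ffunE inE => /andP[].
  have := fG v vG; case e: (f v) => [i|//] _.
  by exists i => //; rewrite ffunE inE vG e eqxx.
- apply/forallP => i; apply/forallP => j; apply/implyP => ij; rewrite !ffunE.
  apply/pred0P => v /=; rewrite !inE; apply/negP => /andP[/andP[_ /eqP ->]].
  by move=> /andP[_ /eqP[] e]; rewrite e eqxx in ij.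
- apply/forallP => i; apply/forall_inP => a; rewrite /eset /= inE => /andP[aD aG].
  apply: contra aD => /subsetP ai; apply: (mono a aG i) => v /ai.
  by rewrite ffunE inE => /andP[_ /eqP].
Qed.

Section DegreeSum.
Variables (T : finType) (E : {set {set T}}).
Hypothesis E2 : E \subset pairs T.

Definition touching (A : {set T}) : {set {set T}} := [set a in E | ~~ [disjoint a & A]].
Definition inside (A : {set T}) : {set {set T}} := [set a in E | a \subset A].

Lemma sum_degrees (A : {set T}) :
  (\sum_(v in A) #|[set a in E | v \in a]| = #|touching A| + #|inside A|)%N.
Proof.
transitivity (\sum_(a in E) #|a :&: A|)%N.
  under eq_bigr do rewrite -sum1_card big_mkcond /=.
  rewrite exchange_big /= [RHS]big_mkcond /=; apply: eq_bigr => a _.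
  case aE: (a \in E); last by rewrite big1 // => v _; rewrite inE aE.
  rewrite -sum1_card big_mkcond [RHS]big_mkcond /=; apply: eq_bigr => v _.
  by rewrite !inE aE; case: (v \in A); case: (v \in a).
rewrite -[#|touching A|]sum1_card -[#|inside A|]sum1_card.
rewrite [X in _ = (X + _)%N]big_mkcond [X in _ = (_ + X)%N]big_mkcond.
rewrite -big_split [LHS]big_mkcond /=; apply: eq_bigr => a _.
rewrite !inE; case: (boolP (a \in E)) => //= aE.
have a2 : #|a| = 2%N by have := subsetP E2 a aE; rewrite inE => /eqP.
rewrite -setI_eq0 -card_gt0.
have -> : (a \subset A) = (#|a :&: A| == 2)%N.
  rewrite -a2; apply/idP/eqP => [/setIidPl ->//|e]; apply/setIidPl/eqP.
  by rewrite eqEcard subsetIl e leqnn.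
have : (#|a :&: A| <= 2)%N by rewrite -a2 subset_leq_card // subsetIl.
by case: #|a :&: A| => [|[|[|]]].
Qed.

End DegreeSum.

Section Deviations.
Variables (n k : nat).
Local Notation V := {set 'I_n}.

Definition mono_part (W : {set V}) (f : {ffun 'I_n -> option 'I_k}) : {set V} :=
  [set a in W | [exists i, [forall v in a, f v == Some i]]].

(* The sets of edges of a container on which the random graph is required not
   to have too many edges. *)
Definition test_sets (W : {set V}) : {set {set V}} :=
  [set touching (inside W P.1) P.2 | P : V * V] :|: [set inside W A | A : V]
  :|: [set mono_part W f | f : {ffun 'I_n -> option 'I_k}].

Lemma test_sets_sub W d : d \in test_sets W -> d \subset W.
Proof.
rewrite !in_setU -orbA => /or3P[] /imsetP[? _ ->]; apply/subsetP => a;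
  by rewrite !inE => /andP[] // /andP[].
Qed.

(** The three families have at most 4^n, 2^n and (k+1)^n members. *)
Lemma card_test_sets W : (#|test_sets W| <= 3 * (k + 4) ^ n)%N.
Proof.
have c2 : #|{: V}| = (2 ^ n)%N by rewrite -cardsT -powersetT card_powerset cardsT card_ord.
have mon a b : (a <= b)%N -> (a ^ n <= b ^ n)%N.
  by move=> ab; have [->|n0] := posnP n; rewrite ?expn0 // leq_exp2r.
apply: leq_trans (leq_card_setU _ _) _.
rewrite -[(3 * _)%N]/((2 + 1) * _)%N mulnDl mul1n; apply: leq_add.
  apply: leq_trans (leq_card_setU _ _) _.
  rewrite -[(2 * _)%N]/((1 + 1) * _)%N mulnDl mul1n; apply: leq_add.
    apply: leq_trans (leq_imset_card _ _) _; rewrite card_prod c2 -expnMn.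
    by apply: mon; rewrite leq_addl.
  by apply: leq_trans (leq_imset_card _ _) _; rewrite c2; apply: mon; rewrite addnC.
apply: leq_trans (leq_imset_card _ _) _; rewrite card_ffun card_option !card_ord.
by apply: mon; rewrite -addn1 leq_add2l.
Qed.

End Deviations.

(** The vertex set S of [G] may be a proper subset. If S is small, [W] has few edges inside it.
    Otherwise [dense_hom] applies to [W] restricted to S: few vertices have low degree there,
    because the degrees of [G] at such a set would exceed what the test sets allow. The colouring
    obtained has few monochromatic edges in [W], and by a further test set few in [G]. *)
Theorem close_of_container (R : realType) (U : finType) (H : graph U) (r : nat)
    (gamma : R) : (2 <= r)%N -> (0 < #|U|)%N -> partite r H -> 0 < gamma ->
  exists (eta eps : R) (n0 : nat), [/\ 0 < eta, eta <= 2, 0 < eps &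
  forall (n : nat) (p : R) (W : {set {set 'I_n}}) (G : graph 'I_n),
    (n0 <= n)%N -> 0 < p -> W \subset pairs 'I_n -> eset G \subset W ->
    #|edges_in (embeddings U n) (@image_edges U H n) W|%:R < eps * n%:R ^+ #|U| ->
    {in test_sets r.-1 W, forall d,
       #|eset G :&: d|%:R <= p * #|d|%:R + eta * p * n%:R ^+ 2} ->
    {in vset G, forall v,
       (1 - 3 / (3 * r%:R - 4) + gamma) * p * n%:R <= (deg G v)%:R} ->
    close_to_partite r.-1 (gamma * p * n%:R ^+ 2) G].
Proof.
have arith (x y q d g t : R) :
    x * ((d + g) * q * y) <= q * (x * ((d + g / 2) * y)) + 2 * (t * q * y ^+ 2) ->
    x * g * (q * y / 2) <= 4 * t * y * (q * y / 2) by rewrite expr2; lra.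
move=> r2 U0 /existsP[P /and3P[/eqP PU /forallP Pdis /forallP Pind]] g0.
have k0 : (0 < r.-1)%N by rewrite -subn1 subn_gt0.
have r0 : (0 < r)%N by apply: leq_trans r2.
pose i0 : 'I_r := Ordinal r0.
pose phi (x : U) : 'I_r := if [pick i | x \in P i] is Some i then i else i0.
have phiP x : x \in vset H -> x \in P (phi x).
  rewrite -PU => /bigcupP[i _ xi]; rewrite /phi; case: pickP => [//|/(_ i)].
  by rewrite xi.
pose h (a b : U) := (a != b) && ([set a; b] \in eset H).
have hphi a b : h a b -> phi a != phi b.
  move=> /andP[ab abH]; apply/eqP => e.
  have /forall_inP/(_ _ abH)/negP := Pind (phi a); apply.
  have /subsetP sub := eset_sub_vset abH.
  rewrite subUset !sub1set {2}e !phiP // sub // !inE eqxx ?orbT //.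
have g2 : 0 < gamma / 2 by rewrite divr_gt0.
have [eta0 [eps0 [eta00 eps00 dense]]] := dense_hom r2 U0 hphi g2 g2.
(* Below [sg * n] vertices a single class will do, since [sg ^+ 2] is at most gamma / 2. *)
pose sg := Num.min 1 gamma / 2.
have sg0 : 0 < sg by rewrite divr_gt0 // lt_min g0 ltr01.
have sg1 : sg <= 1 by have : Num.min 1 gamma <= 1; [rewrite ge_min lexx|rewrite /sg; lra].
have sg2 : sg ^+ 2 <= gamma / 2.
  have : sg <= gamma / 2 by rewrite /sg ler_wpM2r // ge_min lexx orbT.
  by apply: le_trans; rewrite expr2 ler_piMr // ltW.
(* The last bound turns #|A| gamma <= 4 eta n, derived below for the set [A] of low-degree vertices,
   into #|A| <= eta0 #|S|. *)
pose eta := Num.min (Num.min 2 (gamma / 2)) (eta0 * gamma * sg / 4).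
have eta_gt0 : 0 < eta by rewrite !lt_min g2 ltr0n (divr_gt0 (mulr_gt0 (mulr_gt0 eta00 g0) sg0)).
have eta2 : eta <= 2 by rewrite !ge_min lexx.
have etag : eta <= gamma / 2 by rewrite !ge_min lexx orbT.
have etae : eta <= eta0 * gamma * sg / 4 by rewrite !ge_min lexx !orbT.
pose eps := eps0 * sg ^+ #|U|.
exists eta, eps, (Num.bound (eps0 * sg)^-1); split=> //.
  by rewrite mulr_gt0 // exprn_gt0.
move=> n p W G n0 p0 W2 GW few conc mind.
have nbig : (eps0 * sg)^-1 <= n%:R.
  apply: (@le_trans _ _ (Num.bound (eps0 * sg)^-1)%:R); last by rewrite ler_nat.
  by apply/ltW/archi_boundP; rewrite invr_ge0 ltW // mulr_gt0.
have n00 : 0 < n%:R :> R by apply: lt_le_trans nbig; rewrite invr_gt0 mulr_gt0.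
pose S := vset G; pose WS := inside W S.
have GS : eset G \subset WS.
  by apply/subsetP => a aG; rewrite inE (subsetP GW) //= eset_sub_vset.
have inT A : inside W A \in test_sets r.-1 W.
  by rewrite !in_setU; apply/orP; left; apply/orP; right; apply: imset_f.
have [small|large] := lerP #|S|%:R (sg * n%:R).
  apply: (@close_to_partite_colouring _ _ _ _ _ (fun=> Some (Ordinal k0)) WS) => //.
    by move=> a aG _ _; apply: (subsetP GS).
  apply: le_trans (conc WS (inT S)) _.
  have WSle : #|WS|%:R <= #|S|%:R ^+ 2 :> R.
    rewrite -natrX ler_nat; apply: (@leq_trans 'C(#|S|, 2)).
      rewrite -(cards_draws S 2); apply: subset_leq_card; apply/subsetP => a.
      by rewrite !inE => /andP[/(subsetP W2)]; rewrite inE => -> ->.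
    by rewrite bin2 -divn2 (leq_trans (leq_div _ _)) // expnS expn1 leq_mul // leq_pred.
  have S2 : #|S|%:R ^+ 2 <= gamma / 2 * n%:R ^+ 2.
    apply: (@le_trans _ _ ((sg * n%:R) ^+ 2)).
      by rewrite lerXn2r ?nnegrE // mulr_ge0 // ltW.
    by rewrite exprMn ler_wpM2r // exprn_ge0.
  have h1 : p * #|WS|%:R <= p * (gamma / 2 * n%:R ^+ 2).
    by rewrite ler_pM2l // (le_trans WSle).
  have h2 : eta * (p * n%:R ^+ 2) <= gamma / 2 * (p * n%:R ^+ 2).
    by rewrite ler_wpM2r // mulr_ge0 ?exprn_ge0 // ltW.
  by move: h1 h2; move: (n%:R ^+ 2) (#|WS|%:R) => N x; lra.
pose T : finType := {x | x \in S}.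
have cT : #|T| = #|S| by rewrite card_sig.
pose w (x y : T) := [set val x; val y] \in W.
have ws : symmetric w by move=> x y; rewrite /w setUC.
have wi : irreflexive w.
  move=> x; apply/negP => /(subsetP W2); rewrite inE /w setUid cards1.
  by [].
have m0 : 0 < #|S|%:R :> R by apply: le_lt_trans large; rewrite mulr_ge0 // ltW.
have T0 : (0 < #|T|)%N by rewrite cT -(ltr0n R).
have mn : #|S|%:R <= n%:R :> R by rewrite ler_nat -[X in (_ <= X)%N]card_ord max_card.
have [] := dense T w ws wi T0.
- rewrite cT; apply: le_trans (ltW large).
  by rewrite mulrC -ler_pdivrMr // -invfM.
- rewrite cT.
  pose ext (x : {ffun U -> T}) : {ffun U -> 'I_n} := [ffun u => val (x u)].
  have ext_inj : injective ext.
    move=> x y e; apply/ffunP => u; apply: val_inj.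
    by have := congr1 (fun f : {ffun U -> 'I_n} => f u) e; rewrite !ffunE.
  apply: (@le_trans _ _ #|edges_in (embeddings U n) (@image_edges U H n) W|%:R).
    rewrite ler_nat -(card_imset _ ext_inj); apply: subset_leq_card.
    apply/subsetP => y /imsetP[x]; rewrite inE => /andP[/injectiveP xinj /forallP xh] ->.
    rewrite !inE; apply/andP; split.
      apply/injectiveP => u v; rewrite !ffunE => /val_inj; exact: xinj.
    apply/subsetP => _ /imsetP[a aH ->].
    have /eqP/cards2P[u [v [uv ea]]] := eset_card2 aH.
    have /forallP/(_ v)/implyP := xh u; rewrite /h uv -ea aH => /(_ isT).
    by rewrite /w ea imsetU1 imset_set1 !ffunE.
  apply: le_trans (ltW few) _; rewrite /eps -mulrA -exprMn ler_pM2l //.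
  by rewrite lerXn2r ?nnegrE ?(mulr_ge0 (ltW sg0) (ltW n00)) // ltW.
- rewrite cT; set B := [set v | _].
  pose A : {set 'I_n} := val @: B.
  have AB : #|B| = #|A| by rewrite card_imset //; apply: val_inj.
  have AS : A \subset S by apply/subsetP => _ /imsetP[x _ ->]; apply: valP.
  set c := 1 - 3 / (3 * r%:R - 4) in mind *.
  have degW v : v \in A -> #|[set a in WS | v \in a]|%:R <= (c + gamma / 2) * n%:R.
    move=> /imsetP[x xB ->].
    have d1 : (#|[set a in WS | val x \in a]| + #|nonadj w x| <= #|S|)%N.
      rewrite -cT -(cardsC [set y | w x y]); apply: leq_add.
        pose g (y : T) := [set val x; val y].
        apply: leq_trans (leq_imset_card g _); apply: subset_leq_card.
        apply/subsetP => a; rewrite !inE => /andP[/andP[aW aS] xa].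
        have : a \in pairs 'I_n by apply: subsetP W2 _ aW.
        rewrite inE => /cards2P[u [u' [uu ea]]].
        have [t [tS et]] : exists t, t \in S /\ a = [set val x; t].
          move: xa; rewrite ea !inE => /orP[]/eqP->.
            by exists u'; split=> //; apply: (subsetP aS); rewrite ea !inE eqxx orbT.
          by exists u; split; rewrite 1?setUC //; apply: (subsetP aS); rewrite ea !inE eqxx.
        apply/imsetP; exists (exist _ t tS) => //.
        by rewrite inE /w /= -et.
      by apply: subset_leq_card; apply/subsetP => y; rewrite !inE.
    move: d1 xB; rewrite -(ler_nat R) natrD inE.
    move: (#|[set a in WS | _]|%:R) (ler0n R #|[set a in WS | val x \in a]|) => y y0 d1 xB.
    (* For [r = 2] the number [c] is negative, so the passage from #|S| to [n] needs this sign; it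
       holds because the degree of a vertex of [B] is nonnegative and below this product. *)
    have pos : 0 < (c + gamma / 2) * #|S|%:R by move: xB d1; rewrite /c; lra.
    apply: (@le_trans _ _ ((c + gamma / 2) * #|S|%:R)); first by move: xB d1; rewrite /c; lra.
    by rewrite ler_wpM2l // ltW //; move: pos; rewrite pmulr_lgt0.
  have t1 : touching WS A \in test_sets r.-1 W.
    by rewrite !in_setU; apply/orP; left; apply/orP; left; apply/imsetP; exists (S, A).
  have c1 := conc _ t1; have c2 := conc _ (inT A).
  have sG := sum_degrees (eset_pairs G) A.
  have WS2 : WS \subset pairs 'I_n.
    by apply: subset_trans W2; apply/subsetP => a; rewrite inE => /andP[].
  have sW := sum_degrees WS2 A.
  have e1 : (#|touching (eset G) A| <= #|eset G :&: touching WS A|)%N.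
    apply: subset_leq_card; apply/subsetP => a; rewrite !inE => /andP[aG ->].
    by have := subsetP GS a aG; rewrite !inE aG andbT.
  have e2 : (#|inside (eset G) A| <= #|eset G :&: inside W A|)%N.
    apply: subset_leq_card; apply/subsetP => a; rewrite !inE => /andP[aG ->].
    by rewrite aG (subsetP GW).
  have e3 : (#|inside W A| <= #|inside WS A|)%N.
    apply: subset_leq_card; apply/subsetP => a; rewrite !inE => /andP[-> aA].
    by rewrite aA (subset_trans aA AS).
  have lo : #|A|%:R * ((c + gamma) * p * n%:R) <= (\sum_(v in A) #|[set a in eset G | v \in a]|)%:R.
    rewrite natr_sum mulr_natl -sumr_const; apply: ler_sum => v vA.
    by apply: mind; apply: (subsetP AS).
  have hi : (\sum_(v in A) #|[set a in WS | v \in a]|)%:R <= #|A|%:R * ((c + gamma / 2) * n%:R).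
    by rewrite natr_sum mulr_natl -sumr_const; apply: ler_sum => v vA; apply: degW.
  (* Edges inside [A] are counted twice in a degree sum, hence the two test sets, [touching WS A]
     and [inside W A], and twice the error term. *)
  have key : #|A|%:R * ((c + gamma) * p * n%:R) <=
      p * (#|A|%:R * ((c + gamma / 2) * n%:R)) + 2 * (eta * p * n%:R ^+ 2).
    apply: le_trans lo _; rewrite sG natrD.
    move: e1 e2 e3 hi; rewrite sW natrD -!(ler_nat R) => e1 e2 e3 hi.
    have : p * (#|touching WS A|%:R + #|inside W A|%:R) <= p * (#|A|%:R * ((c + gamma / 2) * n%:R)).
      by rewrite ler_pM2l //; lra.
    by move: c1 c2; lra.
  have {key} key : #|A|%:R * gamma <= 4 * eta * n%:R.
    have pn : 0 < p * n%:R / 2 by rewrite divr_gt0 // mulr_gt0.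
    by rewrite -(ler_pM2r pn); apply: arith key.
  rewrite AB -(ler_pM2r g0); apply: le_trans key _.
  apply: (@le_trans _ _ (eta0 * gamma * (sg * n%:R))).
    have : eta * n%:R <= eta0 * gamma * sg / 4 * n%:R by rewrite ler_wpM2r.
    by lra.
  by rewrite [leRHS]mulrAC ler_wpM2l // ?mulr_ge0 ?(ltW large) // ltW.
move=> f fmono.
pose f' : {ffun 'I_n -> option 'I_r.-1} :=
  [ffun v => if insub v is Some x then Some (f x) else None].
have f'P v i : f' v = Some i -> exists2 x : T, v = val x & f x = i.
  by rewrite ffunE; case: insubP => // x _ <- [] <-; exists x.
apply: (@close_to_partite_colouring _ _ _ _ _ f' (mono_part W f')).
- by move=> v vG; rewrite ffunE insubT.
- move=> a aG i ai; rewrite inE (subsetP GW) //=; apply/existsP; exists i.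
  by apply/forall_inP => v va; rewrite ai.
have tD : mono_part W f' \in test_sets r.-1 W.
  by rewrite in_setU; apply/orP; right; apply: imset_f.
apply: le_trans (conc _ tD) _.
have Dle : (#|mono_part W f'| <= mono_edges w f)%N.
  pose Q := [set z : T * T | w z.1 z.2 && (f z.2 == f z.1)].
  have -> : mono_edges w f = #|Q|.
    transitivity (\sum_x \sum_y (if (x, y) \in Q then 1 else 0))%N.
      apply: eq_bigr => x _; rewrite -sum1_card big_mkcond; apply: eq_bigr => y _.
      by rewrite !inE.
    rewrite pair_bigA -sum1_card [RHS]big_mkcond; apply: eq_bigr => -[x y] _.
    by [].
  pose g (z : T * T) := [set val z.1; val z.2].
  apply: leq_trans (leq_imset_card g _); apply: subset_leq_card; apply/subsetP => a.
  rewrite inE => /andP[aW /existsP[i /forall_inP ai]].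
  have : a \in pairs 'I_n by apply: subsetP W2 _ aW.
  rewrite inE => /cards2P[u [v [uv ea]]].
  have /eqP/f'P[x ex fx] : f' u == Some i by apply: ai; rewrite ea !inE eqxx.
  have /eqP/f'P[y ey fy] : f' v == Some i by apply: ai; rewrite ea !inE eqxx orbT.
  apply/imsetP; exists (x, y); last by rewrite /g /= -ex -ey.
  by rewrite inE /= /w -ex -ey -ea aW fx fy eqxx.
have h1 : p * #|mono_part W f'|%:R <= p * (gamma / 2 * n%:R ^+ 2).
  rewrite ler_pM2l //; apply: (@le_trans _ _ (mono_edges w f)%:R); first by rewrite ler_nat.
  apply: le_trans (ltW fmono) _; rewrite cT ler_pM2l //.
  by rewrite lerXn2r ?nnegrE.
have h2 : eta * (p * n%:R ^+ 2) <= gamma / 2 * (p * n%:R ^+ 2).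
  by rewrite ler_wpM2r // mulr_ge0 ?exprn_ge0 // ltW.
by move: h1 h2; move: (n%:R ^+ 2) (#|mono_part W f'|%:R) => N x; lra.
Qed.


(** * The event, the chromatic number and the 2-density *)

Definition aes_event (R : realType) (U : finType) (H : graph U) (gamma : R) (n : nat)
    (p : R) : pred (graph 'I_n) :=
  fun G => [forall G' : graph 'I_n,
    [&& subgraph G' G, free_of H G'
      & (1 - 3 / (3 * (chromatic_number H)%:R - 4) + gamma) * p * n%:R
          <= (min_deg G')%:R] ==>
    close_to_partite (chromatic_number H).-1 (gamma * p * n%:R ^+ 2) G'].

Lemma not_aes_event (R : realType) (U : finType) (H : graph U) (gamma : R) (n : nat)
    (p : R) (G : graph 'I_n) : ~~ aes_event H gamma p G ->
  exists G' : graph 'I_n, [/\ subgraph G' G, free_of H G',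
    (1 - 3 / (3 * (chromatic_number H)%:R - 4) + gamma) * p * n%:R <= (min_deg G')%:R
    & ~~ close_to_partite (chromatic_number H).-1 (gamma * p * n%:R ^+ 2) G'].
Proof.
by move=> /forallPn[G']; rewrite negb_imply => /andP[/and3P[h1 h2 h3] h4]; exists G'.
Qed.

Lemma cvg1_of_bound (R : realType) (u : nat -> R) :
  (forall n, u n <= 1) -> (\forall n \near \oo, 1 - u n <= n.+1%:R^-1)%classic ->
  (u @ \oo --> (1 : R))%classic.
Proof.
move=> u1 near_u.
apply: (@squeeze_cvgr _ _ _ _ (fun n => 1 - harmonic n) (fun=> 1)).
- near=> n; rewrite u1 andbT lerBlDr -lerBlDl.
  by near: n.
- rewrite -[X in (_ --> X)%classic]subr0; apply: cvgB; first exact: cvg_cst.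
  exact: cvg_harmonic.
- exact: cvg_cst.
Unshelve. all: by end_near.
Qed.

Section ChromaticNumber.
Variables (U : finType) (H : graph U).

Lemma chromatic_partite : partite (chromatic_number H) H.
Proof. by rewrite /chromatic_number; case: ex_minnP. Qed.

Lemma chromatic_min k : partite k H -> (chromatic_number H <= k)%N.
Proof. by rewrite /chromatic_number; case: ex_minnP => m _; apply. Qed.

Lemma partite0 : partite 0 H -> vset H = set0.
Proof. by move=> /existsP[P /and3P[/eqP <- _ _]]; rewrite big_ord0. Qed.

Lemma partite1 : partite 1 H -> eset H = set0.
Proof.
move=> /existsP[P /and3P[/eqP PU _ /forallP Pind]].
apply/setP => a; rewrite inE; apply/negP => aH.
have /forall_inP/(_ a aH)/negP := Pind ord0; apply.
by move: PU; rewrite big_ord1 => ->; apply: eset_sub_vset.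
Qed.

Lemma chromatic_ge2 : eset H != set0 -> (2 <= chromatic_number H)%N.
Proof.
move=> /set0Pn[a aH]; rewrite ltnNge; apply/negP => le1; have := chromatic_partite.
move: (chromatic_number H) le1 => [|[|//]] _.
  move=> /partite0 V0; have := eset_sub_vset aH; rewrite V0 subset0 => /eqP a0.
  by have := eset_card2 aH; rewrite a0 cards0.
by move=> /partite1 E0; rewrite E0 inE in aH.
Qed.

End ChromaticNumber.

Section TwoDensity.
Variables (R : realType) (U : finType) (H : graph U).

Lemma is_graph_cover (F : {set {set U}}) : F \subset eset H ->
  is_graph (\bigcup_(a in F) a, F).
Proof.
move=> /subsetP FH; apply/forall_inP => a aF.
by rewrite (eset_card2 (FH a aF)) eqxx andbT; apply: bigcup_sup.
Qed.

Lemma card_cover_gt2 (F : {set {set U}}) : F \subset eset H -> (2 <= #|F|)%N ->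
  (3 <= #|\bigcup_(a in F) a|)%N.
Proof.
move=> /subsetP FH /card_gt1P[a [b [aF bF ab]]].
have aC : a \subset \bigcup_(a in F) a by apply: bigcup_sup.
have bC : b \subset \bigcup_(a in F) a by apply: bigcup_sup.
have a2 := eset_card2 (FH a aF); have b2 := eset_card2 (FH b bF).
rewrite ltnNge; apply: contra ab => C2.
have eC (c : {set U}) : c \subset \bigcup_(a in F) a -> #|c| = 2%N -> c = \bigcup_(a in F) a.
  by move=> cC c2; apply/eqP; rewrite eqEcard cC c2.
by rewrite (eC a) // (eC b).
Qed.

(** The subgraph formed by [F] and the vertices that it covers competes in the maximum; two edges
    already rule out the special values of [m2]. *)
Lemma m2_ge (F : {set {set U}}) : F \subset eset H -> (2 <= #|F|)%N ->
  (#|F|%:R - 1) / (#|\bigcup_(a in F) a|%:R - 2) <= m2 R H.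
Proof.
move=> FH F2; have C3 := card_cover_gt2 FH F2.
have CV : \bigcup_(a in F) a \subset vset H.
  by apply/bigcupsP => a aF; apply: eset_sub_vset; apply: (subsetP FH).
rewrite /m2 ifF; last first.
  apply/negbTE; rewrite negb_or -ltnNge (leq_trans C3) ?subset_leq_card //=.
  by rewrite gtn_eqF // (leq_trans F2) // subset_leq_card.
apply: ub_le_sup.
  exists #|eset H|%:R => _ [K /andP[/andP[_ KH] K3] <-].
  have d0 : 1 <= #|vset K|%:R - 2 :> R.
    by have : 3 <= #|vset K|%:R :> R; [rewrite ler_nat|lra].
  rewrite ler_pdivrMr ?(lt_le_trans ltr01) //.
  apply: (@le_trans _ _ #|eset H|%:R); last by rewrite ler_peMr.
  by have : #|eset K|%:R <= #|eset H|%:R :> R; [rewrite ler_nat subset_leq_card|lra].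
exists (Graph (is_graph_cover FH)) => //=.
by rewrite /subgraph /vset /eset /= CV FH C3.
Qed.

(** Two intersecting edges span three vertices and have density (2-1)/(3-2). *)
Lemma m2_ge1 (a b : {set U}) : a \in eset H -> b \in eset H -> a != b ->
  ~~ [disjoint a & b] -> 1 <= m2 R H.
Proof.
move=> aH bH ab nd; have FH : [set a; b] \subset eset H by rewrite subUset !sub1set aH.
have F2 : #|[set a; b]| = 2%N by rewrite cards2 ab.
have := m2_ge FH; rewrite F2 => /(_ isT).
have C3 : (3 <= #|\bigcup_(c in [set a; b]) c|)%N by apply: card_cover_gt2; rewrite ?F2.
suff C : #|\bigcup_(c in [set a; b]) c| = 3%N.
  rewrite C; apply: le_trans.
  have e3 : (3%:R - 2)^-1 = 1 :> R by rewrite -[RHS]invr1; congr _^-1; lra.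
  by rewrite e3 mulr1; lra.
apply/eqP; rewrite eqn_leq C3 andbT.
rewrite bigcup_setU !big_set1; have := cardsUI a b.
move: nd; rewrite -setI_eq0 -card_gt0 (eset_card2 aH) (eset_card2 bH).
by move=> nd e; rewrite -(leq_add2r #|a :&: b|) e -[(2 + 2)%N]/(3 + 1)%N leq_add2l.
Qed.

(** Two distinct edges span at most four vertices, and a single edge has the conventional value
    1/2. *)
Lemma m2_ge_half : eset H != set0 -> 2^-1 <= m2 R H.
Proof.
move=> E0; have [E1|E1] := eqVneq #|eset H| 1%N.
  by rewrite /m2 E1 eqxx orbT.
have /card_gt1P[a [b [aH bH ab]]] : (1 < #|eset H|)%N.
  by rewrite ltn_neqAle eq_sym E1 card_gt0.
have FH : [set a; b] \subset eset H by rewrite subUset !sub1set aH.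
have F2 : #|[set a; b]| = 2%N by rewrite cards2 ab.
have := m2_ge FH; rewrite F2 => /(_ isT); apply: le_trans.
have C3 : (3 <= #|\bigcup_(c in [set a; b]) c|)%N by apply: card_cover_gt2; rewrite ?F2.
have C4 : (#|\bigcup_(c in [set a; b]) c| <= 4)%N.
  rewrite bigcup_setU !big_set1; apply: leq_trans (leq_card_setU _ _) _.
  by rewrite (eset_card2 aH) (eset_card2 bH).
have e1 : 2%:R - 1 = 1 :> R by lra.
rewrite e1 div1r lef_pV2 ?posrE //.
  by move: C4; rewrite -(ler_nat R); lra.
by rewrite subr_gt0 ltr_nat.
Qed.

(** Each subgraph contributes -1/(v-2), so the supremum is negative. *)
Lemma m2_edgeless : eset H = set0 -> (3 <= #|vset H|)%N -> m2 R H < 0.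
Proof.
move=> E0 V3; rewrite /m2 E0 cards0 orbF leqNgt V3 /=.
have dH : 0 < #|vset H|%:R - 2 :> R by rewrite subr_gt0 ltr_nat.
apply: (@le_lt_trans _ _ (- (#|vset H|%:R - 2)^-1)); last by rewrite oppr_lt0 invr_gt0.
apply: ge_sup.
  by exists ((#|eset H|%:R - 1) / (#|vset H|%:R - 2)), H => //=; rewrite /subgraph !subxx V3.
move=> _ [K /andP[/andP[KV KE] K3] <-].
have -> : #|eset K| = 0%N by move: KE; rewrite E0 subset0 => /eqP ->; rewrite cards0.
rewrite sub0r mulN1r lerN2 lef_pV2 ?posrE ?subr_gt0 ?ltr_nat //.
by rewrite lerB // ler_nat subset_leq_card.
Qed.

End TwoDensity.

Lemma small_close (R : realType) (T : finType) (G : graph T) (k N : nat) (x : R) :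
  (0 < k)%N -> (#|vset G| <= N)%N -> N%:R ^+ 2 <= x -> close_to_partite k x G.
Proof.
move=> k0 VN Nx.
apply: (@close_to_partite_colouring _ _ _ _ _ (fun=> Some (Ordinal k0)) (eset G)) => //.
apply: le_trans Nx; rewrite setIid -natrX ler_nat.
apply: (@leq_trans 'C(#|vset G|, 2)).
  rewrite -(cards_draws (vset G) 2); apply: subset_leq_card; apply/subsetP => a aG.
  by rewrite inE (eset_sub_vset aG) (eset_card2 aG).
rewrite bin2 -divn2 (leq_trans (leq_div _ _)) // expnS expn1 leq_mul //.
by rewrite (leq_trans (leq_pred _)).
Qed.


(** * Edgeless graphs and matchings *)

(** An explicit failure rate makes each case an inequality for large [n], with limits taken only at
    the end. *)
Definition aes_whp (R : realType) (U : finType) (H : graph U) (gamma : R) : Prop :=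
  exists2 C : R, 0 < C & forall p : nat -> R, (forall n, 0 <= p n <= 1) ->
    (exists N, forall n, (N <= n)%N -> C * n%:R `^ (- (1 / m2 R H)) <= p n) ->
    exists N, forall n, (N <= n)%N ->
      1 - gnp_prob (p n) (@aes_event R U H gamma n (p n)) <= n.+1%:R^-1.

Lemma gnp_prob_sure (R : realType) (n : nat) (p : R) (A : pred (graph 'I_n)) :
  0 <= p <= 1 -> (forall G, A G) -> 1 - gnp_prob p A <= 0.
Proof.
move=> p01 AG; apply: le_trans (gnp_prob_union_bound p01 (Z := fun=> 0) _ _) _ => //.
  by move=> G _; rewrite AG.
by rewrite big1 // => E _; rewrite mulr0.
Qed.

(** If [H] has no vertex, nothing is [H]-free. With three or more vertices the exponent is positive,
    so [C = 2] would force p > 1. With one or two vertices an [H]-free graph has at most one vertex;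
    a vertex would have degree 0 against a positive bound, and the empty graph is 0-partite. *)
Lemma aes_edgeless (R : realType) (U : finType) (H : graph U) (gamma : R) :
  0 < gamma -> eset H = set0 -> aes_whp H gamma.
Proof.
move=> g0 E0; exists 2 => // p p01 [N Np].
have [V0|V0] := eqVneq (vset H) set0.
  exists 1%N => n n1; apply: le_trans (gnp_prob_sure (p01 n) _) _; last by rewrite invr_ge0.
  move=> G; apply/forallP => G'; apply/implyP => /and3P[_ free _].
  case/negP: free.
  apply/existsP; exists [ffun=> Ordinal n1]; rewrite V0 E0; apply/and3P; split;
    by apply/forall_inP => x; rewrite inE.
exists (maxn N 1) => n; rewrite geq_max => /andP[nN n1].
have n1' : 1 <= n%:R :> R by rewrite ler1n.
have [V3|V3] := ltnP 2 #|vset H|.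
  have m0 := m2_edgeless R E0 V3; have := le_trans (Np n nN) (proj2 (andP (p01 n))).
  have : 1 <= n%:R `^ (- (1 / m2 R H)).
    rewrite -[leLHS](powRr0 n%:R) ler_powR // div1r oppr_ge0 invr_le0 ltW //.
  by move: (_ `^ _) => x; lra.
apply: le_trans (gnp_prob_sure (p01 n) _) _; last by rewrite invr_ge0.
have p0 : 0 < p n by apply: lt_le_trans (Np n nN); rewrite mulr_gt0 // powR_gt0 // (lt_le_trans ltr01).
have chi1 : chromatic_number H = 1%N.
  apply/eqP; rewrite eqn_leq; apply/andP; split.
    apply: chromatic_min; apply/existsP; exists [ffun=> vset H]; apply/and3P; split.
    - by rewrite big_ord1 ffunE.
    - by apply/forallP => i; apply/forallP => j; rewrite !ord1 eqxx.
    - by apply/forallP => i; apply/forall_inP => a; rewrite E0 inE.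
  rewrite lt0n; apply/eqP => c0; have := chromatic_partite H.
  by rewrite c0 => /partite0 e; rewrite e eqxx in V0.
move=> G; apply: contraT => /not_aes_event[G' [_ free mind nclose]].
have small : (#|vset G'| < #|vset H|)%N.
  rewrite ltnNge; apply: contra free => VH.
  apply: (@contains_copy_extend _ _ _ _ (fun=> Ordinal n1) set0) => //.
  - exact: sub0set.
  - by move=> a; rewrite E0 inE.
  - by move=> x y; rewrite inE.
  - by move=> a; rewrite E0 inE.
  - by rewrite imset0 sub0set.
have edgeless : eset G' = set0.
  apply/setP => a; rewrite inE; apply/negP => aG'.
  have := subset_leq_card (eset_sub_vset aG'); rewrite (eset_card2 aG').
  by move=> /leq_ltn_trans /(_ small); rewrite ltnNge V3.
case: (set_0Vmem (vset G')) => [e|[v vG']].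
  move: nclose; rewrite (@close_to_partite_colouring _ _ _ _ _ (fun=> None) set0) //.
  - by move=> v; rewrite e inE.
  - by move=> a; rewrite edgeless inE.
  - by rewrite setI0 cards0 !mulr_ge0 ?(ltW g0) ?(ltW p0).
have d0 : deg G' v = 0%N.
  by apply/eqP; rewrite cards_eq0; apply/eqP/setP => a; rewrite edgeless !inE.
have := min_deg_le vG'; rewrite d0 leqn0 => /eqP md.
move: mind; rewrite md chi1 leNgt => /negP[].
(* With chromatic number 1 the denominator is -1, so the degree bound is at least 4 p n. *)
have e1 : 1 - 3 / (3 * 1%:R - 4) = 4 :> R by field; lra.
by rewrite e1 !mulr_gt0 ?addr_gt0 // (lt_le_trans ltr01).
Qed.

Lemma powR_half_density (R : realType) (U : finType) (H : graph U) (n : nat) :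
  eset H != set0 -> (0 < n)%N -> 1 <= n%:R `^ (- (1 / m2 R H)) * n%:R ^+ 2 :> R.
Proof.
move=> E0 n0; have n1 : 1 <= n%:R :> R by rewrite ler1n.
have m2h := m2_ge_half R E0; have mu0 : 0 < m2 R H by apply: lt_le_trans m2h; rewrite invr_gt0.
rewrite -powR_mulrn // -powRD; last by rewrite pnatr_eq0 -lt0n n0 implybT.
rewrite -[leLHS](powRr0 n%:R) ler_powR // div1r.
have : (m2 R H)^-1 <= 2 by rewrite -[leRHS]invrK lef_pV2 ?posrE ?invr_gt0.
by lra.
Qed.

(* Embed the edges of H one by one, each into an edge of G which avoids the
   vertices used so far. *)
Lemma matching_copy (U T : finType) (H : graph U) (G : graph T) :
  {in eset H &, forall a b : {set U}, a != b -> [disjoint a & b]} ->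
  (#|vset H| <= #|vset G|)%N -> (0 < #|U|)%N -> (0 < #|eset G|)%N ->
  (forall v, #|U| * deg G v < #|eset G|)%N -> contains_copy H G.
Proof.
move=> dis HG U0 E0 few.
have [u0 _] := card_gt0P U0.
have few' (Y : {set T}) : (#|Y| <= #|U|)%N -> exists2 b, b \in eset G & [disjoint b & Y].
  move=> YU; apply: contrapT => none.
  have touch : (#|eset G| <= \sum_(v in Y) deg G v)%N.
    rewrite (sum_degrees (eset_pairs G)) (leq_trans _ (leq_addr _ _)) //.
    apply: subset_leq_card; apply/subsetP => b bG; rewrite inE bG /=.
    by apply/negP => bY; apply: none; exists b.
  have : (#|U| * \sum_(v in Y) deg G v <= #|U| * (#|eset G|.-1))%N.
    rewrite big_distrr /=; apply: (@leq_trans (\sum_(v in Y) #|eset G|.-1)%N).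
      by apply: leq_sum => v _; rewrite -ltnS prednK.
    by rewrite sum_nat_const leq_mul2r YU orbT.
  rewrite leq_mul2l eqn0Ngt U0 /= => /(leq_trans touch).
  by rewrite leqNgt prednK // leqnn.
have [b0 b0G] := card_gt0P E0.
have [t0 _] : exists t : T, true.
  have : (0 < #|b0|)%N by rewrite (eset_card2 b0G).
  by move=> /card_gt0P[t _]; exists t.
have embed m : forall M : {set {set U}}, (#|M| <= m)%N -> M \subset eset H ->
    exists g : U -> T, {in \bigcup_(a in M) a &, injective g} /\
      {in M, forall a : {set U}, g @: a \in eset G}.
  elim: m => [|m IH] M Mm MH.
    exists (fun=> t0); split=> [x y|a]; last first.
      by move: Mm; rewrite leqn0 cards_eq0 => /eqP ->; rewrite inE.
    by move: Mm; rewrite leqn0 cards_eq0 => /eqP ->; rewrite big_set0 inE.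
  have [M0|/set0Pn[a aM]] := eqVneq M set0.
    by apply: IH => //; rewrite M0 cards0.
  have [||g [ginj gE]] := IH (M :\ a).
  - by move: Mm; rewrite (cardsD1 a) aM.
  - exact: subset_trans (subD1set _ _) MH.
  set C := \bigcup_(c in M :\ a) c in ginj.
  have [b bG bdis] := few' (g @: C) (leq_trans (leq_imset_card _ _) (max_card _)).
  have /eqP/cards2P[u [v [uv ea]]] := eset_card2 (subsetP MH a aM).
  have /eqP/cards2P[s [t [st eb]]] := eset_card2 bG.
  have aC x : x \in C -> x \notin a.
    move=> /bigcupP[c]; rewrite !inE => /andP[ca cM] xc.
    apply/negP => xa; have := dis c a (subsetP MH c cM) (subsetP MH a aM) ca.
    by move=> /pred0P/(_ x); rewrite /= xc xa.
  have gC x : x \in C -> g x != s /\ g x != t.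
    move=> xC; have gx : g x \notin b.
      apply/negP => gb; move/pred0P/(_ (g x)): bdis; rewrite /= gb imset_f //.
    by move: gx; rewrite eb !inE negb_or => /andP.
  pose g' x := if x == u then s else if x == v then t else g x.
  have g'C x : x \in C -> g' x = g x.
    move=> /aC; rewrite ea !inE negb_or /g' => /andP[xu xv].
    by rewrite (negPf xu) (negPf xv).
  have g'u : g' u = s by rewrite /g' eqxx.
  have g'v : g' v = t by rewrite /g' eqxx eq_sym (negPf uv).
  have cover x : x \in \bigcup_(c in M) c -> [\/ x = u, x = v | x \in C].
    move=> /bigcupP[c cM xc]; have [ca|ca] := eqVneq c a.
      by move: xc; rewrite ca ea !inE => /orP[]/eqP->; [constructor 1|constructor 2].
    by constructor 3; apply/bigcupP; exists c => //; rewrite !inE ca.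
  exists g'; split=> [x y|c cM].
    move=> /cover[->|->|xC] /cover[->|->|yC] //; rewrite ?g'u ?g'v ?g'C //.
    - by move=> e; rewrite e eqxx in st.
    - by move=> e; have [/eqP] := gC y yC; rewrite e.
    - by move=> e; rewrite e eqxx in st.
    - by move=> e; have [_ /eqP] := gC y yC; rewrite e.
    - by move=> e; have [/eqP] := gC x xC; rewrite e.
    - by move=> e; have [_ /eqP] := gC x xC; rewrite e.
    - exact: ginj.
  have [->|ca] := eqVneq c a.
    by rewrite ea imsetU1 imset_set1 g'u g'v -eb.
  rewrite (_ : g' @: c = g @: c); first by apply: gE; rewrite !inE ca.
  apply: eq_in_imset => x xc; apply: g'C; apply/bigcupP.
  by exists c => //; rewrite !inE ca.
have [g [ginj gE]] := embed _ (eset H) (leqnn _) (subxx _).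
apply: (contains_copy_extend _ _ ginj gE) => //.
- by apply/bigcupsP => a /eset_sub_vset.
- by move=> a aH; apply: bigcup_sup.
- apply/subsetP => _ /imsetP[x /bigcupP[a aH xa] ->].
  by apply: (subsetP (eset_sub_vset (gE a aH))); apply: imset_f.
Qed.

(** If [G'] has more than gamma p n^2 edges but no copy of the matching, some vertex has degree at
    least #|eset G'| / #|U|, more than a p n^2. A degree this large is unlikely in G_{n,p}, by an
    exponential moment with base [n], even when p n^2 is only a large constant. *)
Lemma aes_matching (R : realType) (U : finType) (H : graph U) (gamma : R) :
  0 < gamma -> eset H != set0 ->
  {in eset H &, forall a b : {set U}, a != b -> [disjoint a & b]} -> aes_whp H gamma.
Proof.
move=> g0 E0 dis.
have chi2 := chromatic_ge2 E0.
have k0 : (0 < (chromatic_number H).-1)%N by rewrite -subn1 subn_gt0.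
have U0 : (0 < #|U|)%N.
  have /set0Pn[a aH] := E0; have : (0 < #|a|)%N by rewrite (eset_card2 aH).
  by move=> /leq_trans; apply; apply: max_card.
have u0 : 0 < #|U|%:R :> R by rewrite ltr0n.
pose a : R := gamma / #|U|%:R.
have a0 : 0 < a by rewrite divr_gt0.
(* The first term serves the tail estimate; the second makes gamma p n^2 exceed the number of edges
   of any graph on fewer vertices than [H]. *)
pose C : R := 6 / a + #|U|%:R ^+ 2 / gamma.
have C6 : 6 / a <= C by rewrite lerDl divr_ge0 ?sqr_ge0 // ltW.
have CU : #|U|%:R ^+ 2 / gamma <= C by rewrite lerDr divr_ge0 // ltW.
have C0 : 0 < C by apply: lt_le_trans C6; rewrite divr_gt0.
exists C => // p p01 [N Np].
exists (maxn N (maxn 2 (Num.bound (expR (2 / a))))) => n.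
rewrite !geq_max => /and3P[nN n2 nL]; set q := p n.
have n0 : (0 < n)%N by apply: leq_trans n2.
have n00 : 0 < n%:R :> R by rewrite ltr0n.
have q0 : 0 <= q by case/andP: (p01 n).
pose L := ln n%:R : R.
have eL : expR L = n%:R by rewrite /L lnK // posrE.
have aL : 2 <= a * L.
  rewrite mulrC -ler_pdivrMr // -ler_expR eL.
  apply: (@le_trans _ _ (Num.bound (expR (2 / a)))%:R); last by rewrite ler_nat.
  by apply/ltW/archi_boundP; apply: expR_ge0.
have L0 : 0 < L by rewrite -(pmulr_rgt0 _ a0); apply: lt_le_trans aL.
have qn2 : C <= q * n%:R ^+ 2.
  apply: (@le_trans _ _ (C * (n%:R `^ (- (1 / m2 R H)) * n%:R ^+ 2))).
    by rewrite ler_peMr ?(ltW C0) //; apply: powR_half_density.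
  by rewrite mulrA ler_wpM2r ?exprn_ge0 // Np.
have q20 : 0 <= q * n%:R ^+ 2 by rewrite mulr_ge0 // exprn_ge0.
pose D (v : 'I_n) : {set {set 'I_n}} := [set b in pairs 'I_n | v \in b].
have Dn v : (#|D v| <= n)%N.
  rewrite -[X in (_ <= X)%N](card_ord n).
  apply: leq_trans (leq_imset_card (fun u => [set v; u]) 'I_n); apply: subset_leq_card.
  apply/subsetP => b; rewrite !inE => /andP[/cards2P[s [t [st ->]]]].
  rewrite !inE => /orP[]/eqP->; apply/imsetP; [exists t|exists s] => //.
  by rewrite setUC.
pose x := a * (q * n%:R ^+ 2).
pose Z (E : {set {set 'I_n}}) : R := \sum_v (set0 \subset E)%:R * expR L ^+ #|E :&: D v| * expR (- (L * x)).
have Z0 E : 0 <= Z E.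
  by apply: sumr_ge0 => v _; rewrite !mulr_ge0 ?exprn_ge0 ?expR_ge0.
apply: le_trans (gnp_prob_union_bound (p01 n) Z0 _) _.
  move=> G _ /not_aes_event[G' [/andP[_ sub] free _ nclose]].
  have VG : (#|vset H| <= #|vset G'|)%N.
    rewrite leqNgt; apply: contra nclose => small.
    apply: (@small_close _ _ _ _ #|U|) => //.
      by apply: ltnW; apply: leq_trans small (max_card _).
    rewrite -mulrA -/q; apply: (@le_trans _ _ (gamma * C)); last by rewrite ler_pM2l.
    by rewrite mulrC -ler_pdivrMr.
  have EG : gamma * (q * n%:R ^+ 2) < #|eset G'|%:R.
    rewrite ltNge; apply: contra nclose => few.
    apply: (@close_to_partite_colouring _ _ _ _ _ (fun=> Some (Ordinal k0)) (eset G')) => //.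
    by rewrite setIid -mulrA.
  have [v hv] : exists v, (#|eset G'| <= #|U| * deg G' v)%N.
    apply: contrapT => /forallNP none; move: free; rewrite /free_of.
    rewrite matching_copy //.
      by rewrite -(ltr0n R); apply: le_lt_trans EG; rewrite mulr_ge0 // ltW.
    by move=> v; rewrite ltnNge; apply/negP/none.
  have dv : (deg G' v <= #|eset G :&: D v|)%N.
    apply: subset_leq_card; apply/subsetP => b; rewrite !inE => /andP[bG vb].
    by rewrite (subsetP sub) // vb andbT (eset_card2 bG).
  rewrite /Z (bigD1 v) //= sub0set mul1r.
  apply: (@le_trans _ _ (expR L ^+ #|eset G :&: D v| * expR (- (L * x)))).
    rewrite -expRM_natr -expRD -[leLHS]expR0 ler_expR -mulrBr mulr_ge0 ?(ltW L0) // subr_ge0.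
    apply: (@le_trans _ _ (deg G' v)%:R); last by rewrite ler_nat.
    rewrite /x /a mulrAC ler_pdivrMr // (le_trans (ltW EG)) //.
    by rewrite -natrM ler_nat mulnC.
  by rewrite lerDl sumr_ge0 // => v' _; rewrite !mulr_ge0 ?exprn_ge0 ?expR_ge0.
rewrite /Z; under eq_bigr do rewrite mulr_sumr.
rewrite exchange_big /=.
have term v : \sum_(E : {set {set 'I_n}} | E \subset pairs 'I_n) gnp_weight q E *
    ((set0 \subset E)%:R * expR L ^+ #|E :&: D v| * expR (- (L * x)))
    <= expR (q * n%:R ^+ 2 - L * x).
  under eq_bigr do rewrite mulrA.
  rewrite -mulr_suml expRD ler_wpM2r ?expR_ge0 //.
  have L1 : 1 <= expR L by rewrite -[leLHS]expR0 ler_expR ltW.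
  apply: le_trans (gnp_exp_moment (p01 n) (D v) (sub0set _) L1) _.
  rewrite cards0 expr0 mul1r ler_expR eL expr2.
  have : (n%:R - 1) * q * #|D v|%:R <= n%:R * q * n%:R.
    apply: ler_pM; rewrite ?ler_nat ?mulr_ge0 ?subr_ge0 ?ler1n //.
    by rewrite ler_wpM2r // gerBl.
  by move=> /le_trans; apply; rewrite [n%:R * q]mulrC -mulrA.
apply: le_trans (ler_sum _ (fun v _ => term v)) _.
rewrite sumr_const card_ord -[_ *+ _]mulr_natl -{1}eL -expRD.
(* Half of a L p n^2 cancels p n^2 and the other half is at least 3 L; one L is spent on the union
   over [n] vertices. *)
apply: (@le_trans _ _ (expR (- (2 * L)))).
  rewrite ler_expR /x.
  have h1 : 2 * (q * n%:R ^+ 2) <= a * L * (q * n%:R ^+ 2) by rewrite ler_wpM2r.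
  have h2 : 6 * L <= a * L * (q * n%:R ^+ 2).
    rewrite mulrAC ler_wpM2r ?(ltW L0) // mulrC.
    by rewrite -ler_pdivrMr // (le_trans C6).
  by move: h1 h2; move: (q * n%:R ^+ 2) => y; lra.
rewrite mulrC expRN expRM_natr eL lef_pV2 ?posrE ?exprn_gt0 ?ltr0n //.
rewrite -natrX ler_nat expnS expn1; apply: (@leq_trans (2 * n)%N).
  by rewrite mul2n -addnn -addn1 leq_add2l.
by rewrite leq_mul2r n2 orbT.
Qed.


(** * The case of 2-density at least 1, and the conclusion *)

Section Threshold.
Variables (R : realType) (U : finType) (H : graph U) (n : nat).
Hypothesis m21 : 1 <= m2 R H.
Hypothesis n0 : (0 < n)%N.

Let tau : R := n%:R `^ (- (1 / m2 R H)).

Let n1 : 1 <= n%:R :> R. Proof. by rewrite ler1n. Qed.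

Let mu0 : 0 < m2 R H. Proof. exact: lt_le_trans m21. Qed.

(** This is where 2-density at least 1 enters: tau n^2 is at least n, so exponents of order p n^2
    can beat the exponentially many test sets. *)
Lemma threshold_lower : n%:R <= tau * n%:R ^+ 2.
Proof.
rewrite -[X in X <= _](powRr1 (ler0n R n)) -powR_mulrn // /tau -powRD; last first.
  by rewrite pnatr_eq0 -lt0n n0 implybT.
rewrite ler_powR // div1r.
have : (m2 R H)^-1 <= 1 by rewrite -[leRHS]invr1 lef_pV2 ?posrE.
by lra.
Qed.

(** After taking logarithms to base [n] this is (#|F| - 1) / m2 <= v - 2, the defining inequality of
    the 2-density; a single edge gives equality. *)
Lemma threshold_density (F : {set {set U}}) : F \subset eset H -> F != set0 ->
  n%:R ^+ 2 <= tau ^+ #|F|.-1 * n%:R ^+ #|\bigcup_(a in F) a|.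
Proof.
move=> FH F0; have [F2|F1] := ltnP 1 #|F|; last first.
  have e1 : #|F| = 1%N by apply/eqP; rewrite eqn_leq F1 card_gt0.
  have /cards1P[a ea] : #|F| == 1%N by rewrite e1.
  rewrite e1 expr0 mul1r ea big_set1 (eset_card2 (G := H)) //.
  by rewrite (subsetP FH) // ea set11.
have C3 := card_cover_gt2 FH F2; have := m2_ge R FH F2.
set v := #|_| in C3 *; set j := #|F| in F2 *.
have v2 : 0 < v%:R - 2 :> R by rewrite subr_gt0 ltr_nat.
rewrite ler_pdivrMr // => dens.
have j1 : j.-1%:R = j%:R - 1 :> R by rewrite -subn1 natrB // ltnW.
rewrite /tau -!powR_mulrn ?powR_ge0 // -powRrM -powRD; last first.
  by rewrite pnatr_eq0 -lt0n n0 implybT.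
rewrite ler_powR // j1 div1r mulNr.
have : (m2 R H)^-1 * (j%:R - 1) <= v%:R - 2.
  by rewrite mulrC ler_pdivrMr // mulrC.
by move: ((m2 R H)^-1 * _) => z; lra.
Qed.

Lemma threshold_small (c : R) : 0 < c -> c^-1 `^ m2 R H <= n%:R -> tau <= c.
Proof.
move=> c0 cn; rewrite /tau powRN -[leRHS]invrK lef_pV2 ?posrE ?invr_gt0 ?powR_gt0 //; last first.
  exact: lt_le_trans n1.
have -> : c^-1 = (c^-1 `^ m2 R H) `^ (1 / m2 R H).
  by rewrite -powRrM div1r divff ?lt0r_neq0 // powRr1 // invr_ge0 ltW.
by apply: ge0_ler_powR; rewrite ?nnegrE ?powR_ge0 // div1r invr_ge0 ltW.
Qed.

End Threshold.

(** If the event fails, G' has a container, and by [close_of_container] one of its test sets is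
    overfull in G', hence in G. The constants make the union bound over containers at most
    exp(-n). *)
Lemma aes_dense_case (R : realType) (U : finType) (H : graph U) (gamma : R) :
  0 < gamma -> eset H != set0 -> 1 <= m2 R H -> aes_whp H gamma.
Proof.
move=> g0 E0 m21.
have chi2 := chromatic_ge2 E0.
set r := chromatic_number H in chi2.
have k0 : (0 < r.-1)%N by rewrite -subn1 subn_gt0.
have U0 : (0 < #|U|)%N.
  have /set0Pn[a aH] := E0; have : (0 < #|a|)%N by rewrite (eset_card2 aH).
  by move=> /leq_trans; apply; apply: max_card.
have [eta [eps [n1 [eta0 eta2 eps0 close]]]] :=
  close_of_container chi2 U0 (chromatic_partite H) g0.
have [k [c [c0 cont]]] := copy_containers E0 eps0.
have s0 : 0 < eta ^+ 2 by rewrite exprn_gt0.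
(* [y] is chosen first so that the sum over fingerprints costs at most s p n^2 with s = eta^2 / 32,
   out of the 4 s p n^2 gained by the deviation. The choice of [C] then fits y k m into another s p
   n^2, and the test sets and the final n into the remaining 2 s p n^2. *)
have [y y0 yP] : exists2 y : R, 0 <= y & 2 ^+ k.+1 * expR (- y) <= eta ^+ 2 / 32.
  have z0 : 0 < 2 ^+ k.+1 * 32 / eta ^+ 2 :> R by rewrite divr_gt0 // mulr_gt0 // exprn_gt0.
  exists (2 ^+ k.+1 * 32 / eta ^+ 2); first exact: ltW.
  rewrite expRN ler_pdivrMr ?expR_gt0 //.
  apply: (@le_trans _ _ (eta ^+ 2 / 32 * (2 ^+ k.+1 * 32 / eta ^+ 2))).
    rewrite le_eqVlt; apply/orP; left; apply/eqP.
    by move: (2 ^+ k.+1) (eta ^+ 2) s0 => x z zz0; field; rewrite gt_eqF.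
  rewrite ler_wpM2l //; first by rewrite divr_ge0 // ltW.
  by apply: le_trans (expR_ge1Dx _); rewrite lerDr.
pose s := eta ^+ 2 / 32; have s32 : 0 < s by rewrite divr_gt0.
pose b : R := (r.-1 + 4)%:R + 3.
have b0 : 0 <= b by rewrite addr_ge0.
pose C := 2 * y * k%:R / s + (b + 1) / (2 * s) + #|U|%:R ^+ 2 / gamma.
have C10 : 0 <= 2 * y * k%:R / s by rewrite divr_ge0 ?mulr_ge0 // ltW.
have C20 : 0 < (b + 1) / (2 * s) by rewrite divr_gt0 ?mulr_gt0 // ltr_wpDl.
have C30 : 0 <= #|U|%:R ^+ 2 / gamma by rewrite divr_ge0 ?sqr_ge0 // ltW.
have C0 : 0 < C by rewrite /C; lra.
have C1 : 2 * y * k%:R <= s * C.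
  by rewrite [leRHS]mulrC -ler_pdivrMr // /C; lra.
have C2 : b + 1 <= 2 * s * C.
  by rewrite [leRHS]mulrC -ler_pdivrMr ?mulr_gt0 // /C; lra.
have C3 : #|U|%:R ^+ 2 <= gamma * C.
  by rewrite [leRHS]mulrC -ler_pdivrMr // /C; lra.
exists C => // p p01 [N Np].
exists (maxn N (maxn (maxn 1 n1) (Num.bound (c^-1 `^ m2 R H)))) => n.
rewrite !geq_max => /and3P[nN /andP[n0 nn1] nc]; set q := p n.
have n00 : 0 < n%:R :> R by rewrite ltr0n.
have n1' : 1 <= n%:R :> R by rewrite ler1n.
pose tau : R := n%:R `^ (- (1 / m2 R H)).
have tau0 : 0 < tau by rewrite powR_gt0.
have tauc : tau <= c.
  apply: threshold_small => //; apply: (@le_trans _ _ (Num.bound (c^-1 `^ m2 R H))%:R).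
    by apply/ltW/archi_boundP; apply: powR_ge0.
  by rewrite ler_nat.
have taun : n%:R <= tau * n%:R ^+ 2 by apply: threshold_lower.
have q_ge : C * tau <= q by apply: Np.
have q0 : 0 < q by apply: lt_le_trans q_ge; rewrite mulr_gt0.
(* Rounding up costs at most 1, hence at most a factor 2, as tau n^2 is at least n. *)
have [m mP] : exists m, tau * n%:R ^+ 2 <= m%:R <= 2 * tau * n%:R ^+ 2.
  have t0 : 0 <= tau * n%:R ^+ 2 by rewrite mulr_ge0 ?exprn_ge0 // ltW.
  exists (Num.truncn (tau * n%:R ^+ 2)).+1.
  have /andP[lo hi] := truncn_itv t0.
  rewrite (ltW hi) /= -natr1 -mulrA; move: lo taun n1'.
  by move: (tau * n%:R ^+ 2) => z; lra.
have [f fP] := cont n m tau (introT andP (conj tau0 tauc)) n0 mP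
  (fun F FH F0 => threshold_density m21 n0 FH F0).
(* The intersection with the pairs matters only for tuples that are not fingerprints, on which [f]
   is uncontrolled. *)
pose W (t : {ffun 'I_k -> {set {set 'I_n}}}) : {set {set 'I_n}} :=
  f (mkseq (fun i => if insub i is Some j then t j else set0) k) :&: pairs 'I_n.
pose D t := test_sets r.-1 (W t).
have qn : C * n%:R <= q * n%:R ^+ 2.
  apply: (@le_trans _ _ (C * (tau * n%:R ^+ 2))); first by rewrite ler_pM2l.
  by rewrite mulrA ler_wpM2r ?exprn_ge0.
apply: le_trans (gnp_container_bound (k := k) (m := m) (D := D) (y := y)
  (B := expR (b * n%:R)) (p01 n) eta0 eta2 y0 _ _ _) _.
- by move=> t d /test_sets_sub/subset_trans; apply; apply: subsetIr.
- move=> t; apply: (@le_trans _ _ (3 * (r.-1 + 4) ^ n)%:R).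
    by rewrite ler_nat card_test_sets.
  rewrite natrM natrX expRM_natr /b [X in expR X]addrC expRD exprMn.
  apply: ler_pM; rewrite ?exprn_ge0 //.
    apply: le_trans (_ : expR 3 <= _); first by apply: le_trans (expR_ge1Dx _); lra.
    by rewrite ler_eXnr // -[leLHS]expR0 ler_expR.
  rewrite lerXn2r ?nnegrE ?expR_ge0 //.
  by apply: le_trans (expR_ge1Dx _); rewrite lerDr.
- move=> G _ /not_aes_event[G' [/andP[_ sub] free mind nclose]].
  have VG : (#|vset H| <= #|vset G'|)%N.
    rewrite leqNgt; apply: contra nclose => small.
    apply: (@small_close _ _ _ _ #|U|) => //.
      by apply: ltnW; apply: leq_trans small (max_card _).
    apply: le_trans C3 _; rewrite -mulrA ler_pM2l //.
    by apply: le_trans qn; rewrite ler_peMr // ltW.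
  have ind := free_indep free VG.
  have [ss [ssk ssI If fX few]] := fP _ (eset_pairs G') ind.
  pose t : {ffun 'I_k -> {set {set 'I_n}}} := [ffun i : 'I_k => nth set0 ss i].
  have Wt : W t = f ss.
    rewrite /W (_ : mkseq _ _ = ss); first exact/setIidPl.
    apply: (@eq_from_nth _ set0); rewrite size_mkseq ?ssk // => i ik.
    by rewrite nth_mkseq // insubT ffunE.
  exists t; split.
    move=> i; rewrite ffunE; have /allP/(_ (nth set0 ss i)) := ssI.
    rewrite mem_nth ?ssk // => /(_ isT)/andP[sG sm]; split=> //.
    exact: subset_trans sub.
  apply: contrapT => none; move/negP: nclose; apply.
  rewrite /D Wt in none.
  apply: (close n q (f ss) G' nn1 q0 fX If few).
    move=> d dD; rewrite leNgt; apply/negP => dev; apply: none; exists d => //.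
    apply: lt_le_trans dev _; rewrite ler_nat; apply: subset_leq_card; exact: setSI.
  by move=> v vG; apply: le_trans mind _; rewrite ler_nat min_deg_le.
rewrite -expRD.
apply: (@le_trans _ _ (expR (- n%:R))).
  rewrite ler_expR.
  have h1 : y * (k * m)%:R <= s * (q * n%:R ^+ 2).
    apply: (@le_trans _ _ (y * k%:R * (2 * tau * n%:R ^+ 2))).
      rewrite natrM mulrA ler_wpM2l ?mulr_ge0 //.
      by case/andP: mP.
    apply: (@le_trans _ _ (2 * y * k%:R * (tau * n%:R ^+ 2))); first by rewrite le_eqVlt; apply/orP; left; apply/eqP; ring.
    apply: (@le_trans _ _ (s * C * (tau * n%:R ^+ 2))).
      by rewrite ler_wpM2r // mulr_ge0 ?exprn_ge0 // ltW.
    rewrite -mulrA ler_pM2l // [leLHS]mulrA.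
    by rewrite ler_wpM2r ?exprn_ge0.
  have h2 : 2 ^+ k.+1 * q * expR (- y) * n%:R ^+ 2 <= s * (q * n%:R ^+ 2).
    apply: (@le_trans _ _ (2 ^+ k.+1 * expR (- y) * (q * n%:R ^+ 2))).
      by rewrite [2 ^+ k.+1 * q * _]mulrAC -[leLHS]mulrA.
    by rewrite ler_wpM2r // mulr_ge0 ?exprn_ge0 // ltW.
  have h3 : (b + 1) * n%:R <= 2 * s * (q * n%:R ^+ 2).
    apply: (@le_trans _ _ (2 * s * C * n%:R)); first by rewrite ler_wpM2r.
    by rewrite -mulrA ler_wpM2l ?mulr_ge0 // ltW.
  move: h1 h2 h3; rewrite -/q /s; move: (y * (k * m)%:R) (2 ^+ k.+1 * q * expR (- y) * n%:R ^+ 2) => z1 z2.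
  by lra.
rewrite expRN lef_pV2 ?posrE ?expR_gt0 ?ltr0n //.
by apply: le_trans (expR_ge1Dx _); rewrite -natr1 addrC.
Qed.

Local Open Scope classical_set_scope.
Local Open Scope ring_scope.

Theorem theorem1p13 (R : realType) (U : finType) (H : graph U) (gamma : R)
    (gamma_gt0 : 0 < gamma) :
  exists2 C : R, 0 < C &
    forall p : nat -> R,
      (forall n, 0 <= p n <= 1) ->
      (\forall n \near \oo, C * n%:R `^ (- (1 / m2 R H)) <= p n) ->
      gnp_prob (p n) (fun G : graph 'I_n =>
        [forall G' : graph 'I_n,
          [&& subgraph G' G, free_of H G'
            & (1 - 3 / (3 * (chromatic_number H)%:R - 4) + gamma) * p n * n%:R
                <= (min_deg G')%:R] ==>
          close_to_partite (chromatic_number H).-1 (gamma * p n * n%:R ^+ 2) G'])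
        @[n --> \oo] --> (1 : R).
Proof.
have [C C0 HC] : aes_whp H gamma.
  have [E0|E0] := eqVneq (eset H) finset.set0; first exact: aes_edgeless.
  have [m21|m21] := lerP 1 (m2 R H); first exact: aes_dense_case.
  (* Two intersecting edges would make the 2-density at least 1. *)
  apply: aes_matching => // a b aH bH ab; apply: contraLR m21 => nd.
  by rewrite -leNgt (m2_ge1 _ aH bH ab nd).
exists C => // p p01 [N _ Np].
have [M HM] := HC p p01 (ex_intro _ N Np).
apply: cvg1_of_bound => [n|]; first exact: gnp_prob_le1.
by exists M => // n /= Mn; apply: HM.
Qed.
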